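(* Let $k$ be an integer with $|k|\ge3$ and let $\lambda_\alpha,\lambda_\gamma$ be such that $G_\alpha^\circ\simeq G_\gamma^\circ\simeq G_a$ (notation of the context). Assume that $\Phi=\int\omega y_1x_1^2\,dz$ is algebraic, i.e. $\Phi\in K$. If $\mathrm{VE}_{2,\alpha}^{\gamma}$ is virtually Abelian, then (1), (2), (3) hold: 1. There is $d_\alpha\in\mathbb{C}$ with $\Psi_\alpha-d_\alpha I_\alpha\in K$. 2. There are $d_\gamma,d\in\mathbb{C}$ with $\Psi_\gamma-d_\gamma I_\gamma-dI_\alpha\in K$. 3. If in the previous relations $d_\gamma\neq d_\alpha$, then there is an Ostrowski relation between $I_\gamma$ and $I_\alpha$ (i.e. $I_\gamma,I_\alpha$ are dependent over $K$). Moreover: 4. Conversely, if $\Phi\in K$ and conditions (1), (2), (3) hold, then, independently of the virtual Abelianity of $\mathrm{VE}_{2,\alpha}^{\gamma}$, the integrals $\Psi_\alpha,\Psi_\gamma,\Psi_{2\alpha},\Psi_{\gamma,\alpha},X$ and $M$ can be computed in closed form. Moreover, $\mathrm{VE}_{2,\alpha}^{\gamma}$ is virtually Abelian if and only if $\Psi_{\gamma,2\alpha}$ can also be computed in closed form. 5. Suppose $\Phi\in K$, conditions (1), (2), (3) hold, and $I_\alpha,I_\gamma$ are independent over $K$. Then there is a unique choice of $\Phi$ modulo constants such that $\Psi_\alpha\in K$ and $\Psi_\gamma=dI_\alpha+f$ with $d\in\mathbb{C}$, $f\in K$. For this choice, $\mathrm{VE}_{2,\alpha}^{\gamma}$ is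 virtually Abelian if and only if the following two conditions hold: - the integrals $X$ and $M$ have polynomial expressions $$\begin{pmatrix} M \\ X \end{pmatrix}=\begin{pmatrix} dI_\alpha^2/2 \\ 0 \end{pmatrix}+E\begin{pmatrix} I_\alpha \\ I_\gamma \end{pmatrix}+G,\qquad E\in M_2(\mathbb{C}),\ G\in K^2;$$ - $E$ is symmetric, i.e. writing $M=\frac d2I_\alpha^2+a_MI_\alpha+b_MI_\gamma+g_M$ and $X=a_XI_\alpha+b_XI_\gamma+g_X$ with $a_M,b_M,a_X,b_X\in\mathbb{C}$ and $g_M,g_X\in K$, one has $a_X=b_M$. 6. Suppose $\Phi\in K$, conditions (1), (2) hold, and $I_\alpha,I_\gamma$ are dependent, i.e. $I_\gamma-\theta I_\alpha\in K$ for some $\theta\in\mathbb{C}$. Choose $\Phi$ modulo constants such that $\Psi_\alpha\in K$, and write (2) in the form $\Psi_\gamma-eI_\alpha\in K$ with $e\in\mathbb{C}$. Then $\mathrm{VE}_{2,\alpha}^{\gamma}$ is virtually Abelian if and only if $M+\theta X$ can be written in the polynomial form $$M+\theta X=\frac e2I_\alpha^2+aI_\alpha+g\qquad\text{with }a\in\mathbb{C},\ g\in K.$$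
   Context: Derivation $'=d/dz$. For an integer $k$ with $|k|\ge3$ and $\lambda\in\mathbb{C}$ put $$r_\lambda(z)=\frac{\rho^2-1}{4z^2}+\frac{\sigma^2-1}{4(z-1)^2}-\frac14(1-\rho^2-\sigma^2+\tau^2)\Big(\frac1z+\frac1{1-z}\Big),\quad \rho=\frac1k,\ \sigma=\frac12,\ \tau^2=\frac{(k-2)^2+8k\lambda}{4k^2}.$$ Write $r_\nu=r_{\lambda_\nu}$ for $\nu\in\{\alpha,\gamma\}$. Let $\omega=z^{-(\frac32+\frac1{2k})}(z-1)^{-5/4}$ and $K_0=\mathbb{C}(z)[\omega]$. The system considered, over $K_0$, is $$\mathrm{VE}_{2,\alpha}^{\gamma}:\ x''=r_\alpha x,\quad y''=r_\gamma y+\omega x^2 .$$ It is called virtually Abelian if the identity component of the differential Galois group of its Picard–Vessiot extension $F/K_0$ (with constants $\mathbb{C}$) is Abelian. $G_\nu$ is the differential Galois group of $w''=r_\nu w$ over $\mathbb{C}(z)$ and $G_a$ is the additive group. By the Morales–Ramis classification, $G_\nu^\circ\simeq G_a$ for $\lambda_\nu=p+\frac k2p(p-1)$, $p\in\mathbb{Z}$. In this case $w''=r_\nu w$ has, up to a constant factor, a unique nonzero solution $w_1$ algebraic over $\mathbb{C}(z)$; denote it $x_1$ for $\nu=\alpha$ and $y_1$ for $\nu=\gamma$, and put $I_\alpha=\int x_1^{-2}dz$, $I_\gamma=\int y_1^{-2}dz$. Let $K=K_0[y_1,x_1]$, an algebraic extension of $\mathbb{C}(z)$. A first level integral is a function whose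 derivative lies in $K$. First level integrals are dependent over $K$ if some nontrivial $\mathbb{C}$-linear combination of them lies in $K$ (such a relation is called an Ostrowski relation), and independent otherwise. $\Phi$ is defined up to an additive constant (''a choice of $\Phi$ modulo constants'' means fixing this constant). For one and the same choice of $\Phi$ one sets $$\Psi_\alpha=\int\Phi I_\alpha'\,dz,\quad \Psi_\gamma=\int\Phi I_\gamma'\,dz,\quad \Psi_{2\alpha}=\int\Phi I_\alpha'I_\alpha\,dz,\quad \Psi_{\gamma,\alpha}=\Psi_{\alpha,\gamma}=\int\Phi\,(I_\gamma I_\alpha)'\,dz,$$ $$\Psi_{\gamma,2\alpha}=\int\Phi\,(I_\gamma I_\alpha^2)'\,dz,\quad X=\int\Psi_\alpha I_\alpha'\,dz,\quad M=\int(\Psi_\gamma I_\alpha'+\Psi_\alpha I_\gamma')\,dz .$$ An integral can be computed in closed form if it equals a polynomial in $I_\alpha,I_\gamma$ with coefficients in $K$ plus a first level integral. *)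

(* Defs.v *)
From mathcomp Require Import all_boot all_order all_algebra.
From mathcomp Require Import boolp classical_sets functions reals.
From mathcomp Require Import complex mpoly.

Set Implicit Arguments.
Unset Strict Implicit.
Unset Printing Implicit Defensive.

Import GRing.Theory Num.Theory.
Local Open Scope classical_set_scope.
Local Open Scope ring_scope.

(* A differential field with field of constants exactly C = R[i], together with
   an element z such that z' = 1.  As z is then transcendental over C, this is
   a differential extension of (C(z), d/dz) without new constants.  All the
   functions of the theory (algebraic functions, integrals, solutions of
   differential systems) are elements of one such field, which plays the role
   of a universal extension. *)
Record diffExt (R : realType) := DiffExt {
  carrier :> fieldType;
  der : {additive carrier -> carrier};
  cstC : {rmorphism R[i] -> carrier};
  zvar : carrier;
  derM : forall a b, der (a * b) = der a * b + a * der b;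
  der_eq0P : forall a, der a = 0 <-> exists c, a = cstC c;
  der_zvar : der zvar = 1
}.

Arguments der {R d}.
Arguments cstC {R d}.
Arguments zvar {R d}.

Section Subfields.
Variables (R : realType) (L : diffExt R).
Implicit Types (E : set L).

Definition subfield E : Prop := GRing.divring_closed (mem E).

Definition adjoin E (S : set L) : set L := smallest subfield (E `|` S).

Definition Cz : set L := adjoin (range cstC) [set zvar].

Definition algebraic_over E (a : L) : Prop :=
  exists p : {poly L}, [/\ p != 0, forall i, E p`_i & root p a].

End Subfields.

Arguments Cz {R L}.

Section Zariski.
Variables (R : realType) (n : nat).
Implicit Types (G A S : set 'M[R[i]]_n) (M : 'M[R[i]]_n).

Definition mxeval (p : {mpoly R[i][n * n]}) M : R[i] :=
  p.@[fun i => mxvec M 0 i].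

Definition zariski_closed S : Prop :=
  exists I : set {mpoly R[i][n * n]},
    S = [set M | forall p, I p -> mxeval p M = 0].

Definition zariski_connected A : Prop :=
  forall S T, zariski_closed S -> zariski_closed T ->
    A `<=` S `|` T -> A `&` (S `&` T) = set0 -> A `<=` S \/ A `<=` T.

Definition identity_component G : set 'M[R[i]]_n :=
  [set M | exists A, [/\ A `<=` G, zariski_connected A, A 1%:M & A M]].

(* G is isomorphic to the additive group as a linear algebraic group: both the
   parametrization t |-> f(t) and its inverse are regular, the regular
   functions on GL_n being generated by the matrix entries and 1/det. *)
Definition isomorphic_Ga G : Prop :=
  exists f : R[i] -> 'M[R[i]]_n,
    [/\ exists q : 'M[{poly R[i]}]_n,
          forall t, f t = map_mx (fun p : {poly R[i]} => p.[t]) q,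
        forall s t, f (s + t) = f s *m f t,
        range f = G &
        exists (p : {mpoly R[i][n * n]}) (m : nat),
          forall t, mxeval p (f t) / (\det (f t)) ^+ m = t].

Definition abelian_mx G : Prop :=
  forall M N, G M -> G N -> M *m N = N *m M.

End Zariski.

Section PicardVessiot.
Variables (R : realType) (L : diffExt R) (n : nat).
Implicit Types (K F : set L) (A Y : 'M[L]_n).

Definition fundamental_matrix A Y : Prop :=
  Y \in unitmx /\ map_mx der Y = A *m Y.

(* If A has entries in the differential subfield K containing the constants and
   Y is a fundamental matrix of Y' = A Y, this is the Picard-Vessiot extension
   of K for that system; there are no new constants because L has none. *)
Definition pv_ext K Y : set L := adjoin K [set a | exists i j, a = Y i j].

Definition diff_aut K F (s : L -> L) : Prop :=
  [/\ set_bij F F s,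
      {in F &, {morph s : a b / a + b}},
      {in F &, {morph s : a b / a * b}},
      {in F, forall a, s (der a) = der (s a)} &
      {in K, forall a, s a = a}].

(* The group of the extension pv_ext K Y / K, as a group of matrices through
   its action on Y. *)
Definition diff_galois K Y : set 'M[R[i]]_n :=
  [set M | exists2 s, diff_aut K (pv_ext K Y) s &
                      map_mx s Y = Y *m map_mx cstC M].

Definition galois_component_Ga K Y : Prop :=
  isomorphic_Ga (identity_component (diff_galois K Y)).

Definition virtually_abelian K Y : Prop :=
  abelian_mx (identity_component (diff_galois K Y)).

End PicardVessiot.

Section Equations.
Variables (R : realType) (L : diffExt R).

Definition mx_of_rows n (s : seq (seq L)) : 'M[L]_n :=
  \matrix_(i < n, j < n) nth 0 (nth [::] s i) j.

Definition rho (k : int) : R[i] := k%:~R^-1.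
Definition sigma : R[i] := 2%:R^-1.
Definition tau2 (k : int) (lam : R[i]) : R[i] :=
  ((k%:~R - 2%:R) ^+ 2 + 8%:R * k%:~R * lam) / (4%:R * k%:~R ^+ 2).

Definition rfun (k : int) (lam : R[i]) : L :=
  cstC (rho k ^+ 2 - 1) / (4%:R * zvar ^+ 2)
  + cstC (sigma ^+ 2 - 1) / (4%:R * (zvar - 1) ^+ 2)
  - 4%:R^-1 * cstC (1 - rho k ^+ 2 - sigma ^+ 2 + tau2 k lam)
    * (zvar^-1 + (1 - zvar)^-1).

(* w'' = r w in the unknowns (w, w') *)
Definition companion (r : L) : 'M[L]_2 :=
  mx_of_rows 2 [:: [:: 0; 1];
                   [:: r; 0]].

(* x'' = ra x, y'' = rc y + omega x^2, as the linear differential system it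
   induces on (x, x', x^2, x x', x'^2, y, y').  The entries of a fundamental
   matrix generate the same field as the components x, x', y, y' of all the
   solutions. *)
Definition VE2 (ra rc omega : L) : 'M[L]_7 :=
  mx_of_rows 7
    [:: [:: 0;  1; 0;     0;         0; 0;  0];
        [:: ra; 0; 0;     0;         0; 0;  0];
        [:: 0;  0; 0;     2%:R;      0; 0;  0];
        [:: 0;  0; ra;    0;         1; 0;  0];
        [:: 0;  0; 0;     2%:R * ra; 0; 0;  0];
        [:: 0;  0; 0;     0;         0; 0;  1];
        [:: 0;  0; omega; 0;         0; rc; 0]].

(* omega = z^-(3/2 + 1/(2k)) (z-1)^-(5/4): the relation fixes omega up to a
   root of unity, i.e. up to the choice of a branch. *)
Definition is_omega (k : int) (omega : L) : Prop :=
  omega ^ (4 * k) = zvar ^ (- (6 * k + 2)) * (zvar - 1) ^ (- (5 * k)).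

(* C(z)[omega] is already a field, omega being algebraic; likewise below. *)
Definition K0 (omega : L) : set L := adjoin Cz [set omega].

Definition Kalg (omega x1 y1 : L) : set L :=
  adjoin (K0 omega) [set y1; x1].

Definition algebraic_solution (r w : L) : Prop :=
  [/\ w != 0, der (der w) = r * w & algebraic_over Cz w].

End Equations.

Section Integrals.
Variables (R : realType) (L : diffExt R) (K : set L).

Definition first_level (J : L) : Prop := K (der J).

Definition dependent (f g : L) : Prop :=
  exists a b : R[i], (a != 0 \/ b != 0) /\ K (cstC a * f + cstC b * g).

(* closed form with respect to the integrals Ia and Ic *)
Definition closed_form (Ia Ic f : L) : Prop :=
  exists (P : {poly {poly L}}) (J : L),
    [/\ forall i j, K (P`_i)`_j, first_level J & f = P.[Ia%:P].[Ic] + J].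

Definition cond1 (Ia Psia : L) : Prop :=
  exists da : R[i], K (Psia - cstC da * Ia).

Definition cond2 (Ia Ic Psic : L) : Prop :=
  exists dc d : R[i], K (Psic - cstC dc * Ic - cstC d * Ia).

Definition cond3 (Ia Ic Psia Psic : L) : Prop :=
  forall da dc d : R[i],
    K (Psia - cstC da * Ia) -> K (Psic - cstC dc * Ic - cstC d * Ia) ->
    dc != da -> dependent Ic Ia.

End Integrals.

(* Main.v *)
From HB Require Import structures.
Require Import Defs.
From mathcomp Require Import all_boot all_order all_algebra.
From mathcomp Require Import boolp classical_sets functions reals.
From mathcomp Require Import complex mpoly ring.

(** Put x2 = x1 Ia and y2 = y1 Ic, which complete x1 and y1 to bases of solutions
    of the two linear equations, and let F be the Picard-Vessiot extension of the
    second variational system.  Variation of constants expresses every solution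
    as a polynomial over K in the iterated integrals
      Ia, Ic, Psia, Psic (first level), Psi2a, Psica (second), Psic2a (third),
    where Psi2a, Psica and Psic2a are primitives of Phi Ia' Ia, Phi (Ic Ia)' and
    Phi (Ic Ia^2)' ([sym_square_solution], [forced_solution]); all of them lie
    in F and generate F over K.

    Virtual abelianity means that the differential automorphisms of F over K
    commute.  One direction: K is algebraic over K_0, so that the identity
    component, being connected, fixes K ([identity_component_fixes]); when the
    integrals have closed forms, automorphisms over K translate Ia, Ic and the
    first level parts by constants, hence commute
    ([closed_form_virtually_abelian]).  The other direction: an automorphism over K acts on a fundamental matrix by a
    unipotent M, and the powers of M are polynomial in the exponent, hence form
    an irreducible, so connected, set: M is in the identity component
    ([unipotent_identity_component], [virtually_abelian_commute]).  There are
    enough automorphisms: a first level integral outside K is transcendental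
    over K, can be translated by 1, and this extends up the tower of integrals
    one primitive at a time ([extend_embedding], [galois_moves]).  In particular
    a first level integral fixed by all automorphisms is in K.  Finally Ia is
    not in K, as otherwise all solutions of the first equation would be algebraic
    and its group would be finite ([Ia_notin_K]).

    What remains is linear algebra.  Let s translate Ia, Ic by a_s, b_s and first
    level integrals f, g by f_s, g_s.  If W' = f' Ia + g' Ic, then
      s W = W + a_s f + b_s g + constant,
    so that s and t commute on W iff a_t f_s + b_t g_s is symmetric in s and t
    ([commuting_pairing]).  For W = Psi2a, where f = Psia and g = 0, this makes
    the translations of Psia proportional to those of Ia: Psia - d Ia is in K.
    For W = Psica, where f = Psic and g = Psia, the same argument applies to
    Psic - d Ic and gives Psic - d Ic - e Ia in K, with the same d.  These two
    relations are the normal form of the three necessary conditions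
    ([virtually_abelian_normal], [normal_cond], [cond_normal]).

    Given the normal form, integration by parts expresses all the integrals but
    Psic2a in closed form and reduces Psic2a to a primitive of N' Ia + X' Ic,
    where X and N are first level integrals ([third_level_reduction]).  Commuting
    on it means, when Ia and Ic are independent, that (N, X) is a symmetric
    matrix times (Ia, Ic) modulo K, by Cartan's lemma ([cartan_shift]); when
    Ic - theta Ia is in K, it means that N + theta X is a multiple of Ia modulo K.
    Conversely such relations integrate N' Ia + X' Ic by parts
    ([closed_independent], [closed_dependent]). *)

Set Implicit Arguments.
Unset Strict Implicit.
Unset Printing Implicit Defensive.

Import Order.TTheory GRing.Theory Num.Theory.
Local Open Scope classical_set_scope.
Local Open Scope ring_scope.

(** * Derivations and subfields *)
Section Derivation.
Variables (R : realType) (L : diffExt R).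
Implicit Types a b t : L.

Lemma der_cst (c : R[i]) : der (cstC c : L) = 0.
Proof. by apply/der_eq0P; exists c. Qed.

Lemma der_nat n : der (n%:R : L) = 0.
Proof. by rewrite -(rmorph_nat (@cstC _ L)) der_cst. Qed.

Lemma der1 : der (1 : L) = 0.
Proof. exact: (der_nat 1). Qed.

Lemma derD a b : der (a + b) = der a + der b.
Proof. exact: raddfD. Qed.

Lemma derB a b : der (a - b) = der a - der b.
Proof. exact: raddfB. Qed.

Lemma derN a : der (- a) = - der a.
Proof. exact: raddfN. Qed.

Lemma der_sqr a : der (a ^+ 2) = 2%:R * a * der a.
Proof. by rewrite expr2 derM; ring. Qed.

Lemma derV a : der a^-1 = - der a / a ^+ 2.
Proof.
have [->|a0] := eqVneq a 0; first by rewrite invr0 raddf0 oppr0 mul0r.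
have : der (a * a^-1) = 0 by rewrite divff // der1.
rewrite derM => h.
apply: (mulfI a0); move/eqP: h; rewrite addrC addr_eq0 => /eqP ->; field.
exact: a0.
Qed.

Lemma der_inj a b : der a = der b -> exists c, a = b + cstC c.
Proof.
move=> h; have : der (a - b) = 0 by rewrite raddfB h subrr.
by case/der_eq0P => c hc; exists c; rewrite -hc addrC subrK.
Qed.

Lemma cst_inj : injective (@cstC _ L).
Proof. exact: fmorph_inj. Qed.

Lemma natS_neq0 n : (n.+1%:R : L) != 0.
Proof. by rewrite -(rmorph_nat (@cstC _ L)) fmorph_eq0 pnatr_eq0. Qed.

Lemma der_horner (p : {poly L}) t :
  der p.[t] = (map_poly der p).[t] + p^`().[t] * der t.
Proof.
elim/poly_ind: p => [|p c IH].
  by rewrite horner0 raddf0 map_poly0 deriv0 !horner0 mul0r addr0.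
rewrite derivD derivM derivX derivC.
have -> : map_poly der (p * 'X + c%:P) = map_poly der p * 'X + (der c)%:P.
  apply/polyP => i; rewrite !(coef_map, coefD, coefMX, coefC, raddfD).
  by case: i => [|i] /=; rewrite ?raddf0.
rewrite !hornerE raddfD derM IH /=; ring.
Qed.

End Derivation.

Definition derE := (derD, derB, derN, der_sqr, derM, derV, der_cst, der_nat).

Section Subfields.
Variables (R : realType) (L : diffExt R) (E : set L).
Hypothesis hE : subfield E.
Implicit Types a b t : L.

Lemma sfB a b : E a -> E b -> E (a - b).
Proof. by case: hE => _ h _ Ea Eb; apply/set_mem/h; apply/mem_set. Qed.
Lemma sf1 : E 1.
Proof. by case: hE => h _ _; apply/set_mem. Qed.
Lemma sf0 : E 0.
Proof. by rewrite -(subrr 1); apply: sfB sf1 sf1. Qed.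
Lemma sfN a : E a -> E (- a).
Proof. by move=> Ea; rewrite -sub0r; apply: sfB sf0 Ea. Qed.
Lemma sfD a b : E a -> E b -> E (a + b).
Proof. by move=> Ea Eb; rewrite -[b]opprK; apply/sfB/sfN. Qed.
Lemma sfdiv a b : E a -> E b -> E (a / b).
Proof. by case: hE => _ _ h Ea Eb; apply/set_mem/h; apply/mem_set. Qed.
Lemma sfV a : E a -> E a^-1.
Proof. by move=> Ea; rewrite -div1r; apply: sfdiv sf1 Ea. Qed.
Lemma sfM a b : E a -> E b -> E (a * b).
Proof. by move=> Ea Eb; rewrite -[b]invrK; apply/sfdiv/sfV. Qed.
Lemma sfX a n : E a -> E (a ^+ n).
Proof.
by move=> Ea; elim: n => [|n IH]; [exact: sf1|rewrite exprS; apply: sfM].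
Qed.
Lemma sf_nat n : E n%:R.
Proof. by elim: n => [|n IH]; [exact: sf0|rewrite -addn1 natrD; apply: sfD sf1]. Qed.
Lemma sfXz a (n : int) : E a -> E (a ^ n).
Proof. by case: n => n Ea; rewrite ?NegzE -?exprnP; [|apply: sfV]; apply: sfX. Qed.
Lemma sf_sum (I : Type) (r : seq I) (P : pred I) (F : I -> L) :
  (forall i, P i -> E (F i)) -> E (\sum_(i <- r | P i) F i).
Proof. by move=> h; apply: big_ind => //; [exact: sf0|exact: sfD]. Qed.
Lemma sf_horner (p : {poly L}) t : (forall i, E p`_i) -> E t -> E p.[t].
Proof.
by move=> hp Et; rewrite horner_coef; apply: sf_sum => i _; apply: sfM (sfX _ _).
Qed.

End Subfields.

Lemma subfieldI (R : realType) (L : diffExt R) (E : set L) :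
  E 1 -> (forall a b, E a -> E b -> E (a - b)) ->
  (forall a b, E a -> E b -> E (a * b)) ->
  (forall a, E a -> E a^-1) -> subfield E.
Proof.
move=> h1 hB hM hV; split=> [|a b|a b]; first exact/mem_set.
  by move=> /set_mem ? /set_mem ?; apply/mem_set/hB.
by move=> /set_mem ? /set_mem ?; apply/mem_set/hM => //; apply: hV.
Qed.

Section Adjoin.
Variables (R : realType) (L : diffExt R).
Implicit Types (E F S : set L).

Lemma adjoin_subfield E S : subfield (adjoin E S).
Proof.
split=> [|a b /set_mem ha /set_mem hb|a b /set_mem ha /set_mem hb];
  apply/mem_set => F [hF hsub].
- exact: sf1.
- by apply: sfB => //; [apply: ha|apply: hb].
- by apply: sfdiv => //; [apply: ha|apply: hb].
Qed.

Lemma adjoin_base E S : E `<=` adjoin E S.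
Proof. by move=> a Ea F [_]; apply; left. Qed.

Lemma adjoin_gen E S : S `<=` adjoin E S.
Proof. by move=> a Ea F [_]; apply; right. Qed.

Lemma adjoin_min E S F :
  subfield F -> E `<=` F -> S `<=` F -> adjoin E S `<=` F.
Proof. by move=> hF hE hS a h; apply: (h F); split=> // b []; [apply: hE|apply: hS]. Qed.

Definition diff_subfield E : Prop :=
  [/\ subfield E, forall c, E (cstC c) & forall a, E a -> E (der a)].

(** Reduces stability of a generated field under the derivation to its generators. *)
Lemma der_stable_subfield E : subfield E -> subfield [set a | E a /\ E (der a)].
Proof.
move=> hE; apply: subfieldI => [|a b [? ?] [? ?]|a b [? ?] [? ?]|a [? ?]]; split.
- exact: (sf1 hE).
- by rewrite der1; apply: (sf0 hE).
- exact: (sfB hE).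
- by rewrite derB; apply: (sfB hE).
- exact: (sfM hE).
- by rewrite derM; apply: (sfD hE); apply: (sfM hE).
- exact: (sfV hE).
- by rewrite derV; apply: (sfdiv hE (sfN hE _) (sfX hE _ _)).
Qed.

Lemma der_adjoin E S : diff_subfield E -> (forall a, S a -> adjoin E S (der a)) ->
  diff_subfield (adjoin E S).
Proof.
case=> hE hC hD hS; have hA := adjoin_subfield E S.
split=> //; first by move=> c; apply: adjoin_base.
suff h : adjoin E S `<=` [set a | adjoin E S a /\ adjoin E S (der a)].
  by move=> a /h [].
apply: adjoin_min => [|a Ea|a Sa]; first exact: der_stable_subfield.
- by split; apply: adjoin_base => //; apply: hD.
- by split; [apply: adjoin_gen|apply: hS].
Qed.

Lemma Cz_dsub : diff_subfield (Cz : set L).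
Proof.
have hA : subfield (Cz : set L) := adjoin_subfield _ _.
split=> //; first by move=> c; apply: adjoin_base; exists c.
suff h : Cz `<=` [set a : L | Cz a /\ Cz (der a)] by move=> a /h [].
apply: adjoin_min => [|a [c _ <-]|a ->]; first exact: der_stable_subfield.
- by split; [apply: adjoin_base; exists c|rewrite der_cst; apply: (sf0 hA)].
- by split; [apply: adjoin_gen|rewrite der_zvar; apply: (sf1 hA)].
Qed.

End Adjoin.

(** * Primitives and algebraic elements *)
Section Primitive.
Variables (R : realType) (L : diffExt R) (E : set L).
Hypothesis hE : diff_subfield E.
Implicit Types a b t : L.

Let sE : subfield E. Proof. by case: hE. Qed.

(** A relation p(t) = 0 of minimal degree, made monic, has a derivative of smaller
    degree, which must vanish identically; its coefficient of degree deg p - 1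
    says that t, up to a constant, is in E.  This is Ostrowski's theorem for one
    integral. *)
Lemma primitive_transcendental t (p : {poly L}) :
  E (der t) -> ~ E t -> (forall i, E p`_i) -> root p t -> p = 0.
Proof.
case: hE => _ hC hD Et' Et.
elim: {p}(size p) {-2}p (leqnn (size p)) => [p|n IH p].
  by rewrite leqn0 size_poly_eq0 => /eqP.
move=> sp hp rp; apply/eqP/negPn/negP => p0.
pose c := lead_coef p; have c0 : c != 0 by rewrite lead_coef_eq0.
pose q := c^-1 *: p.
have hq i : E q`_i by rewrite coefZ; apply: (sfM sE) => //; apply: sfV => //; apply: hp.
have sq : (size q <= n.+1)%N by rewrite size_scale ?invr_eq0.
have mq : q \is monic by rewrite monicE lead_coefZ mulVf.
have rq : q.[t] = 0 by rewrite hornerZ (rootP rp) mulr0.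
pose d := map_poly der q + q^`() * (der t)%:P.
have hd i : d`_i = der q`_i + q`_i.+1 *+ i.+1 * der t.
  by rewrite coefD coef_map coefMC coef_deriv.
have d0 : d = 0.
  apply: IH => [|i|].
  - apply/leq_sizeP => j hj; rewrite hd.
    have -> : q`_j.+1 = 0 by apply: (leq_sizeP _ _ sq); rewrite ltnS.
    rewrite mul0rn mul0r addr0.
    have [jn|nj] := leqP n.+1 j; first by rewrite (leq_sizeP _ _ sq) ?raddf0.
    have jn : j = n by apply/eqP; rewrite eqn_leq hj andbT -ltnS.
    have [hs|hs] := leqP (size q) j; first by rewrite (leq_sizeP _ _ hs) ?raddf0.
    have hsq : size q = n.+1 by apply/eqP; rewrite eqn_leq sq -jn.
    have -> : q`_j = 1 by move/monicP: mq; rewrite /lead_coef hsq /= jn.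
    exact: der1.
  - rewrite hd -mulr_natr; apply: (sfD sE) => //; first exact: hD.
    by apply: (sfM sE) => //; apply: (sfM sE) => //; apply: sf_nat.
  - apply/rootP; rewrite hornerD hornerM hornerC.
    by rewrite -der_horner rq raddf0.
have q0 : q != 0 by apply: monic_neq0.
have [m hm] : exists m, size q = m.+2.
  case hs: (size q) => [|[|m]]; last by exists m.
    by move/eqP: hs; rewrite size_poly_eq0 (negbTE q0).
  have/size1_polyC hq1 : (size q <= 1)%N by rewrite hs.
  move: rq; rewrite hq1 hornerC => h0.
  by move: q0; rewrite hq1 h0 eqxx.
(* the subleading coefficient: q is monic of degree m + 1 *)
have := hd m; rewrite d0 coef0.
have -> : q`_m.+1 = 1 by move/monicP: mq; rewrite /lead_coef hm.
move=> h; have : der (q`_m + m.+1%:R * t) = 0.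
  by rewrite raddfD derM der_nat mul0r add0r.
case/der_eq0P => e he; apply: Et.
have -> : t = (cstC e - q`_m) / m.+1%:R.
  by rewrite -he addrC addKr mulrC mulKf // natS_neq0.
apply: (sfdiv sE); last exact: (sf_nat sE).
by apply: (sfB sE).
Qed.

(** Differentiating a relation p(a) = 0 of minimal degree expresses a' as
    - p^der(a) / p'(a), where p^der has the derivatives of the coefficients. *)
Lemma der_algebraic a : algebraic_over E a -> adjoin E [set a] (der a).
Proof.
case: hE => _ hC hD; case=> p [p0 hp rp].
have hA := adjoin_subfield E [set a].
elim: {p}(size p) {-2}p (leqnn (size p)) p0 hp rp => [p|n IH p].
  by rewrite leqn0 size_poly_eq0 => /eqP ->; rewrite eqxx.
move=> sp p0 hp rp; have [ra|ra] := boolP (root p^`() a).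
  apply: (IH p^`()) => //.
  - by rewrite -ltnS; apply: leq_trans sp; apply: lt_size_deriv.
  - have [m hm] : exists m, size p = m.+2.
      case hs: (size p) => [|[|m]]; last by exists m.
        by move/eqP: hs; rewrite size_poly_eq0 (negbTE p0).
      have/size1_polyC hq1 : (size p <= 1)%N by rewrite hs.
      move: rp p0; rewrite hq1 => /rootP; rewrite hornerC => ->.
      by rewrite eqxx.
    apply/eqP => /polyP /(_ m); rewrite coef_deriv coef0 => /eqP.
    rewrite -mulr_natr mulf_eq0 (negbTE (natS_neq0 _ _)) orbF => h.
    by move: p0; rewrite -lead_coef_eq0 /lead_coef hm /= h.
  - by move=> i; rewrite coef_deriv -mulr_natr; apply: (sfM sE) => //; apply: sf_nat.
have : der p.[a] = 0 by rewrite (rootP rp) raddf0.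
rewrite der_horner => /eqP; rewrite addrC addr_eq0 => /eqP h.
have -> : der a = - (map_poly der p).[a] / p^`().[a].
  by rewrite -h mulrC mulKf.
have Aa : adjoin E [set a] a by apply: adjoin_gen.
apply: (sfdiv hA); [apply: (sfN hA)|]; apply: (sf_horner hA) => // i.
  by rewrite coef_map; apply: adjoin_base; apply: hD.
rewrite coef_deriv -mulr_natr; apply: (sfM hA); last exact: (sf_nat hA).
exact: adjoin_base.
Qed.

End Primitive.

(** A subfield given as a set is repackaged as a field type, which gives access to
    polynomial rings over it and to the theory of algebraic elements. *)
Section SubfieldType.
Variables (R : realType) (L : diffExt R) (E : set L).
Definition subfield_pred (hE : subfield E) : {pred L} := mem E.
Variable hE : subfield E.
HB.instance Definition _ := GRing.isDivringClosed.Build L (subfield_pred hE) hE.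
Record subfieldType := SubfieldType { sfval : L; sfvalP : sfval \in subfield_pred hE }.
HB.instance Definition _ := [isSub for sfval].
HB.instance Definition _ := [Choice of subfieldType by <:].
HB.instance Definition _ := [SubChoice_isSubIntegralDomain of subfieldType by <:].
HB.instance Definition _ := [SubIntegralDomain_isSubField of subfieldType by <:].

Fact sfval_zmod : zmod_morphism sfval.
Proof. exact: (raddfB (val : subfieldType -> L)). Qed.
Fact sfval_monoid : monoid_morphism sfval.
Proof.
split; first exact: (rmorph1 (val : subfieldType -> L)).
exact: (rmorphM (val : subfieldType -> L)).
Qed.
HB.instance Definition _ :=
  GRing.isZmodMorphism.Build subfieldType L sfval sfval_zmod.
HB.instance Definition _ :=
  GRing.isMonoidMorphism.Build subfieldType L sfval sfval_monoid.

Lemma subfieldType_ex a : E a -> exists x : subfieldType, sfval x = a.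
Proof. by move=> Ea; exists (SubfieldType (mem_set Ea : a \in subfield_pred hE)). Qed.

Lemma sfval_in (x : subfieldType) : E (sfval x).
Proof. exact/set_mem/sfvalP. Qed.

Lemma poly_lift (p : {poly L}) : (forall i, E p`_i) ->
  exists q : {poly subfieldType}, p = map_poly sfval q.
Proof.
move=> hp; have h i : {x : subfieldType | sfval x = p`_i}.
  by apply: cid; apply: subfieldType_ex.
exists (\poly_(i < size p) sval (h i)).
apply/polyP => i; rewrite coef_map coef_poly; case: ltnP => hi /=.
  by rewrite (svalP (h i)).
by rewrite nth_default // raddf0.
Qed.

Lemma algebraic_overP a : algebraic_over E a <-> algebraicOver sfval a.
Proof.
split=> [[p [p0 hp rp]]|[q q0 rq]].
  have [q hq] := poly_lift hp; exists q; last by rewrite -hq.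
  by move: p0; rewrite hq map_poly_eq0.
exists (map_poly sfval q); split=> //; first by rewrite map_poly_eq0.
by move=> i; rewrite coef_map; apply: sfval_in.
Qed.

Lemma algebraic_subfield : subfield [set a | algebraic_over E a].
Proof.
apply: subfieldI => [|a b|a b|a] /=.
- exact/algebraic_overP/algebraic1.
- by move=> /algebraic_overP ha /algebraic_overP hb; exact/algebraic_overP/algebraic_sub.
- by move=> /algebraic_overP ha /algebraic_overP hb; exact/algebraic_overP/algebraic_mul.
- by move=> /algebraic_overP ha; exact/algebraic_overP/algebraic_inv.
Qed.

Lemma algebraic_base a : E a -> algebraic_over E a.
Proof.
by case/subfieldType_ex => x <-; apply/algebraic_overP; apply: algebraic_id.
Qed.

End SubfieldType.
Arguments sfval {R L E hE}.

(** * Extension of differential embeddings *)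
(** Only the values on E matter: s is a function on all of L so that no type of
    elements of E is needed. *)
Definition diff_embedding (R : realType) (L : diffExt R) (E : set L) (s : L -> L) :=
  [/\ forall c, s (cstC c) = cstC c,
      forall a b, E a -> E b -> s (a - b) = s a - s b,
      forall a b, E a -> E b -> s (a * b) = s a * s b &
      forall a, E a -> s (der a) = der (s a)].

Section Embeddings.
Variables (R : realType) (L : diffExt R) (E : set L) (s : L -> L).
Hypotheses (hE : diff_subfield E) (hs : diff_embedding E s).

Let sE : subfield E. Proof. by case: hE. Qed.

Lemma emb0 : s 0 = 0.
Proof. by case: hs => h _ _ _; rewrite -(rmorph0 (@cstC _ L)) h. Qed.
Lemma emb1 : s 1 = 1.
Proof. by case: hs => h _ _ _; rewrite -(rmorph1 (@cstC _ L)) h. Qed.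
Lemma embB a b : E a -> E b -> s (a - b) = s a - s b.
Proof. by case: hs => _ + _ _; apply. Qed.
Lemma embM a b : E a -> E b -> s (a * b) = s a * s b.
Proof. by case: hs => _ _ + _; apply. Qed.
Lemma emb_der a : E a -> s (der a) = der (s a).
Proof. by case: hs => _ _ _; apply. Qed.
Lemma emb_cst c : s (cstC c) = cstC c.
Proof. by case: hs. Qed.
Lemma embN a : E a -> s (- a) = - s a.
Proof. by move=> Ea; rewrite -sub0r embB ?emb0 ?sub0r //; apply: (sf0 sE). Qed.
Lemma embD a b : E a -> E b -> s (a + b) = s a + s b.
Proof.
by move=> Ea Eb; rewrite -{1}[b]opprK embB ?embN ?opprK //; apply: (sfN sE).
Qed.
Lemma embX a n : E a -> s (a ^+ n) = s a ^+ n.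
Proof.
by move=> Ea; elim: n => [|n IH]; rewrite ?emb1 // !exprS embM ?IH //; apply: (sfX sE).
Qed.
Lemma embV a : E a -> s a^-1 = (s a)^-1.
Proof.
move=> Ea; have [->|a0] := eqVneq a 0; first by rewrite invr0 emb0 invr0.
have h : s a * s a^-1 = 1 by rewrite -embM ?divff ?emb1 //; apply: (sfV sE).
have sa0 : s a != 0.
  by apply/eqP => sa; move/eqP: h; rewrite sa mul0r eq_sym oner_eq0.
by apply: (mulfI sa0); rewrite h divff.
Qed.
Lemma emb_eq0 a : E a -> s a = 0 -> a = 0.
Proof.
move=> Ea sa; apply/eqP/negPn/negP => a0.
have := embM Ea (sfV sE Ea); rewrite divff // emb1 sa mul0r.
by move/eqP; rewrite oner_eq0.
Qed.
Lemma emb_inj a b : E a -> E b -> s a = s b -> a = b.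
Proof.
move=> Ea Eb h; apply/eqP; rewrite -subr_eq0; apply/eqP/emb_eq0.
  exact: (sfB sE).
by rewrite embB // h subrr.
Qed.
Lemma emb_sum (I : Type) (r : seq I) (F : I -> L) :
  (forall i, E (F i)) -> s (\sum_(i <- r) F i) = \sum_(i <- r) s (F i).
Proof.
move=> h; elim: r => [|i r IH]; first by rewrite !big_nil emb0.
by rewrite !big_cons embD ?IH //; apply: (sf_sum sE).
Qed.

Lemma emb_image_dsub : diff_subfield (s @` E).
Proof.
case: (hE) => _ hC hD; split; last 2 first.
- by move=> c; exists (cstC c); [exact: hC|exact: emb_cst].
- by move=> _ [a Ea <-]; exists (der a); [exact: hD|exact: emb_der].
apply: subfieldI => [|_ _ [a Ea <-] [b Eb <-]|_ _ [a Ea <-] [b Eb <-]|_ [a Ea <-]].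
- by exists 1; [exact: (sf1 sE)|exact: emb1].
- by exists (a - b); [exact: (sfB sE)|exact: embB].
- by exists (a * b); [exact: (sfM sE)|exact: embM].
- by exists a^-1; [exact: (sfV sE)|exact: embV].
Qed.

Definition emb_val of diff_embedding E s := fun x : subfieldType sE => s (sfval x).

Fact emb_val_zmod : zmod_morphism (emb_val hs).
Proof. by move=> x y; rewrite /emb_val raddfB /= embB //; apply: sfval_in. Qed.
Fact emb_val_monoid : monoid_morphism (emb_val hs).
Proof.
split; first by rewrite /emb_val rmorph1 emb1.
by move=> x y; rewrite /emb_val rmorphM /= embM //; apply: sfval_in.
Qed.
HB.instance Definition _ :=
  GRing.isZmodMorphism.Build (subfieldType sE) L (emb_val hs) emb_val_zmod.
HB.instance Definition _ :=
  GRing.isMonoidMorphism.Build (subfieldType sE) L (emb_val hs) emb_val_monoid.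

(** When t is outside E, it is transcendental over E, and u is transcendental over
    s(E): otherwise u = s(a) for some a in E, whence a' = t' and t would be in E.
    So p(t)/q(t) |-> p^s(u)/q^s(u) is well defined, and any primitive u of s(t')
    can be prescribed as the image of t.  When t is in E, its image is forced, and
    still differs from u by a constant. *)
Lemma extend_embedding t u : E (der t) -> der u = s (der t) ->
  exists s', [/\ diff_embedding (adjoin E [set t]) s',
                 forall a, E a -> s' a = s a,
                 ~ E t -> s' t = u &
                 exists c, s' t = u + cstC c].
Proof.
move=> Et' hu; case: (hE) => _ hC hD.
have [Et|Et] := pselect (E t).
  exists s; split=> //; last first.
    by apply: der_inj; rewrite -emb_der.
  have sub : adjoin E [set t] `<=` E by apply: adjoin_min => // _ ->.
  by case: hs => ? ? ? ?; split=> // [a b /sub ? /sub ?|a b /sub ? /sub ?|a /sub ?]; auto.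
pose T := subfieldType sE.
pose ev1 (p : {poly T}) := (map_poly sfval p).[t].
pose ev2 (p : {poly T}) := (map_poly (emb_val hs) p).[u].
have ev1_eq0 p : ev1 p = 0 -> p = 0.
  move=> h; apply/eqP; rewrite -(map_poly_eq0 (@sfval _ _ _ sE)); apply/eqP.
  apply: (primitive_transcendental hE Et' Et); last exact/rootP.
  by move=> i; rewrite coef_map; apply: sfval_in.
have ev2_eq0 p : ev2 p = 0 -> p = 0.
  move=> h; apply/eqP; rewrite -(map_poly_eq0 (emb_val hs)); apply/eqP.
  apply: (primitive_transcendental emb_image_dsub (t := u)); last exact/rootP.
  - by exists (der t).
  - case=> a Ea ha; apply: Et.
    have : der t = der a by apply: emb_inj => //; [exact: hD|rewrite -hu -ha emb_der].
    by case/der_inj => c ->; apply: (sfD sE).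
  - by move=> i; rewrite coef_map; exists (sfval p`_i) => //; apply: sfval_in.
have ev1M p q : ev1 (p * q) = ev1 p * ev1 q by rewrite /ev1 rmorphM hornerM.
have ev2M p q : ev2 (p * q) = ev2 p * ev2 q by rewrite /ev2 rmorphM hornerM.
have ev1B p q : ev1 (p - q) = ev1 p - ev1 q by rewrite /ev1 raddfB hornerD hornerN.
have ev2B p q : ev2 (p - q) = ev2 p - ev2 q by rewrite /ev2 raddfB hornerD hornerN.
have ev1C x : ev1 x%:P = sfval x by rewrite /ev1 map_polyC hornerC.
have ev2C x : ev2 x%:P = s (sfval x) by rewrite /ev2 map_polyC hornerC.
have ev1X : ev1 'X = t by rewrite /ev1 map_polyX hornerX.
have ev2X : ev2 'X = u by rewrite /ev2 map_polyX hornerX.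
have ev11 : ev1 1 = 1 by rewrite /ev1 rmorph1 hornerC.
have ev21 : ev2 1 = 1 by rewrite /ev2 rmorph1 hornerC.
have ev1n p : p != 0 -> ev1 p != 0 by move=> h; apply/eqP => /ev1_eq0 /eqP; apply/negP.
have ev2n p : p != 0 -> ev2 p != 0 by move=> h; apply/eqP => /ev2_eq0 /eqP; apply/negP.
(* the graph of the extension *)
pose gr a : set L :=
  [set b | exists p q, [/\ q != 0, a = ev1 p / ev1 q & b = ev2 p / ev2 q]].
pose s' a := xget 0 (gr a).
have s'E p q : q != 0 -> s' (ev1 p / ev1 q) = ev2 p / ev2 q.
  move=> q0; have : gr (ev1 p / ev1 q) (s' (ev1 p / ev1 q)).
    by apply: xgetPex; exists (ev2 p / ev2 q), p, q.
  case=> p1 [q1 [q10 h ->]]; apply/eqP; rewrite eqr_div ?ev2n // -!ev2M.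
  move/eqP: h; rewrite eqr_div ?ev1n // -!ev1M => /eqP h.
  have /ev1_eq0/subr0_eq -> : ev1 (p1 * q - p * q1) = 0 by rewrite ev1B h subrr.
  by rewrite eqxx.
have frac a : adjoin E [set t] a -> exists p q, q != 0 /\ a = ev1 p / ev1 q.
  apply: (@adjoin_min _ _ _ _ [set a | exists p q, q != 0 /\ a = ev1 p / ev1 q]).
  - apply: subfieldI => [|_ _ [p [q [q0 ->]]] [p1 [q1 [q10 ->]]]
                        |_ _ [p [q [q0 ->]]] [p1 [q1 [q10 ->]]]|_ [p [q [q0 ->]]]].
    + by exists 1, 1; rewrite oner_eq0 ev11 divr1; split.
    + exists (p * q1 - p1 * q), (q * q1); rewrite mulf_neq0 //; split=> //.
      rewrite ev1B !ev1M; field; by rewrite !ev1n.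
    + exists (p * p1), (q * q1); rewrite mulf_neq0 //; split=> //.
      rewrite !ev1M; field; by rewrite !ev1n.
    + have [p0|p0] := eqVneq p 0.
        by exists 0, 1; rewrite oner_eq0 p0 /ev1 raddf0 !horner0 !mul0r invr0.
      by exists q, p; split=> //; rewrite invf_div.
  - move=> b /(subfieldType_ex sE) [x <-]; exists x%:P, 1.
    by rewrite oner_eq0 ev11 divr1 ev1C.
  - by move=> _ ->; exists 'X, 1; rewrite oner_eq0 ev11 divr1 ev1X.
have s'base a : E a -> s' a = s a.
  case/(subfieldType_ex sE) => x <-.
  have := s'E x%:P 1 (oner_neq0 _).
  by rewrite ev11 ev21 !divr1 ev1C ev2C.
have s't : s' t = u.
  by have := s'E 'X 1 (oner_neq0 _); rewrite ev11 ev21 !divr1 ev1X ev2X.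
have s'B a b : adjoin E [set t] a -> adjoin E [set t] b -> s' (a - b) = s' a - s' b.
  move=> /frac [p [q [q0 ->]]] /frac [p1 [q1 [q10 ->]]].
  have -> : ev1 p / ev1 q - ev1 p1 / ev1 q1 = ev1 (p * q1 - p1 * q) / ev1 (q * q1).
    by rewrite ev1B !ev1M; field; rewrite !ev1n.
  rewrite !s'E ?mulf_neq0 // ev2B !ev2M; field; by rewrite !ev2n.
have s'M a b : adjoin E [set t] a -> adjoin E [set t] b -> s' (a * b) = s' a * s' b.
  move=> /frac [p [q [q0 ->]]] /frac [p1 [q1 [q10 ->]]].
  have -> : ev1 p / ev1 q * (ev1 p1 / ev1 q1) = ev1 (p * p1) / ev1 (q * q1).
    by rewrite !ev1M; field; rewrite !ev1n.
  rewrite !s'E ?mulf_neq0 // !ev2M; field; by rewrite !ev2n.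
exists s'; split=> //; last by exists 0; rewrite raddf0 addr0.
split=> //; first by move=> c; rewrite s'base // emb_cst.
have hA := adjoin_subfield E [set t].
have [_ hAC hAD] : diff_subfield (adjoin E [set t]).
  by apply: der_adjoin => // _ ->; apply: adjoin_base.
suff sub : adjoin E [set t] `<=`
  [set a | adjoin E [set t] a /\ s' (der a) = der (s' a)].
  by move=> a /sub [].
have s'N a : adjoin E [set t] a -> s' (- a) = - s' a.
  move=> ha; rewrite -sub0r s'B //; last exact: (sf0 hA).
  by rewrite s'base ?emb0 ?sub0r //; apply: (sf0 sE).
have s'D a b : adjoin E [set t] a -> adjoin E [set t] b -> s' (a + b) = s' a + s' b.
  by move=> ha hb; rewrite -{1}[b]opprK s'B ?s'N ?opprK //; apply: (sfN hA).
have s'1 : s' 1 = 1 by rewrite s'base ?emb1 //; apply: (sf1 sE).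
have s'V a : adjoin E [set t] a -> s' a^-1 = (s' a)^-1.
  move=> ha; have [->|a0] := eqVneq a 0.
    by rewrite invr0 s'base ?emb0 ?invr0 //; apply: (sf0 sE).
  have h : s' a * s' a^-1 = 1 by rewrite -s'M ?divff //; apply: (sfV hA).
  have sa0 : s' a != 0.
    by apply/eqP => sa; move/eqP: h; rewrite sa mul0r eq_sym oner_eq0.
  by apply: (mulfI sa0); rewrite h divff.
apply: adjoin_min.
- apply: subfieldI => [|a b [ha ea] [hb eb]|a b [ha ea] [hb eb]|a [ha ea]]; split.
  + exact: (sf1 hA).
  + rewrite s'1 !der1 s'base ?emb0 //; exact: (sf0 sE).
  + exact: (sfB hA).
  + by rewrite raddfB (s'B _ _ (hAD _ ha) (hAD _ hb)) (s'B _ _ ha hb) raddfB ea eb.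
  + exact: (sfM hA).
  + have [da db] := (hAD _ ha, hAD _ hb).
    by rewrite derM s'D ?s'M ?ea ?eb ?derM //; apply: (sfM hA).
  + exact: (sfV hA).
  + have [da haa] := (hAD _ ha, sfM hA ha ha).
    rewrite derV expr2 s'M ?s'N ?s'V ?s'M ?ea ?derV ?expr2 //.
      exact: (sfN hA).
    exact: (sfV hA).
- move=> a Ea; split; first exact: adjoin_base.
  by rewrite (s'base _ Ea) s'base ?emb_der //; apply: hD.
- move=> _ ->; split; first exact: adjoin_gen.
  by rewrite s't s'base.
Qed.

End Embeddings.

(** * Zariski topology on matrices *)
Lemma poly_roots_finite (F : fieldType) (p : {poly F}) :
  p != 0 -> exists r : seq F, forall x, root p x -> x \in r.
Proof.
elim: {p}(size p) {-2}p (leqnn (size p)) => [p|n IH p].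
  by rewrite leqn0 size_poly_eq0 => /eqP ->; rewrite eqxx.
move=> sp p0; have [[a ra]|h] := pselect (exists a, root p a); last first.
  by exists [::] => x rx; case: h; exists x.
have [q hq] := factor_theorem _ _ ra; rewrite hq in ra p0 sp *.
have q0 : q != 0 by apply: contraNneq p0 => ->; rewrite mul0r.
have [|r hr] := IH q _ q0.
  by move: sp; rewrite size_Mmonic ?monicXsubC // size_XsubC addn2.
exists (a :: r) => x; rewrite rootM root_XsubC inE orbC.
by case/orP => [->//|/hr ->]; rewrite orbT.
Qed.

Lemma poly_nat_eq0 (F : numDomainType) (p : {poly F}) :
  (forall k : nat, p.[k%:R] = 0) -> p = 0.
Proof.
move=> h; apply/eqP/negPn/negP => p0.
pose r := [seq (i%:R : F) | i <- iota 0 (size p)].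
have ar : all (root p) r by apply/allP => _ /mapP [i _ ->]; apply/rootP.
have ur : uniq r.
  by rewrite map_inj_uniq ?iota_uniq // => i j /eqP; rewrite eqr_nat => /eqP.
by have := max_poly_roots p0 ar ur; rewrite size_map size_iota ltnn.
Qed.

Section Zariski.
Variables (R : realType) (n : nat).
Local Notation C := R[i].
Implicit Types (f g : 'M[C]_n -> C) (S T A : set 'M[C]_n) (M : 'M[C]_n).

(** Functions rather than polynomials: the entries of a product of matrices are
    easier to recognise as functions. *)
Definition polyfun f := exists p, forall M, mxeval p M = f M.

Lemma polyfun_cst c : polyfun (fun=> c).
Proof. by exists c%:MP => M; rewrite /mxeval mevalC. Qed.

Lemma polyfun_entry i j : polyfun (fun M => M i j).
Proof. by exists 'X_(mxvec_index i j) => M; rewrite /mxeval mevalXU mxvecE. Qed.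

Lemma polyfunD f g : polyfun f -> polyfun g -> polyfun (fun M => f M + g M).
Proof. by move=> [p hp] [q hq]; exists (p + q) => M; rewrite -hp -hq /mxeval mevalD. Qed.

Lemma polyfunM f g : polyfun f -> polyfun g -> polyfun (fun M => f M * g M).
Proof. by move=> [p hp] [q hq]; exists (p * q) => M; rewrite -hp -hq /mxeval mevalM. Qed.

Lemma polyfun_sum m (f : 'I_m -> 'M[C]_n -> C) :
  (forall i, polyfun (f i)) -> polyfun (fun M => \sum_i f i M).
Proof.
elim: m f => [|m IH] f h.
  have -> : (fun M => \sum_i f i M) = fun=> 0 by apply/funext => M; rewrite big_ord0.
  exact: polyfun_cst.
have -> : (fun M => \sum_i f i M) = fun M => f ord0 M + \sum_i f (lift ord0 i) M.
  by apply/funext => M; rewrite big_ord_recl.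
by apply: polyfunD => //; apply: IH => i; apply: h.
Qed.

Lemma closed_polyfun (I : Type) (f : I -> 'M[C]_n -> C) :
  (forall i, polyfun (f i)) -> zariski_closed [set M | forall i, f i M = 0].
Proof.
move=> hf; exists [set p | exists i, forall M, mxeval p M = f i M].
apply/seteqP; split=> M /= h.
  by move=> p [i ->].
by move=> i; have [p hp] := hf i; rewrite -hp; apply: h; exists i.
Qed.

Lemma mxevalM p q M : mxeval (p * q) M = mxeval p M * mxeval q M.
Proof. exact: mevalM. Qed.

Lemma closed0 : zariski_closed (set0 : set 'M[C]_n).
Proof.
exists [set 1]; apply/seteqP; split=> M //= /(_ 1 erefl).
by rewrite /mxeval meval1 => /eqP; rewrite oner_eq0.
Qed.

Lemma closedU S T : zariski_closed S -> zariski_closed T -> zariski_closed (S `|` T).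
Proof.
move=> [I ->] [J ->]; exists [set r | exists p q, [/\ I p, J q & r = p * q]].
apply/seteqP; split=> M /=.
  case=> h r [p [q [Ip Jq ->]]]; rewrite mxevalM.
    by rewrite (h p) ?mul0r.
  by rewrite (h q) ?mulr0.
move=> h; have [hI|hI] := pselect (forall p, I p -> mxeval p M = 0); first by left.
right=> q Jq; apply/eqP/negPn/negP => q0; apply: hI => p Ip.
have /eqP : mxeval (p * q) M = 0 by apply: h; exists p, q.
by rewrite mxevalM mulf_eq0 (negbTE q0) orbF => /eqP.
Qed.

Lemma closed_bigU (I : eqType) (r : seq I) (f : I -> set 'M[C]_n) :
  (forall i, zariski_closed (f i)) ->
  zariski_closed [set M | exists2 i, i \in r & f i M].
Proof.
move=> hf; elim: r => [|i r IH].
  have -> : [set M | exists2 i, i \in [::] & f i M] = set0.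
    by apply/seteqP; split=> M // [].
  exact: closed0.
have -> : [set M | exists2 j, j \in i :: r & f j M] =
          f i `|` [set M | exists2 j, j \in r & f j M].
  apply/seteqP; split=> M /=.
    by case=> j; rewrite inE => /orP [/eqP ->|hj] hM; [left|right; exists j].
  by case=> [hM|[j hj hM]]; [exists i|exists j]; rewrite // inE ?eqxx ?hj ?orbT.
exact: closedU.
Qed.

Definition polyseq_nat (f : nat -> C) := exists q : {poly C}, forall k, f k = q.[k%:R].

Lemma polyseq_nat_cst c : polyseq_nat (fun=> c).
Proof. by exists c%:P => k; rewrite hornerC. Qed.
Lemma polyseq_natM (f g : nat -> C) :
  polyseq_nat f -> polyseq_nat g -> polyseq_nat (fun k => f k * g k).
Proof. by move=> [p hp] [q hq]; exists (p * q) => k; rewrite hornerM hp hq. Qed.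
Lemma polyseq_natX (f : nat -> C) m : polyseq_nat f -> polyseq_nat (fun k => f k ^+ m).
Proof. by move=> [p hp]; exists (p ^+ m) => k; rewrite horner_exp hp. Qed.
Lemma polyseq_nat_sum (I : Type) (r : seq I) (f : I -> nat -> C) :
  (forall i, polyseq_nat (f i)) -> polyseq_nat (fun k => \sum_(i <- r) f i k).
Proof.
move=> h; have [p hp] := choice h; exists (\sum_(i <- r) p i) => k.
by rewrite horner_sum; apply: eq_bigr => i _; rewrite hp.
Qed.
Lemma polyseq_nat_prod (I : Type) (r : seq I) (f : I -> nat -> C) :
  (forall i, polyseq_nat (f i)) -> polyseq_nat (fun k => \prod_(i <- r) f i k).
Proof.
move=> h; have [p hp] := choice h; exists (\prod_(i <- r) p i) => k.
by rewrite horner_prod; apply: eq_bigr => i _; rewrite hp.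
Qed.

Lemma polyseq_nat_bin l : polyseq_nat (fun k => 'C(k, l)%:R).
Proof.
elim: l => [|l [q hq]]; first by exists 1 => k; rewrite bin0 hornerC.
exists (l.+1%:R^-1 *: (q * ('X - (l%:R)%:P))) => k.
rewrite hornerZ hornerM hornerXsubC -hq.
apply: (mulfI (x := l.+1%:R)); first by rewrite pnatr_eq0.
rewrite mulVKf ?pnatr_eq0 // -natrM mul_bin_left natrM mulrC.
have [hl|hl] := leqP l k; first by rewrite natrB.
by rewrite bin_small // !mul0r.
Qed.

(** M^n = sum_l C(n, l) (M - 1)^l, where the sum may be cut at N, independently of
    n, and C(n, l) is polynomial in n. *)
Lemma unipotent_entry M N i j : (M - 1) ^+ N = 0 ->
  polyseq_nat (fun k => (M ^+ k) i j).
Proof.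
move=> hN; set U := M - 1.
have hU l : (N <= l)%N -> U ^+ l = 0.
  by move=> h; rewrite -(subnK h) exprD hN mulr0.
have hM k : M ^+ k = \sum_(l < N) U ^+ l *+ 'C(k, l).
  have -> : M = U + 1 by rewrite subrK.
  rewrite exprD1n -!(big_mkord xpredT (fun l => U ^+ l *+ 'C(k, l))).
  have [h|h] := leqP k.+1 N.
    rewrite (big_cat_nat (leq0n _) h) /= [X in _ = _ + X]big_nat_cond.
    rewrite [X in _ = _ + X]big1 ?addr0 //.
    by move=> l /andP [/andP [hl _] _]; rewrite bin_small ?mulr0n.
  rewrite (big_cat_nat (leq0n _) (ltnW h)) /= [X in _ + X = _]big_nat_cond.
  rewrite [X in _ + X = _]big1 ?addr0 //.
  by move=> l /andP [/andP [hl _] _]; rewrite hU ?mul0rn.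
have -> : (fun k => (M ^+ k) i j) =
    fun k => \sum_(l < N) (U ^+ l) i j * 'C(k, l)%:R.
  apply/funext => k; rewrite hM summxE; apply: eq_bigr => l _.
  by rewrite mulmxnE mulr_natr.
apply: polyseq_nat_sum => l; apply: polyseq_natM; first exact: polyseq_nat_cst.
exact: polyseq_nat_bin.
Qed.

Lemma unipotent_mxeval M N p : (M - 1) ^+ N = 0 ->
  polyseq_nat (fun k => mxeval p (M ^+ k)).
Proof.
move=> hN; rewrite /mxeval.
have -> : (fun k => p.@[fun i => mxvec (M ^+ k) 0 i]) = 
  fun k => \sum_(m <- msupp p) p@_m * \prod_i mxvec (M ^+ k) 0 i ^+ m i.
  by apply/funext => k; rewrite mevalE.
apply: polyseq_nat_sum => m; apply: polyseq_natM; first exact: polyseq_nat_cst.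
apply: polyseq_nat_prod => l; apply: polyseq_natX.
case/mxvec_indexP: l => i j.
have -> : (fun k => mxvec (M ^+ k) 0 (mxvec_index i j)) = fun k => (M ^+ k) i j.
  by apply/funext => k; rewrite mxvecE.
exact: unipotent_entry hN.
Qed.

(** Polynomial functions on the powers of M are polynomials in the exponent.  Two
    of them that do not vanish on all powers have a product that does not, so the
    powers form an irreducible set. *)
Lemma unipotent_connected M N : (M - 1) ^+ N = 0 ->
  zariski_connected (range (fun k : nat => M ^+ k)).
Proof.
move=> hN S T [I hI] [J hJ] sub _; apply: contrapT => /not_orP [nS nT].
have wit X (Q : set {mpoly C[n * n]}) : X = [set M | forall p, Q p -> mxeval p M = 0] ->
    ~ range (fun k : nat => M ^+ k) `<=` X ->
    exists q : {poly C}, q != 0 /\ forall k, X (M ^+ k) -> q.[k%:R] = 0.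
  move=> -> /existsNP [_ /not_implyP [[k _ <-]]].
  case/existsNP => p /not_implyP [Qp pk].
  have [q hq] := unipotent_mxeval p hN; exists q; split.
    by apply/eqP => q0; apply: pk; rewrite hq q0 horner0.
  by move=> l h; rewrite -hq h.
have [P [P0 hP]] := wit S I hI nS; have [Q [Q0 hQ]] := wit T J hJ nT.
have : P * Q = 0.
  apply: poly_nat_eq0 => k; rewrite hornerM.
  by have [|/hP ->|/hQ ->] := sub (M ^+ k); rewrite ?mul0r ?mulr0 //; exists k.
by apply/eqP/mulf_neq0.
Qed.

End Zariski.

Section LinearRelations.
Variables (R : realType) (L : diffExt R).
Local Notation C := R[i].
Local Notation cmx := (map_mx (@cstC _ L)).

(** The constant row vectors d with d u = 0 form a subspace; a matrix of maximal rank
    among those whose rows are such relations spans it. *)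
Lemma linear_relations_mx n (u : 'cV[L]_n) :
  exists B : 'M[C]_n, forall d : 'rV[C]_n, cmx d *m u = 0 <-> d *m B = 0.
Proof.
pose P r := `[< exists2 B : 'M[C]_n, cmx B *m u = 0 & \rank B = r >].
have exP : exists r, P r.
  by exists 0%N; apply/asboolP; exists 0; rewrite ?map_mx0 ?mul0mx ?mxrank0.
have bP r : P r -> (r <= n)%N by move=> /asboolP [B _ <-]; apply: rank_leq_row.
case: (ex_maxnP exP bP) => r /asboolP [B hB rB] hmax.
exists (cokermx B) => d; split; last first.
  move/eqP; rewrite -submxE => /submxP [D ->].
  by rewrite map_mxM -mulmxA hB mulmx0.
move=> hd; apply/eqP; rewrite -submxE; apply/negPn/negP => ndB.
have : (\rank (B + d)%MS <= r)%N.
  apply: hmax; apply/asboolP; exists (B + d)%MS => //.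
  have /submxP [D ->] : (B + d <= col_mx B d)%MS by rewrite addsmxE.
  by rewrite map_mxM map_col_mx -mulmxA mul_col_mx hB hd col_mx0 mulmx0.
rewrite leqNgt -rB => /negP; apply; apply: rank_ltmx.
by rewrite ltmxE addsmxSl addsmx_sub submx_refl.
Qed.

(** The equation has coefficients in L, but its constant solutions form an affine
    subspace defined over the constants. *)
Lemma closed_linear n (u : 'rV[L]_n) (c : 'cV[C]_n) (w : L) :
  zariski_closed [set M | u *m cmx M *m cmx c = w%:M].
Proof.
set S := [set M | _]; have [[M1 hM1]|h0] := pselect (exists M, S M); last first.
  have -> : S = set0 by apply/seteqP; split=> M // hM; apply: h0; exists M.
  exact: closed0.
have [B hB] := linear_relations_mx u^T.
have -> : S = [set M | forall j, (((M - M1) *m c)^T *m B) 0 j = 0].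
  have eqS M : S M <-> ((M - M1) *m c)^T *m B = 0.
    rewrite -hB -map_trmx -trmx_mul; split=> h; last first.
      have /eqP : u *m cmx ((M - M1) *m c) = 0 by apply: trmx_inj; rewrite h trmx0.
      by rewrite map_mxM map_mxB mulmxBl mulmxBr !mulmxA subr_eq0 hM1 => /eqP.
    apply/eqP; rewrite trmx_eq0 map_mxM map_mxB mulmxBl mulmxBr !mulmxA.
    by rewrite h hM1 subrr.
  apply/seteqP; split=> M /=; first by move/eqS => h j; rewrite h mxE.
  by move=> h; apply/eqS/rowP => j; rewrite h mxE.
apply: closed_polyfun => j.
have -> : (fun M => (((M - M1) *m c)^T *m B) 0 j) =
   fun M => \sum_k (\sum_l (M k l + - M1 k l) * c l 0) * B k j.
  apply/funext => M; rewrite mxE; apply: eq_bigr => k _; rewrite !mxE.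
  by congr (_ * _); apply: eq_bigr => l _; rewrite !mxE.
apply: polyfun_sum => k; apply: polyfunM; last exact: polyfun_cst.
apply: polyfun_sum => l; apply: polyfunM; last exact: polyfun_cst.
by apply: polyfunD; [exact: polyfun_entry|exact: polyfun_cst].
Qed.

End LinearRelations.

(** * Differential Galois groups of linear systems *)
Section EmbeddingsOfAdjoin.
Variables (R : realType) (L : diffExt R) (E S : set L).
Let F := adjoin E S.
Hypothesis hF : diff_subfield F.
Let sF : subfield F. Proof. by case: hF. Qed.

Lemma emb_preimage_subfield (s : L -> L) (F' : set L) :
  diff_embedding F s -> subfield F' -> subfield [set a | F a /\ F' (s a)].
Proof.
move=> hs hF'.
apply: subfieldI => [|a b [? ?] [? ?]|a b [? ?] [? ?]|a [? ?]] /=.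
- by rewrite (emb1 hs); split; [exact: sf1 sF|exact: sf1 hF'].
- by rewrite (embB hs) //; split; [exact: (sfB sF)|exact: (sfB hF')].
- by rewrite (embM hs) //; split; [exact: (sfM sF)|exact: (sfM hF')].
- by rewrite (embV hF hs) //; split; [exact: (sfV sF)|exact: (sfV hF')].
Qed.

Lemma emb_adjoin_sub (s : L -> L) (F' : set L) :
  diff_embedding F s -> subfield F' -> (forall a, E a -> F' (s a)) ->
  (forall a, S a -> F' (s a)) -> forall a, F a -> F' (s a).
Proof.
move=> hs hF' hE hS.
suff sub : F `<=` [set a | F a /\ F' (s a)] by move=> a /sub [].
apply: adjoin_min => [|a Ea|a Sa]; first exact: emb_preimage_subfield.
  by split; [exact: adjoin_base|exact: hE].
by split; [exact: adjoin_gen|exact: hS].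
Qed.

Lemma emb_adjoin_eq (s1 s2 : L -> L) :
  diff_embedding F s1 -> diff_embedding F s2 -> (forall a, E a -> s1 a = s2 a) ->
  (forall a, S a -> s1 a = s2 a) -> forall a, F a -> s1 a = s2 a.
Proof.
move=> h1 h2 hE hS.
suff sub : F `<=` [set a | F a /\ s1 a = s2 a] by move=> a /sub [].
apply: adjoin_min => [|a Ea|a Sa].
- apply: subfieldI => [|a b [? e1] [? e2]|a b [? e1] [? e2]|a [? e1]] /=.
  + by rewrite (emb1 h1) (emb1 h2); split=> //; exact: sf1 sF.
  + by rewrite (embB h1) // (embB h2) // e1 e2; split=> //; exact: (sfB sF).
  + by rewrite (embM h1) // (embM h2) // e1 e2; split=> //; exact: (sfM sF).
  + by rewrite (embV hF h1) // (embV hF h2) // e1; split=> //; exact: (sfV sF).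
- by split; [exact: adjoin_base|exact: hE].
- by split; [exact: adjoin_gen|exact: hS].
Qed.

Lemma diff_embedding_comp (s1 s2 : L -> L) :
  diff_embedding F s1 -> diff_embedding F s2 -> (forall a, F a -> F (s2 a)) ->
  diff_embedding F (s1 \o s2).
Proof.
move=> h1 h2 h; case: hF => _ _ hD; split=> /= [c|a b Fa Fb|a b Fa Fb|a Fa].
- by rewrite (emb_cst h2) (emb_cst h1).
- by rewrite (embB h2) // (embB h1) //; apply: h.
- by rewrite (embM h2) // (embM h1) //; apply: h.
- by rewrite (emb_der h2) // (emb_der h1) //; apply: h.
Qed.

End EmbeddingsOfAdjoin.

Lemma diff_embedding_id (R : realType) (L : diffExt R) (E : set L) : diff_embedding E id.
Proof. by split. Qed.

Lemma diff_embedding_sub (R : realType) (L : diffExt R) (E F : set L) s :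
  E `<=` F -> diff_embedding F s -> diff_embedding E s.
Proof.
move=> h [h1 h2 h3 h4]; split=> // [a b /h ? /h ?|a b /h ? /h ?|a /h ?];
  by [exact: h2|exact: h3|exact: h4].
Qed.

Section PicardVessiot.
Variables (R : realType) (L : diffExt R) (n : nat).
Local Notation C := R[i].
Local Notation cmx := (map_mx (@cstC _ L)).

Lemma der_mulmx m p q (B : 'M[L]_(m, p)) (D : 'M[L]_(p, q)) :
  map_mx der (B *m D) = map_mx der B *m D + B *m map_mx der D.
Proof.
apply/matrixP => i j; rewrite !mxE raddf_sum /= -big_split /=.
by apply: eq_bigr => k _; rewrite derM !mxE.
Qed.

Lemma der_cmx m p (B : 'M[C]_(m, p)) : map_mx der (cmx B) = 0.
Proof. by apply/matrixP => i j; rewrite !mxE der_cst. Qed.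

Lemma cmx_inj m p : injective (cmx : 'M[C]_(m, p) -> _).
Proof. exact: map_mx_inj. Qed.

Variables (K : set L) (A Y : 'M[L]_n).
Hypotheses (hK : diff_subfield K) (hA : forall i j, K (A i j)) (hY : fundamental_matrix A Y).
Let F := pv_ext K Y.
Let G := diff_galois K Y.
Let sK : subfield K. Proof. by case: hK. Qed.
Let Yunit : Y \in unitmx. Proof. by case: hY. Qed.

(** The derivative of Y^-1 v vanishes. *)
Lemma solution_cst m (v : 'M[L]_(n, m)) : map_mx der v = A *m v ->
  exists c : 'M[C]_(n, m), v = Y *m cmx c.
Proof.
case: hY => _ dY hv.
have [c vc] : exists c, v = Y *m c by exists (invmx Y *m v); rewrite mulKVmx.
have : map_mx der c = 0.
  have : Y *m map_mx der c = 0.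
    move: hv; rewrite {1}vc der_mulmx dY -mulmxA -vc => /eqP.
    by rewrite addrC -subr_eq0 addrK => /eqP.
  by move/(congr1 (mulmx (invmx Y))); rewrite mulKmx // mulmx0.
move=> /matrixP dc; have h i j : exists d, c i j = cstC d.
  by apply/der_eq0P; have := dc i j; rewrite !mxE.
have [d hd] := choice (fun ij : 'I_n * 'I_m => h ij.1 ij.2).
exists (\matrix_(i, j) d (i, j)); rewrite {1}vc; congr (_ *m _).
by apply/matrixP => i j; rewrite !mxE -(hd (i, j)).
Qed.

Lemma pv_subfield : subfield F.
Proof. exact: adjoin_subfield. Qed.

Lemma pv_entry i j : F (Y i j).
Proof. by apply: adjoin_gen; exists i, j. Qed.

Lemma pv_base a : K a -> F a.
Proof. exact: adjoin_base. Qed.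

Lemma pv_cst c : F (cstC c).
Proof. by apply: pv_base; case: hK. Qed.

Lemma pv_solution m (v : 'M[L]_(n, m)) i j : map_mx der v = A *m v -> F (v i j).
Proof.
case/solution_cst => c ->; rewrite mxE; apply: (sf_sum pv_subfield) => k _.
by apply: (sfM pv_subfield); [exact: pv_entry|rewrite mxE; exact: pv_cst].
Qed.

Lemma pv_dsub : diff_subfield F.
Proof.
apply: der_adjoin => // _ [i [j ->]]; case: hY => _ /matrixP /(_ i j).
rewrite !mxE => ->; apply: (sf_sum pv_subfield) => k _.
apply: (sfM pv_subfield); last exact: pv_entry.
by apply: pv_base; apply: hA.
Qed.

Lemma emb_mx (s : L -> L) m p (B : 'M[L]_(m, n)) (c : 'M[C]_(n, p)) :
  diff_embedding F s -> (forall i j, F (B i j)) ->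
  map_mx s (B *m cmx c) = map_mx s B *m cmx c.
Proof.
move=> hs hB; have Fc c' := pv_cst c'; apply/matrixP => i j; rewrite !mxE.
have hF (k : 'I_n) : F (B i k * cmx c k j).
  by rewrite mxE; apply: (sfM pv_subfield).
rewrite (emb_sum pv_dsub hs) //; apply: eq_bigr => k _.
by rewrite !mxE (embM hs) // (emb_cst hs).
Qed.

Lemma emb_fundamental (s : L -> L) :
  diff_embedding F s -> (forall a, K a -> s a = a) ->
  exists M, map_mx s Y = Y *m cmx M.
Proof.
move=> hs hsK; apply: solution_cst; case: hY => _ /matrixP dY.
apply/matrixP => i j; rewrite !mxE -(emb_der hs); last exact: pv_entry.
have := dY i j; rewrite !mxE => ->.
rewrite (emb_sum pv_dsub hs) => [|k]; last first.
  apply: (sfM pv_subfield); last exact: pv_entry.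
  by apply: pv_base; apply: hA.
apply: eq_bigr => k _; rewrite mxE (embM hs) => [|//|]; first by rewrite hsK.
  by apply: pv_base; apply: hA.
exact: pv_entry.
Qed.

Lemma emb_stable (s : L -> L) :
  diff_embedding F s -> (forall a, K a -> s a = a) -> forall a, F a -> F (s a).
Proof.
move=> hs hsK; have [M hM] := emb_fundamental hs hsK.
apply: emb_adjoin_sub => //; first exact: pv_dsub.
- exact: pv_subfield.
- by move=> a Ka; rewrite hsK //; apply: pv_base.
- move=> _ [i [j ->]]; have /matrixP /(_ i j) := hM; rewrite !mxE => ->.
  apply: (sf_sum pv_subfield) => k _; rewrite mxE.
  by apply: (sfM pv_subfield); [exact: pv_entry|exact: pv_cst].
Qed.

(** Since s Y = Y M for a constant M, the image of s is generated by the entries of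
    Y M; M is invertible because s is injective, so the image is all of F. *)
Lemma emb_diff_aut (s : L -> L) :
  diff_embedding F s -> (forall a, K a -> s a = a) -> diff_aut K F s.
Proof.
move=> hs hsK; have hst := emb_stable hs hsK; have [M hM] := emb_fundamental hs hsK.
have hF := pv_dsub; split.
- split=> [a Fa|a b|]; first exact: hst.
    by move=> /set_mem Fa /set_mem Fb; apply: (emb_inj hF hs).
  have [sI _ _] := emb_image_dsub hF hs.
  have Mu : cmx M \in unitmx.
    rewrite map_unitmx -unitmx_tr unitmxE unitfE; apply/negP.
    case/det0P => d d0 dM; have Md : M *m d^T = 0.
      by apply: trmx_inj; rewrite trmx_mul trmxK dM trmx0.
    have : Y *m cmx d^T = 0.
      apply/matrixP => i j; rewrite [RHS]mxE; apply: (emb_eq0 hF hs).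
        rewrite mxE; apply: (sf_sum pv_subfield) => k _.
        by apply: (sfM pv_subfield); [exact: pv_entry|rewrite mxE; exact: pv_cst].
      have := emb_mx d^T hs pv_entry; rewrite hM -mulmxA -map_mxM Md map_mx0 mulmx0.
      by move=> /matrixP /(_ i j); rewrite !mxE.
    move/(congr1 (mulmx (invmx Y))); rewrite mulKmx // mulmx0 -(map_mx0 cstC).
    by move=> /cmx_inj /eqP; rewrite trmx_eq0 (negbTE d0).
  suff sub : F `<=` s @` F by move=> a /sub.
  apply: adjoin_min => //.
    by move=> a Ka; exists a; [exact: pv_base|exact: hsK].
  move=> _ [i [j ->]].
  have -> : Y = map_mx s Y *m cmx (invmx M).
    by rewrite map_invmx hM mulmxK.
  rewrite mxE; apply: (sf_sum sI) => k _; apply: (sfM sI).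
    by rewrite mxE; exists (Y i k) => //; exact: pv_entry.
  by rewrite mxE; exists (cstC (invmx M k j)); [exact: pv_cst|exact: (emb_cst hs)].
- by move=> a b /set_mem Fa /set_mem Fb /=; apply: (embD hF hs).
- by move=> a b /set_mem Fa /set_mem Fb /=; apply: (embM hs).
- by move=> a /set_mem Fa; apply: (emb_der hs).
- by move=> a /set_mem Ka; apply: hsK.
Qed.

Lemma diff_aut_emb (s : L -> L) : diff_aut K F s -> 
  diff_embedding F s /\ (forall a, K a -> s a = a).
Proof.
case=> [_ hadd hmul hder hfix]; have sF := pv_subfield.
have hfix' a : K a -> s a = a by move=> Ka; apply: hfix; apply/mem_set.
split=> //; split=> [c|a b Fa Fb|a b Fa Fb|a Fa].
- by apply: hfix'; case: hK.
- have Fab := sfB sF Fa Fb; apply/eqP.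
  rewrite eq_sym subr_eq -hadd ?subrK //; exact/mem_set.
- by apply: hmul; apply/mem_set.
- by apply: hder; apply/mem_set.
Qed.

Lemma galois_emb M : G M -> exists s, [/\ diff_embedding F s, forall a, K a -> s a = a &
  map_mx s Y = Y *m cmx M].
Proof. by case=> s /diff_aut_emb [hs hK'] hM; exists s. Qed.

Lemma emb_galois s M : diff_embedding F s -> (forall a, K a -> s a = a) ->
  map_mx s Y = Y *m cmx M -> G M.
Proof. by move=> hs hsK hM; exists s => //; apply: emb_diff_aut. Qed.

Lemma emb_comp_mx s1 s2 M1 M2 : diff_embedding F s1 ->
  map_mx s1 Y = Y *m cmx M1 -> map_mx s2 Y = Y *m cmx M2 ->
  map_mx (s1 \o s2) Y = Y *m cmx (M1 *m M2).
Proof.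
move=> h1 e1 e2; rewrite map_mx_comp e2 emb_mx //; last by move=> i j; exact: pv_entry.
by rewrite e1 map_mxM mulmxA.
Qed.

(** The action on Y composes as s (t Y) = Y M_s M_t, constants being fixed. *)
Lemma emb_commute s1 s2 M1 M2 :
  diff_embedding F s1 -> (forall a, K a -> s1 a = a) ->
  diff_embedding F s2 -> (forall a, K a -> s2 a = a) ->
  map_mx s1 Y = Y *m cmx M1 -> map_mx s2 Y = Y *m cmx M2 ->
  (M1 *m M2 = M2 *m M1 <-> forall a, F a -> s1 (s2 a) = s2 (s1 a)).
Proof.
move=> h1 k1 h2 k2 e1 e2; have e12 := emb_comp_mx h1 e1 e2.
have e21 := emb_comp_mx h2 e2 e1; split=> h; last first.
  apply: cmx_inj; apply: (can_inj (mulKmx Yunit)).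
  rewrite -e12 -e21; apply/matrixP => i j; rewrite !mxE /=; apply: h.
  exact: pv_entry.
have c12 := diff_embedding_comp pv_dsub h1 h2 (emb_stable h2 k2).
have c21 := diff_embedding_comp pv_dsub h2 h1 (emb_stable h1 k1).
apply: (emb_adjoin_eq pv_dsub c12 c21) => [a Ka|_ [i [j ->]]] /=.
  by rewrite k1 ?k2 ?k1.
have /matrixP /(_ i j) : map_mx (s1 \o s2) Y = map_mx (s2 \o s1) Y.
  by rewrite e12 e21 h.
by rewrite !mxE.
Qed.

(** The conjugates of an algebraic element v are finite in number, and the matrices
    that send v to a given one form a closed set.  A connected set of matrices
    containing 1 is inside the one that fixes v. *)
Lemma identity_component_fixes M (c : 'cV[C]_n) i :
  identity_component G M -> algebraic_over K ((Y *m cmx c) i 0) ->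
  (Y *m cmx M *m cmx c) i 0 = (Y *m cmx c) i 0.
Proof.
case=> B [BG Bc B1 BM] [p [p0 pK rp]]; set v := (Y *m cmx c) i 0.
have [r hr] := poly_roots_finite p0.
pose l M := (Y *m cmx M *m cmx c) i 0.
have lE N w : l N = w <-> row i Y *m cmx N *m cmx c = w%:M.
  have -> : row i Y *m cmx N *m cmx c = row i (Y *m cmx N *m cmx c) by rewrite !row_mul.
  split=> [<-|/matrixP /(_ 0 0)]; last by rewrite !mxE eqxx mulr1n => <-; rewrite /l mxE.
  by apply/matrixP => a b; rewrite !ord1 /l !mxE eqxx mulr1n.
have lB N : B N -> root p (l N).
  case/BG/galois_emb => s [hs hsK hN]; have Fv : F v.
    rewrite /v mxE; apply: (sf_sum pv_subfield) => k _.
    by apply: (sfM pv_subfield); [exact: pv_entry|rewrite mxE; exact: pv_cst].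
  have -> : l N = s v.
    rewrite /l -hN -emb_mx //; last by move=> ? ?; exact: pv_entry.
    by rewrite mxE.
  apply/rootP; have := congr1 s (rootP rp); rewrite (emb0 hs) !horner_coef.
  rewrite (emb_sum pv_dsub hs) => [h|k]; last first.
    by apply: (sfM pv_subfield); [apply: pv_base; apply: pK|exact: (sfX pv_subfield)].
  rewrite -[RHS]h; apply: eq_bigr => k _; rewrite (embM hs).
  - by rewrite (hsK _ (pK _)) (embX pv_dsub hs).
  - apply: pv_base; apply: pK.
  - exact: (sfX pv_subfield).
have cl w : zariski_closed [set N | l N = w].
  have -> : [set N | l N = w] = [set N | row i Y *m cmx N *m cmx c = w%:M].
    by apply/seteqP; split=> N /lE.
  exact: closed_linear.
pose T := [set N | exists2 w, w \in [seq w <- r | w != v] & l N = w].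
have [|||sub|sub] := Bc _ T (cl v).
- by apply: closed_bigU.
- move=> N BN; have [h|h] := eqVneq (l N) v; first by left.
  by right; exists (l N) => //; rewrite mem_filter h; apply/hr/lB.
- apply/seteqP; split=> N //= [_ [hN [w]]].
  by rewrite mem_filter => /andP [wv _]; rewrite hN => e; rewrite e eqxx in wv.
- exact: sub.
- have [w] := sub _ B1; rewrite mem_filter => /andP [wv _].
  by rewrite /l map_mx1 mulmx1 => e; rewrite -e eqxx in wv.
Qed.

(** The powers of M are a connected subset of the group through 1 and M. *)
Lemma unipotent_identity_component M N :
  G M -> (M - 1) ^+ N = 0 -> identity_component G M.
Proof.
move=> GM hN; exists (range (fun k : nat => M ^+ k)); split.
- move=> _ [k _ <-]; have [s [hs hsK hM]] := galois_emb GM.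
  suff [sk [h1 h2 h3]] : exists sk, [/\ diff_embedding F sk, forall a, K a -> sk a = a &
      map_mx sk Y = Y *m cmx (M ^+ k)] by apply: emb_galois h3.
  elim: k => [|k [sk [h1 h2 h3]]].
    exists id; split=> //.
    by rewrite expr0 map_mx1 mulmx1; apply/matrixP => i j; rewrite !mxE.
  exists (s \o sk); split.
  + exact: (diff_embedding_comp pv_dsub hs h1 (emb_stable h1 h2)).
  + by move=> a Ka /=; rewrite h2 ?hsK.
  + by rewrite exprS; apply: emb_comp_mx.
- exact: unipotent_connected hN.
- by exists 0%N.
- by exists 1%N.
Qed.

(** The operator s - 1 acts on Y as right multiplication by M - 1. *)
Lemma emb_unipotent s M N : diff_embedding F s ->
  map_mx s Y = Y *m cmx M ->
  (forall i j, iter N (fun a => s a - a) (Y i j) = 0) -> (M - 1) ^+ N = 0.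
Proof.
move=> hs hM h.
have step c : map_mx (fun a => s a - a) (Y *m cmx c) = Y *m cmx ((M - 1) *m c).
  have -> : map_mx (fun a => s a - a) (Y *m cmx c) = map_mx s (Y *m cmx c) - Y *m cmx c.
    by apply/matrixP => i j; rewrite !mxE.
  rewrite emb_mx //; last by move=> ? ?; exact: pv_entry.
  by rewrite hM map_mxM map_mxB map_mx1 mulmxBl mul1mx mulmxBr mulmxA.
have stepn k : map_mx (iter k (fun a => s a - a)) Y = Y *m cmx ((M - 1) ^+ k).
  elim: k => [|k IH].
    by rewrite expr0 map_mx1 mulmx1; apply/matrixP => i j; rewrite !mxE.
  rewrite exprS -[(M - 1) * _]/((M - 1) *m _) -step -IH.
  by apply/matrixP => i j; rewrite !mxE.
apply: cmx_inj; apply: (can_inj (mulKmx Yunit)); rewrite -stepn map_mx0 mulmx0.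
by apply/matrixP => i j; rewrite !mxE h.
Qed.

End PicardVessiot.

(** * The fields K_0 and K *)
Section BaseField.
Variables (R : realType) (L : diffExt R).

Lemma Cz_subfield : subfield (Cz : set L).
Proof. exact: adjoin_subfield. Qed.

Lemma Cz_zvar : Cz (zvar : L).
Proof. exact: adjoin_gen. Qed.

Lemma Cz_cst c : Cz (cstC c : L).
Proof. by apply: adjoin_base; exists c. Qed.

Lemma Cz_rfun k lam : Cz (rfun L k lam).
Proof.
have hz := Cz_zvar; have hC c := Cz_cst c; have s := Cz_subfield.
have h1 := sf1 s; have hn m := sf_nat s m.
rewrite /rfun; apply: (sfB s); [apply: (sfD s)|apply: (sfM s)].
- by apply: (sfdiv s) => //; apply: (sfM s) => //; apply: (sfX s).
- by apply: (sfdiv s) => //; apply: (sfM s) => //; apply: (sfX s); apply: (sfB s).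
- by apply: (sfM s) => //; apply: (sfV s).
- by apply: (sfD s); apply: (sfV s) => //; apply: (sfB s).
Qed.

(** According to the sign of k, the defining relation is about a power of omega or
    of its inverse. *)
Lemma omega_algebraic (k : int) (omega : L) :
  3 <= `|k| -> is_omega k omega -> algebraic_over Cz omega.
Proof.
rewrite /is_omega => hk ho.
have s := Cz_subfield.
move: ho; set rhs := (X in _ = X) => ho.
have Cr : Cz rhs.
  apply: (sfM s); apply: (sfXz s); first exact: Cz_zvar.
  by apply: (sfB s); [exact: Cz_zvar|exact: sf1 s].
have [m [m0 [w [Cw hw]]]] : exists m : nat, (0 < m)%N /\
    exists w : L, Cz w /\ omega ^+ m = w.
  clearbody rhs.
  case: k hk ho => [n|n] hk ho.
    exists (4 * n)%N; split; first by case: n hk {ho rhs Cr}.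
    by exists rhs; split=> //; rewrite -ho -exprnP.
  exists (4 * n.+1)%N; split=> //; exists rhs^-1; split; first exact: (sfV s).
  rewrite -ho NegzE mulrN -invr_expz invrK.
  by rewrite -PoszM -exprnP.
exists ('X^m - w%:P); split.
- by rewrite -size_poly_eq0 size_XnsubC.
- move=> i; rewrite coefB coefXn coefC.
  by apply: (sfB s); [exact: sf_nat|case: ifP => // _; exact: sf0 s].
- by apply/rootP; rewrite hornerD hornerN hornerC hornerXn hw subrr.
Qed.

End BaseField.

(** The Wronskian of x and w is a constant c, and (w/x)' = c I'. *)
Lemma reduction_of_order (R : realType) (L : diffExt R) (r x I w : L) :
  x != 0 -> der (der x) = r * x -> der I = x ^- 2 -> der (der w) = r * w ->
  exists c d, w = x * (cstC c * I + cstC d).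
Proof.
move=> x0 hx hI hw.
have : der (x * der w - der x * w) = 0 by rewrite raddfB !derM hx hw; ring.
case/der_eq0P => c hc.
have : der (w / x) = der (cstC c * I).
  rewrite !derM der_cst derV hI -hc; field; exact: x0.
case/der_inj => d hd; exists c, d.
by rewrite -hd mulrCA divff // mulr1.
Qed.

Section AlgebraicPart.
Variables (R : realType) (L : diffExt R) (k : int) (hk : 3 <= `|k|).
Variables (la lc : R[i]) (omega : L) (homega : is_omega k omega).
Variables (x1 y1 : L).
Hypothesis hx1 : algebraic_solution (rfun L k la) x1.
Hypothesis hy1 : algebraic_solution (rfun L k lc) y1.
Local Notation K0 := (K0 omega).
Local Notation K := (Kalg omega x1 y1).

Lemma K0_dsub : diff_subfield K0.
Proof.
apply: der_adjoin => [|_ ->]; first exact: Cz_dsub.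
exact: (der_algebraic (Cz_dsub L) (omega_algebraic hk homega)).
Qed.

Lemma Cz_K0 (a : L) : Cz a -> K0 a.
Proof. exact: adjoin_base. Qed.

Lemma K0_K (a : L) : K0 a -> K a.
Proof. exact: adjoin_base. Qed.

Lemma K_subfield : subfield K.
Proof. exact: adjoin_subfield. Qed.

Lemma K_x1 : K x1.
Proof. by apply: adjoin_gen; right. Qed.

Lemma K_y1 : K y1.
Proof. by apply: adjoin_gen; left. Qed.

Lemma K_dsub : diff_subfield K.
Proof.
have alg a : algebraic_over Cz a -> K a -> K (der a).
  move=> ha Ka; have := der_algebraic (Cz_dsub L) ha.
  apply: adjoin_min; first exact: K_subfield.
    by move=> b Cb; apply: K0_K; apply: Cz_K0.
  by move=> _ ->.
apply: der_adjoin => [|_ [->|->]]; first exact: K0_dsub.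
- by apply: alg; [case: hy1|exact: K_y1].
- by apply: alg; [case: hx1|exact: K_x1].
Qed.

Lemma K_algebraic a : K a -> algebraic_over Cz a.
Proof.
have hA := algebraic_subfield (Cz_subfield L).
have base (b : L) : Cz b -> algebraic_over Cz b.
  exact: (algebraic_base (Cz_subfield L)).
apply: adjoin_min => //; last by move=> _ [->|->]; [case: hy1|case: hx1].
by apply: adjoin_min => // _ ->; apply: omega_algebraic homega.
Qed.

(** If Ia were in K, all solutions of the first equation would be algebraic, so that
    the identity component, which fixes algebraic elements, would be trivial.  It
    is not: the inverse of the parametrization by the additive group separates the
    images of 0 and 1. *)
Lemma Ia_notin_K (Wa : 'M[L]_2) (Ia : L) :
  fundamental_matrix (companion (rfun L k la)) Wa ->
  galois_component_Ga Cz Wa -> der Ia = x1 ^- 2 -> ~ K Ia.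
Proof.
move=> hWa [f [_ _ hf [p [m hp]]]] hIa KIa.
case: hx1 => x10 dx1 _; have [_ hC hD] := K_dsub; have sK := K_subfield.
have hrow j : der (Wa 0 j) = Wa 1 j /\ der (Wa 1 j) = rfun L k la * Wa 0 j.
  case: hWa => _ /matrixP dW; split; [have := dW 0 j|have := dW 1 j];
  by rewrite !mxE !big_ord_recl big_ord0 !mxE /= ?mul0r ?mul1r ?addr0 ?add0r // => ->;
     do ?congr (_ * _); congr (Wa _ _); apply: val_inj.
have K0j j : K (Wa 0 j).
  have [h0 h1] := hrow j; rewrite -h0 in h1.
  have [c [d ->]] := reduction_of_order x10 dx1 hIa h1.
  apply: (sfM sK); first exact: K_x1.
  by apply: (sfD sK) => //; apply: (sfM sK).
have KW i j : K (Wa i j).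
  have [->|->] : i = 0 \/ i = 1 by case: i => [[|[|i]] //= hi]; [left|right]; apply: val_inj.
    exact: K0j.
  by have [<- _] := hrow j; apply: hD.
have hA i j : Cz (companion (rfun L k la) i j).
  have s := Cz_subfield L; rewrite mxE.
  case: i j => [[|[|i]] //= ?] [[|[|j]] //= ?];
  by [exact: sf0 s|exact: sf1 s|exact: Cz_rfun].
have G1 M : identity_component (diff_galois Cz Wa) M -> M = 1%:M.
  move=> GM; apply: (@cmx_inj _ L); case: (hWa) => Wu _.
  apply: (can_inj (mulKmx Wu)); rewrite map_mx1 mulmx1.
  apply/matrixP => i j.
  have col (B : 'M[L]_2) : B i j = (B *m map_mx (@cstC _ L) (delta_mx j 0 : 'cV_2)) i 0.
    rewrite mxE (bigD1 j) //= !mxE !eqxx rmorph1 mulr1 big1 ?addr0 // => l lj.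
    by rewrite !mxE (negbTE lj) rmorph0 mulr0.
  rewrite col [RHS]col; apply: (identity_component_fixes (Cz_dsub L) hA hWa GM).
  by rewrite -col; apply: K_algebraic.
have f1 t : f t = 1%:M by apply: G1; rewrite /galois_component_Ga in hf; rewrite -hf; exists t.
have := hp 1; rewrite f1 -(f1 0) hp => /eqP.
by rewrite eq_sym oner_eq0.
Qed.

End AlgebraicPart.

(** * Solutions of the second variational system *)
Section VE2System.
Variables (R : realType) (L : diffExt R) (ra rc om : L).
Local Notation A := (VE2 ra rc om).

(** The seven scalar equations of the system: s0, s1, s2 stand for x^2, x x', x'^2
    and obey the symmetric square of the first equation, whether or not they come
    from a single solution x. *)
Definition VE2_solution (v0 v1 s0 s1 s2 y0 y1 : L) :=
  [/\ der v0 = v1, der v1 = ra * v0,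
      [/\ der s0 = 2%:R * s1, der s1 = ra * s0 + s2 & der s2 = 2%:R * ra * s1],
      der y0 = y1 & der y1 = om * s0 + rc * y0].

Definition col7 (v0 v1 s0 s1 s2 y0 y1 : L) : 'cV[L]_7 :=
  \col_(i < 7) nth 0 [:: v0; v1; s0; s1; s2; y0; y1] i.

Definition comp7 (v : 'cV[L]_7) (i : nat) := v (inord i) 0.

Lemma VE2_mul (v : 'cV[L]_7) :
  A *m v = col7 (comp7 v 1) (ra * comp7 v 0) (2%:R * comp7 v 3)
    (ra * comp7 v 2 + comp7 v 4) (2%:R * ra * comp7 v 3) (comp7 v 6)
    (om * comp7 v 2 + rc * comp7 v 5).
Proof.
apply/matrixP => i j; rewrite ord1 !mxE.
under eq_bigr => l _ do rewrite -[l in v l _]inord_val -/(comp7 v l).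
rewrite !big_ord_recl big_ord0 /= !mxE.
case: i => [[|[|[|[|[|[|[|i]]]]]]] //= hi]; rewrite /bump /=; ring.
Qed.

Lemma VE2_solutionP (v : 'cV[L]_7) :
  map_mx der v = A *m v <->
  VE2_solution (comp7 v 0) (comp7 v 1) (comp7 v 2) (comp7 v 3) (comp7 v 4)
    (comp7 v 5) (comp7 v 6).
Proof.
rewrite VE2_mul; split=> [/matrixP h|[h0 h1 [h2 h3 h4] h5 h6]].
  have e i : (i < 7)%N -> der (comp7 v i) = _ :=
    fun hi => etrans (esym (mxE _ _ _ _)) (h (inord i) 0).
  by split; [| |split| |]; rewrite e // mxE inordK.
apply/matrixP => i j; rewrite ord1 !mxE -[i in v i _]inord_val -/(comp7 v i).
by case: i => [[|[|[|[|[|[|[|i]]]]]]] //= hi].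
Qed.

Lemma comp7K v0 v1 s0 s1 s2 y0 y1 i : (i < 7)%N ->
  comp7 (col7 v0 v1 s0 s1 s2 y0 y1) i = nth 0 [:: v0; v1; s0; s1; s2; y0; y1] i.
Proof. by move=> hi; rewrite /comp7 mxE inordK. Qed.

Lemma col7_solution v0 v1 s0 s1 s2 y0 y1 :
  VE2_solution v0 v1 s0 s1 s2 y0 y1 ->
  map_mx der (col7 v0 v1 s0 s1 s2 y0 y1) = A *m col7 v0 v1 s0 s1 s2 y0 y1.
Proof. by move=> h; apply/VE2_solutionP; rewrite !comp7K. Qed.

Variable Y : 'M[L]_7.
Hypothesis hY : fundamental_matrix A Y.

Lemma VE2_column j : VE2_solution (Y (inord 0) j) (Y (inord 1) j)
  (Y (inord 2) j) (Y (inord 3) j) (Y (inord 4) j) (Y (inord 5) j) (Y (inord 6) j).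
Proof.
case: hY => _ dY.
have /VE2_solutionP : map_mx der (col j Y) = A *m col j Y.
  by rewrite map_col dY !colE mulmxA.
by rewrite /comp7 !mxE.
Qed.

(** The rows 2, 3, 4 of Y have rank 3 and involve only each other, so three suitable
    columns of them form a fundamental matrix Z of the symmetric square.  The same
    constant combination of the corresponding columns of Y lifts a solution. *)
Lemma VE2_sym_square_lift s0 s1 s2 :
  [/\ der s0 = 2%:R * s1, der s1 = ra * s0 + s2 & der s2 = 2%:R * ra * s1] ->
  exists v : 'cV[L]_7, [/\ map_mx der v = A *m v, comp7 v 2 = s0,
     comp7 v 3 = s1 & comp7 v 4 = s2].
Proof.
move=> [h0 h1 h2]; case: (hY) => Yu dY.
pose f (i : 'I_3) : 'I_7 := inord (i + 2).
have fE (i : 'I_3) : f i = (i + 2)%N :> nat.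
  by rewrite inordK //; case: i => [[|[|[|]]]].
have finj : injective f.
  move=> i j /(congr1 val) /=; rewrite -![nat_of_ord (f _)]/(val _) /= !fE => /eqP.
  by rewrite eqn_add2r => /eqP; apply: val_inj.
pose Yb := rowsub f Y.
have Yb_full : row_full Yb^T.
  rewrite /row_full mxrank_tr -/(row_free Yb) -kermx_eq0 -submx0.
  apply/rV_subP => d /sub_kermxP hd.
  have : d *m rowsub f 1%:M *m Y = 0 by rewrite -mulmxA mul_rowsub_mx mul1mx.
  move/(congr1 (mulmx^~ (invmx Y))); rewrite mulmxK // mul0mx => e.
  have : d *m rowsub f 1%:M *m colsub f 1%:M = 0 by rewrite e mul0mx.
  rewrite -mulmxA -mxsub_mul mulmx1.
  have -> : mxsub f f 1%:M = 1%:M :> 'M[L]_3.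
    by apply/matrixP => i j; rewrite !mxE (inj_eq finj).
  by rewrite mulmx1 => ->; apply: sub0mx.
pose Z := (rowsub (fullrankfun Yb_full) Yb^T)^T.
have Zu : Z \in unitmx by rewrite unitmx_tr; apply: fullrowsub_unit.
pose B : 'M[L]_3 := mxsub f f A.
have ZE i j : Z i j = Y (f i) (fullrankfun Yb_full j) by rewrite !mxE.
have dsys (u0 u1 u2 : L) :
   [/\ der u0 = 2%:R * u1, der u1 = ra * u0 + u2 & der u2 = 2%:R * ra * u1] ->
   forall i : 'I_3, der (nth 0 [:: u0; u1; u2] i) = \sum_(l < 3) B i l * nth 0 [:: u0; u1; u2] l.
  move=> [e0 e1 e2] i; rewrite !big_ord_recl big_ord0 /= !mxE !fE /=.
  by case: i => [[|[|[|i]]] //= hi]; rewrite ?e0 ?e1 ?e2; ring.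
have hZ : fundamental_matrix B Z.
  split=> //; apply/matrixP => i j; rewrite mxE [RHS]mxE.
  set l := fullrankfun Yb_full j.
  have [_ _ /dsys sys _ _] := VE2_column l.
  have e (m : 'I_3) : Z m j = nth 0 [:: Y (inord 2) l; Y (inord 3) l; Y (inord 4) l] m.
    by rewrite ZE /f; case: m => [[|[|[|m]]] //= hm].
  by rewrite e sys; apply: eq_bigr => m _; rewrite e.
pose s : 'cV[L]_3 := \col_i nth 0 [:: s0; s1; s2] i.
have [|c hc] := solution_cst hZ (v := s).
  apply/matrixP => i j; rewrite !mxE dsys //; apply: eq_bigr => m _.
  by rewrite [s _ _]mxE.
pose v : 'cV[L]_7 := colsub (fullrankfun Yb_full) Y *m map_mx cstC c.
exists v.
have sv (i : 'I_3) : v (f i) 0 = s i 0.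
  by rewrite hc !mxE; apply: eq_bigr => m _; rewrite !mxE.
split.
- by rewrite der_mulmx der_cmx mulmx0 addr0 map_mxsub dY -mulmx_colsub mulmxA.
- by have := sv 0; rewrite [s _ _]mxE.
- by have := sv 1; rewrite [s _ _]mxE.
- by have := sv (inord 2); rewrite [s _ _]mxE /f inordK.
Qed.

End VE2System.

Section Formula.
Variables (R : realType) (L : diffExt R) (ra rc om x1 y1 Ia Ic : L).
Hypotheses (x10 : x1 != 0) (y10 : y1 != 0).
Hypotheses (dx1 : der (der x1) = ra * x1) (dy1 : der (der y1) = rc * y1).
Hypotheses (dIa : der Ia = x1 ^- 2) (dIc : der Ic = y1 ^- 2).

(** For solutions u, v of x'' = ra x, the form
      u v s2 - (u v' + u' v) s1 + u' v' s0
    is constant.  Its three values on x1, x2 determine s0, s1, s2, because the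
    Wronskian of x1, x2 is 1. *)
Lemma sym_square_solution s0 s1 s2 :
  [/\ der s0 = 2%:R * s1, der s1 = ra * s0 + s2 & der s2 = 2%:R * ra * s1] ->
  exists p q r : R[i], let x2 := x1 * Ia in let dx2 := der x1 * Ia + x1^-1 in
  [/\ s0 = cstC p * x1 ^+ 2 + cstC q * x1 * x2 + cstC r * x2 ^+ 2,
      s1 = cstC p * x1 * der x1 + cstC q * (x1 * dx2 + der x1 * x2) / 2%:R + cstC r * x2 * dx2 &
      s2 = cstC p * der x1 ^+ 2 + cstC q * der x1 * dx2 + cstC r * dx2 ^+ 2].
Proof.
move=> [h0 h1 h2]; set x2 := x1 * Ia; set dx2 := der x1 * Ia + x1^-1.
have two0 : (2%:R : L) != 0 := natS_neq0 L 1.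
have dx2E : der x2 = dx2.
  by rewrite /x2 /dx2 derM dIa; field; exact: x10.
have ddx2 : der dx2 = ra * x2.
  by rewrite /x2 /dx2 !derE dx1 dIa; field; exact: x10.
have W : x1 * dx2 - der x1 * x2 = 1 by rewrite /x2 /dx2; field; exact: x10.
clearbody x2 dx2.
have k11 : der (x1 ^+ 2 * s2 - 2%:R * x1 * der x1 * s1 + der x1 ^+ 2 * s0) = 0.
  by rewrite !derE dx1 h0 h1 h2; ring.
have k22 : der (x2 ^+ 2 * s2 - 2%:R * x2 * dx2 * s1 + dx2 ^+ 2 * s0) = 0.
  by rewrite !derE ddx2 dx2E h0 h1 h2; ring.
have k12 : der (x1 * x2 * s2 - (x1 * dx2 + der x1 * x2) * s1 + der x1 * dx2 * s0) = 0.
  by rewrite !derE ddx2 dx2E dx1 h0 h1 h2; ring.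
move: k11 k22 k12 => /der_eq0P [r hr] /der_eq0P [p hp] /der_eq0P [q hq].
exists p, (- 2%:R * q), r.
rewrite rmorphM rmorphN rmorph_nat -hp -hq -hr.
have W2 : (x1 * dx2 - der x1 * x2) ^+ 2 = 1 by rewrite W expr1n.
by split; [rewrite -[LHS]mul1r|rewrite -[LHS]mul1r|rewrite -[LHS]mul1r];
   rewrite -{1}W2; field.
Qed.

Variables (Phi Pa Pc P2a Pca Pc2a : L).
Hypotheses (dPhi : der Phi = om * y1 * x1 ^+ 2).
Hypotheses (dPa : der Pa = Phi * der Ia) (dPc : der Pc = Phi * der Ic).
Hypotheses (dP2a : der P2a = Phi * der Ia * Ia).
Hypotheses (dPca : der Pca = Phi * der (Ic * Ia)).
Hypotheses (dPc2a : der Pc2a = Phi * der (Ic * Ia ^+ 2)).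

(** Variation of constants: T = y1 w' - y1' w satisfies T' = omega y1 s0, and
    w / y1 is a primitive of T Ic'.  Both are integrated by parts against Phi. *)
Lemma forced_solution s0 w dw p q r :
  s0 = cstC p * x1 ^+ 2 + cstC q * x1 * (x1 * Ia) + cstC r * (x1 * Ia) ^+ 2 ->
  der w = dw -> der dw = om * s0 + rc * w ->
  exists e f : R[i],
   let V := cstC p * Pc + cstC q * (Pca - Ic * Pa) + cstC r * (Pc2a - 2%:R * Ic * P2a)
     + cstC e * Ic + cstC f in
   let T := cstC p * Phi + cstC q * (Phi * Ia - Pa) + cstC r * (Phi * Ia ^+ 2 - 2%:R * P2a)
     + cstC e in
   w = y1 * V /\ dw = der y1 * V + T / y1.
Proof.
move=> hs hw hdw.
have : der (y1 * dw - der y1 * w) =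
  der (cstC p * Phi + cstC q * (Phi * Ia - Pa) + cstC r * (Phi * Ia ^+ 2 - 2%:R * P2a)).
  by rewrite !derE dPa dP2a dPhi dy1 hw hdw hs; ring.
case/der_inj => e he.
have : der (w / y1) = der (cstC p * Pc + cstC q * (Pca - Ic * Pa)
     + cstC r * (Pc2a - 2%:R * Ic * P2a) + cstC e * Ic).
  have -> : der (w / y1) = (y1 * dw - der y1 * w) * der Ic.
    by rewrite derM derV hw dIc; field; exact: y10.
  by rewrite he !derE dPa dP2a dPc dPca dPc2a !derE; ring.
case/der_inj => f hf; exists e, f => V T.
have hV : w = y1 * V by rewrite /V -hf mulrCA divff // mulr1.
split=> //; apply: (mulfI y10).
rewrite mulrDr [_ * (T / _)]mulrCA divff // mulr1 /T -he hV; ring.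
Qed.

(** Stated for any subring U, as it serves for fields, for the elements on which an
    automorphism is unipotent, and for those on which two automorphisms commute. *)
Lemma VE2_solution_in (U : set L) (v0 v1 s0 s1 s2 w dw : L) :
  U 1 -> (forall a b, U a -> U b -> U (a - b)) ->
  (forall a b, U a -> U b -> U (a * b)) -> (forall c, U (cstC c)) ->
  U x1 -> U (der x1) -> U x1^-1 -> U y1 -> U (der y1) -> U y1^-1 ->
  U Phi -> U Ia -> U Ic -> U Pa -> U Pc -> U P2a -> U Pca -> U Pc2a ->
  VE2_solution ra rc om v0 v1 s0 s1 s2 w dw ->
  [/\ U v0, U v1, [/\ U s0, U s1 & U s2], U w & U dw].
Proof.
move=> U1 UB UM UC Ux Udx UxV Uy Udy UyV UPhi UIa UIc UPa UPc UP2a UPca UPc2a.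
move=> [h0 h1 hs hw hdw].
have U0 : U 0 by rewrite -(subrr 1); apply: UB.
have UN a : U a -> U (- a) by move=> Ua; rewrite -sub0r; apply: UB.
have UD a b : U a -> U b -> U (a + b).
  by move=> Ua Ub; rewrite -[b]opprK; apply: UB => //; apply: UN.
have U2 : U 2%:R by apply: UD.
have U2V : U (2%:R)^-1 by rewrite -(rmorph_nat (@cstC _ L)) -fmorphV.
have UX a : U a -> U (a ^+ 2) by move=> Ua; rewrite expr2; apply: UM.
have [c [d hv0]] : exists c d, v0 = x1 * (cstC c * Ia + cstC d).
  by apply: (reduction_of_order (r := ra)) => //; rewrite h0.
have [p [q [r [e0 e1 e2]]]] := sym_square_solution hs.
have [e [f [ew edw]]] := forced_solution e0 hw hdw.
have UV0 : U v0 by rewrite hv0; do ?[exact: (UC _)|apply: (UD _ _)|apply: (UM _ _)].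
have UV1 : U v1.
  rewrite -h0 hv0 !derE dIa.
  have -> : x1 ^- 2 = x1^-1 * x1^-1 by rewrite -expr2 exprVn.
  by do ?[exact: (UC _)|apply: (UD _ _)|apply: (UM _ _)].
split=> //; [split| |].
- by rewrite e0; do ?[exact: (UC _)|apply: (UX _)|apply: (UD _ _)|apply: (UM _ _)].
- by rewrite e1; do ?[exact: (UC _)|apply: (UX _)|apply: (UD _ _)|apply: (UM _ _)].
- by rewrite e2; do ?[exact: (UC _)|apply: (UX _)|apply: (UD _ _)|apply: (UM _ _)].
- by rewrite ew; do ?[exact: (UC _)|apply: (UX _)|apply: (UD _ _)|apply: (UN _)|apply: (UM _ _)].
- by rewrite edw; do ?[exact: (UC _)|apply: (UX _)|apply: (UD _ _)|apply: (UN _)|apply: (UM _ _)].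
Qed.

End Formula.

(** * Automorphisms acting on iterated integrals *)
Section Unipotent.
Variables (R : realType) (L : diffExt R) (F : set L) (s : L -> L).
Hypotheses (hF : diff_subfield F) (hs : diff_embedding F s) (hst : forall a, F a -> F (s a)).
Let sF : subfield F. Proof. by case: hF. Qed.
Let d a := s a - a.

Definition unipotent_at (a : L) := F a /\ exists N, iter N d a = 0.

Let Fd a : F a -> F (d a).
Proof. by move=> Fa; apply: (sfB sF) => //; apply: hst. Qed.

Let d0 : d 0 = 0. Proof. by rewrite /d (emb0 hs) subr0. Qed.

Let iter_d0 N : iter N d 0 = 0.
Proof. by elim: N => //= N ->. Qed.

Lemma iter_shift_le a M N : (M <= N)%N -> iter M d a = 0 -> iter N d a = 0.
Proof. by move=> h e; rewrite -(subnK h) iterD e iter_d0. Qed.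

Let iter_dB N a b : F a -> F b -> iter N d (a - b) = iter N d a - iter N d b.
Proof.
elim: N a b => // N IH a b Fa Fb; rewrite !iterSr -IH; try exact: Fd.
by congr (iter _ _ _); rewrite /d (embB hs) //; ring.
Qed.

Lemma unipotent_atB a b : unipotent_at a -> unipotent_at b -> unipotent_at (a - b).
Proof.
move=> [Fa [M hM]] [Fb [N hN]]; split; first exact: (sfB sF).
exists (M + N)%N; rewrite iter_dB // (iter_shift_le (leq_addr _ _) hM).
by rewrite (iter_shift_le (leq_addl _ _) hN) subr0.
Qed.

Lemma unipotent_atD a b : unipotent_at a -> unipotent_at b -> unipotent_at (a + b).
Proof.
move=> ha hb; rewrite -[b]opprK -[- b]sub0r; apply: unipotent_atB => //.
by apply: unipotent_atB => //; split; [exact: (sf0 sF)|exists 0%N].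
Qed.

Lemma unipotent_at_shift a : F a -> unipotent_at (s a - a) -> unipotent_at a.
Proof. by move=> Fa [_ [N hN]]; split=> //; exists N.+1; rewrite iterSr. Qed.

Lemma unipotent_at_fixed a : F a -> s a = a -> unipotent_at a.
Proof. by move=> Fa h; split=> //; exists 1%N; rewrite /= /d h subrr. Qed.

(** Leibniz rule for d = s - 1: d(a b) = d(a) b + a d(b) + d(a) d(b), where each
    term has smaller total nilpotency order. *)
Lemma unipotent_atM a b : unipotent_at a -> unipotent_at b -> unipotent_at (a * b).
Proof.
move=> [Fa [M hM]] [Fb [N hN]]; have [n hn] : exists n, (M + N <= n)%N by exists (M + N)%N.
elim: n M N a b hn Fa hM Fb hN => [|n IH] M N a b hn Fa hM Fb hN.
  move: hn hM; rewrite leqn0 addn_eq0 => /andP [/eqP -> _] /= ->.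
  by rewrite mul0r; apply: unipotent_at_fixed; [exact: (sf0 sF)|exact: (emb0 hs)].
case: M hn hM => [|M] hn hM.
  move: hM => /= ->.
  by rewrite mul0r; apply: unipotent_at_fixed; [exact: (sf0 sF)|exact: (emb0 hs)].
case: N hn hN => [|N] hn hN.
  move: hN => /= ->.
  by rewrite mulr0; apply: unipotent_at_fixed; [exact: (sf0 sF)|exact: (emb0 hs)].
apply: unipotent_at_shift; first exact: (sfM sF).
have -> : s (a * b) - a * b = d a * b + a * d b + d a * d b.
  by rewrite (embM hs) // /d; ring.
rewrite iterSr in hM; rewrite iterSr in hN.
have hn' : (M + N.+1 <= n)%N by rewrite -ltnS.
have hn'' : (M.+1 + N <= n)%N by rewrite addSn -addnS.
apply: unipotent_atD; first apply: unipotent_atD.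
- by apply: (IH M N.+1) => //; [exact: Fd|rewrite iterSr].
- by apply: (IH M.+1 N) => //; [rewrite iterSr|exact: Fd].
- by apply: (IH M N) => //; [apply: leq_trans hn'; rewrite leq_add2l|exact: Fd|exact: Fd].
Qed.

End Unipotent.

Section Shift.
Variables (R : realType) (L : diffExt R) (K E : set L) (s : L -> L) (Ia Ic : L).
Hypotheses (dE : diff_subfield E) (hs : diff_embedding E s) (KE : forall a, K a -> E a).
Hypothesis (sfix : forall a, K a -> s a = a).
Let sE : subfield E. Proof. by case: dE. Qed.

Lemma shift_primitive t u : E t -> der u = s (der t) -> exists c, s t = u + cstC c.
Proof. by move=> Et hu; apply: der_inj; rewrite -(emb_der hs) // hu. Qed.

Lemma shift_first t : E t -> K (der t) -> exists c, s t = t + cstC c.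
Proof. by move=> Et Kt; apply: shift_primitive => //; rewrite sfix. Qed.

(** Since f' and g' are fixed, s (W') = f' (Ia + a) + g' (Ic + b). *)
Lemma shift_second_level f g W a b :
  E Ia -> E Ic -> K (der f) -> K (der g) -> der W = der f * Ia + der g * Ic ->
  s Ia = Ia + cstC a -> s Ic = Ic + cstC b ->
  s (der W) = der (W + cstC a * f + cstC b * g).
Proof.
move=> EIa EIc Kf Kg dW ha hb; rewrite dW.
have [Ef Eg] := (KE Kf, KE Kg).
rewrite (embD dE hs) ?(embM hs) //; try exact: (sfM sE).
by rewrite (sfix Kf) (sfix Kg) ha hb !derE dW; ring.
Qed.

End Shift.

(** From here on, Pa, Pc stand for Psia, Psic, and P2a, Pca,
    Pc2a for primitives of Phi Ia' Ia, Phi (Ic Ia)' and Phi (Ic Ia^2)'. *)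
Section Core.
Variables (R : realType) (L : diffExt R) (k : int) (hk : 3 <= `|k|).
Variables (la lc : R[i]) (omega : L) (homega : is_omega k omega).
Local Notation ra := (rfun L k la).
Local Notation rc := (rfun L k lc).
Variable Y : 'M[L]_7.
Hypothesis hY : fundamental_matrix (VE2 ra rc omega) Y.
Variables (x1 y1 : L).
Hypothesis hx1 : algebraic_solution ra x1.
Hypothesis hy1 : algebraic_solution rc y1.
Variables (Ia Ic : L).
Hypotheses (hIa : der Ia = x1 ^- 2) (hIc : der Ic = y1 ^- 2).
Local Notation K0 := (K0 omega).
Local Notation K := (Kalg omega x1 y1).
Local Notation F := (pv_ext K0 Y).

Let x10 : x1 != 0. Proof. by case: hx1. Qed.
Let y10 : y1 != 0. Proof. by case: hy1. Qed.
Let dx1 : der (der x1) = ra * x1. Proof. by case: hx1. Qed.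
Let dy1 : der (der y1) = rc * y1. Proof. by case: hy1. Qed.
Let sK : subfield K := K_subfield omega x1 y1.
Let dK : diff_subfield K := K_dsub hk homega hx1 hy1.
Let dK0 : diff_subfield K0 := K0_dsub hk homega.

Lemma VE2_K0 i j : K0 (VE2 ra rc omega i j).
Proof.
have [s0 _ _] := dK0; have h0 := sf0 s0; have h1 := sf1 s0; have h2 := sf_nat s0 2.
have ha : K0 ra by apply: Cz_K0; apply: Cz_rfun.
have hc : K0 rc by apply: Cz_K0; apply: Cz_rfun.
have ho : K0 omega by apply: adjoin_gen.
have h2a : K0 (2%:R * ra) by apply: (sfM s0).
rewrite mxE.
by case: i j => [[|[|[|[|[|[|[|i]]]]]]] //= ?] [[|[|[|[|[|[|[|j]]]]]]] //= ?].
Qed.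

Lemma F_dsub : diff_subfield F. Proof. exact: pv_dsub dK0 VE2_K0 hY. Qed.
Let sF : subfield F. Proof. by case: F_dsub. Qed.

Lemma F_solution v0 v1 s0 s1 s2 w dw :
  VE2_solution ra rc omega v0 v1 s0 s1 s2 w dw ->
  [/\ F v0, F v1 & F w].
Proof.
move=> /col7_solution h; split.
- by have := pv_solution dK0 hY (inord 0) 0 h; rewrite mxE inordK.
- by have := pv_solution dK0 hY (inord 1) 0 h; rewrite mxE inordK.
- by have := pv_solution dK0 hY (inord 5) 0 h; rewrite mxE inordK.
Qed.

Lemma x1_solution : VE2_solution ra rc omega x1 (der x1) 0 0 0 0 0.
Proof. by split=> //; [split| |]; rewrite ?raddf0; ring. Qed.

Lemma y1_solution : VE2_solution ra rc omega 0 0 0 0 0 y1 (der y1).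
Proof. by split=> //; [| |split|rewrite dy1]; rewrite ?raddf0; ring. Qed.

Lemma K_F a : K a -> F a.
Proof.
apply: adjoin_min => //; first by move=> b; apply: adjoin_base.
move=> _ [->|->]; first by case: (F_solution y1_solution).
by case: (F_solution x1_solution).
Qed.

Let K_dx1 : K (der x1). Proof. by case: dK => _ _; apply; apply: K_x1. Qed.
Let K_dy1 : K (der y1). Proof. by case: dK => _ _; apply; apply: K_y1. Qed.
Let Kcst c : K (cstC c). Proof. by case: dK. Qed.
Lemma K_dIa : K (der Ia).
Proof. by rewrite hIa; apply: (sfV sK); apply: (sfX sK); apply: K_x1. Qed.
Lemma K_dIc : K (der Ic).
Proof. by rewrite hIc; apply: (sfV sK); apply: (sfX sK); apply: K_y1. Qed.

Lemma F_Ia : F Ia.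
Proof.
have [|h _ _] := @F_solution (x1 * Ia) (der x1 * Ia + x1^-1) 0 0 0 0 0.
  split; [rewrite derM hIa; field; exact: x10| | |rewrite raddf0; ring|rewrite raddf0; ring].
    by rewrite !derE dx1 hIa; field; exact: x10.
  by split; rewrite raddf0; ring.
have -> : Ia = x1 * Ia / x1 by field; exact: x10.
by apply: (sfdiv sF) => //; apply: K_F; apply: K_x1.
Qed.

Lemma F_Ic : F Ic.
Proof.
have [|_ _ h] := @F_solution 0 0 0 0 0 (y1 * Ic) (der y1 * Ic + y1^-1).
  split; [rewrite raddf0; ring|rewrite raddf0; ring| |rewrite derM hIc; field; exact: y10|].
    by split; rewrite raddf0; ring.
  by rewrite !derE dy1 hIc; field; exact: y10.
have -> : Ic = y1 * Ic / y1 by field; exact: y10.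
by apply: (sfdiv sF) => //; apply: K_F; apply: K_y1.
Qed.

Section Integrals.
Variables (Phi Pa Pc : L).
Hypotheses (dPhi : der Phi = omega * y1 * x1 ^+ 2) (KPhi : K Phi).
Hypotheses (dPa : der Pa = Phi * der Ia) (dPc : der Pc = Phi * der Ic).

Let FPhi : F Phi. Proof. exact: K_F. Qed.
Let Fcst c : F (cstC c). Proof. exact: pv_cst. Qed.

(** The integrals that occur in variation of constants exist in L because they are
    read off a fundamental matrix. *)
Lemma sym_square_integral s0 s1 s2 :
  [/\ der s0 = 2%:R * s1, der s1 = ra * s0 + s2 & der s2 = 2%:R * ra * s1] ->
  exists V T, [/\ F V, F T, der V = T * der Ic & der T = omega * y1 * s0].
Proof.
move=> /(VE2_sym_square_lift hY) [v [hv h2 h3 h4]].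
have [_ _ _ h5 h6] := (iffLR (VE2_solutionP ra rc omega v)) hv.
have Fv i : F (comp7 v i) by exact: (pv_solution dK0 hY (inord i) 0 hv).
have [Fy Fdy] : F y1 /\ F (der y1) by split; apply: K_F => //; apply: K_y1.
exists (comp7 v 5 / y1), (y1 * comp7 v 6 - der y1 * comp7 v 5); split.
- by apply: (sfdiv sF).
- by apply: (sfB sF); apply: (sfM sF).
- by rewrite derM derV h5 hIc; field; exact: y10.
- by rewrite !derE h5 h6 dy1 h2; ring.
Qed.

Lemma F_Pc : F Pc.
Proof.
have [|_ _ h] := @F_solution 0 0 (x1 ^+ 2) (x1 * der x1) (der x1 ^+ 2) (y1 * Pc)
   (der y1 * Pc + Phi / y1).
  split; [rewrite raddf0; ring|rewrite raddf0; ring| | |].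
  - by split; rewrite !derE ?dx1; ring.
  - by rewrite derM dPc hIc; field; exact: y10.
  - by rewrite !derE dy1 dPc hIc dPhi; field; exact: y10.
have -> : Pc = y1 * Pc / y1 by field; exact: y10.
by apply: (sfdiv sF) => //; apply: K_F; apply: K_y1.
Qed.

(** Obtained from the solutions over x1 x2 and x2^2, whose integrals T are
    Phi Ia - Psia and Phi Ia^2 - 2 Psi2a up to constants. *)
Lemma second_level_integrals : F Pa /\ exists P2a Pca Pc2a,
  [/\ F P2a, F Pca & F Pc2a] /\
  [/\ der P2a = Phi * der Ia * Ia, der Pca = Phi * der (Ic * Ia) &
      der Pc2a = Phi * der (Ic * Ia ^+ 2)].
Proof.
pose x2 := x1 * Ia; pose dx2 := der x1 * Ia + x1^-1.
have two0 : (2%:R : L) != 0 := natS_neq0 L 1.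
have dx2E : der x2 = dx2 by rewrite /x2 /dx2 derM hIa; field; exact: x10.
have ddx2 : der dx2 = ra * x2 by rewrite /x2 /dx2 !derE dx1 hIa; field; exact: x10.
have [FIa FIc] := (F_Ia, F_Ic).
have [|V [T [FV FT dV dT]]] := @sym_square_integral
    (x1 * x2) ((x1 * dx2 + der x1 * x2) / 2%:R) (der x1 * dx2).
  clearbody x2 dx2; have h2 : der (2%:R : L)^-1 = 0 by rewrite derV der_nat oppr0 mul0r.
  split; rewrite !derM ?derD ?derM ?h2 ?dx2E ?ddx2 ?dx1; field; exact: two0.
have [|V2 [T2 [FV2 FT2 dV2 dT2]]] := @sym_square_integral (x2 ^+ 2) (x2 * dx2) (dx2 ^+ 2).
  by clearbody x2 dx2; split; rewrite ?der_sqr ?derM ?dx2E ?ddx2; ring.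
have [c hc] : exists c, Pa = Phi * Ia - T + cstC c.
  by apply: der_inj; rewrite dPa derB derM dT dPhi /x2; ring.
have FPa : F Pa.
  by rewrite hc; apply: (sfD sF) => //; apply: (sfB sF) => //; apply: (sfM sF).
split=> //.
have FP2a : F ((Phi * Ia ^+ 2 - T2) / 2%:R).
  apply: (sfdiv sF); last exact: (sf_nat sF).
  by apply: (sfB sF) => //; apply: (sfM sF) => //; apply: (sfX sF).
have dP2a : der ((Phi * Ia ^+ 2 - T2) / 2%:R) = Phi * der Ia * Ia.
  by rewrite derM derV der_nat oppr0 mul0r !derE dT2 dPhi /x2; field; exact: two0.
exists ((Phi * Ia ^+ 2 - T2) / 2%:R), (V + Ic * Pa - cstC c * Ic),
  (V2 + 2%:R * Ic * ((Phi * Ia ^+ 2 - T2) / 2%:R)); split; split=> //.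
- by apply: (sfB sF); [apply: (sfD sF) => //; apply: (sfM sF)|apply: (sfM sF)].
- apply: (sfD sF) => //; apply: (sfM sF) => //; apply: (sfM sF) => //; exact: (sf_nat sF).
- by rewrite !derE dV dPa hc; ring.
- rewrite derD derM dP2a !derE dV2; field; exact: two0.
Qed.

Variables (P2a Pca Pc2a : L).
Hypotheses (FPa : F Pa) (FP2a : F P2a) (FPca : F Pca) (FPc2a : F Pc2a).
Hypotheses (dP2a : der P2a = Phi * der Ia * Ia).
Hypotheses (dPca : der Pca = Phi * der (Ic * Ia)).
Hypotheses (dPc2a : der Pc2a = Phi * der (Ic * Ia ^+ 2)).

Lemma pv_entries_in (U : set L) :
  (forall a b, U a -> U b -> U (a - b)) ->
  (forall a b, U a -> U b -> U (a * b)) -> (forall a, K a -> U a) ->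
  U Ia -> U Ic -> U Pa -> U Pc -> U P2a -> U Pca -> U Pc2a ->
  forall i j, U (Y i j).
Proof.
move=> UB UM UK UIa UIc UPa UPc UP2a UPca UPc2a i j.
have [h0 h1 [h2 h3 h4] h5 h6] : [/\ U (Y (inord 0) j), U (Y (inord 1) j),
    [/\ U (Y (inord 2) j), U (Y (inord 3) j) & U (Y (inord 4) j)],
    U (Y (inord 5) j) & U (Y (inord 6) j)].
  apply: (VE2_solution_in x10 y10 dx1 dy1 hIa hIc dPhi dPa dPc dP2a dPca dPc2a
           (UK _ (sf1 sK)) UB UM) => //; last exact: VE2_column.
  - by move=> c; apply: UK.
  - by apply: UK; apply: K_x1.
  - by apply: UK.
  - by apply: UK; apply: (sfV sK); apply: K_x1.
  - by apply: UK; apply: K_y1.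
  - by apply: UK.
  - by apply: UK; apply: (sfV sK); apply: K_y1.
  - exact: UK.
rewrite -(inord_val i).
by case: i => [[|[|[|[|[|[|[|i]]]]]]] //= hi].
Qed.

Section ShiftThird.
Variables (E : set L) (s : L -> L).
Hypotheses (dE : diff_subfield E) (hs : diff_embedding E s) (KE : forall a, K a -> E a).
Hypothesis (sfix : forall a, K a -> s a = a).
Let sE : subfield E. Proof. by case: dE. Qed.

Lemma shift_third_level a b :
  E Ia -> E Ic -> s Ia = Ia + cstC a -> s Ic = Ic + cstC b ->
  s (der Pc2a) = der (Pc2a + 2%:R * cstC a * Pca + cstC a ^+ 2 * Pc +
                      2%:R * cstC b * P2a + 2%:R * cstC a * cstC b * Pa).
Proof.
move=> EIa EIc ha hb.
have [EPhi EdIa EdIc] := And3 (KE KPhi) (KE K_dIa) (KE K_dIc).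
have -> : der Pc2a = Phi * (der Ic * (Ia * Ia) + (1 + 1) * (Ic * (Ia * der Ia))).
  by rewrite dPc2a !derE; ring.
have EII : E (Ia * Ia) by apply: (sfM sE).
have EIdI : E (Ia * der Ia) by apply: (sfM sE).
have EIIdI : E (Ic * (Ia * der Ia)) by apply: (sfM sE).
have E2 : E (1 + 1 : L) by apply: (sfD sE); apply: (sf1 sE).
have h1 : E (der Ic * (Ia * Ia)) by apply: (sfM sE).
have h2 : E ((1 + 1) * (Ic * (Ia * der Ia))) by apply: (sfM sE).
have h3 : E (der Ic * (Ia * Ia) + (1 + 1) * (Ic * (Ia * der Ia))) by apply: (sfD sE).
rewrite !((embM hs), (embD dE hs)) ?(emb1 hs) //; try exact: (sf1 sE).
rewrite (sfix KPhi) (sfix K_dIa) (sfix K_dIc) ha hb.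
rewrite !derE dP2a dPca dPc2a dPa dPc !derE; ring.
Qed.

End ShiftThird.

(** Translate h by 1, then climb the tower Ia, Ic, Psia, Psic, Psi2a, Psica, Psic2a:
    at each step, the image of the derivative of the next integral has an explicit
    primitive, so that the embedding extends. *)
Lemma galois_moves h : K (der h) -> ~ K h ->
  exists s, [/\ diff_embedding F s, forall a, K a -> s a = a & s h <> h].
Proof.
move=> Kdh Kh.
pose good E s := [/\ diff_subfield E, diff_embedding E s, forall a, K a -> E a,
  forall a, K a -> s a = a & E h /\ s h = h + 1].
have step E s t u : good E s -> E (der t) -> der u = s (der t) ->
    exists E' s', [/\ good E' s', forall a, E a -> E' a & E' t].
  move=> [dE hs KE sfix [Eh sh]] Et' hu.
  have [s' [hs' agree _ _]] := extend_embedding dE hs Et' hu.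
  have sub a : E a -> adjoin E [set t] a by exact: adjoin_base.
  exists (adjoin E [set t]), s'; split=> //; last exact: adjoin_gen.
  split=> //.
  - by apply: der_adjoin => // _ ->; apply: sub.
  - by move=> a Ka; apply: sub; apply: KE.
  - by move=> a Ka; rewrite agree ?sfix //; apply: KE.
  - by split; [exact: sub|rewrite agree].
have [E0 [s0 g0]] : exists E s, good E s.
  have dh1 : der (h + 1) = id (der h) by rewrite derD der1 addr0.
  have [s' [hs' agree sh _]] := extend_embedding dK (diff_embedding_id K) Kdh dh1.
  have sub a : K a -> adjoin K [set h] a by exact: adjoin_base.
  exists (adjoin K [set h]), s'; split=> //.
  - by apply: der_adjoin => // _ ->; apply: sub.
  - by split; [exact: adjoin_gen|exact: sh].
have first E s t : good E s -> K (der t) ->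
    exists E' s', [/\ good E' s', forall a, E a -> E' a & E' t].
  move=> g Kt; have [_ _ KE sfix _] := g.
  by apply: (step E s t t g); [exact: KE|rewrite sfix].
have KdPa : K (der Pa) by rewrite dPa; apply: (sfM sK) => //; exact: K_dIa.
have KdPc : K (der Pc) by rewrite dPc; apply: (sfM sK) => //; exact: K_dIc.
have Kd0 : K (der (0 : L)) by rewrite raddf0; apply: (sf0 sK).
have mixed E s f g W : good E s -> E Ia -> E Ic ->
    K (der f) -> K (der g) -> der W = der f * Ia + der g * Ic ->
    exists E' s', [/\ good E' s', forall a, E a -> E' a & E' W].
  move=> g' Ea Ec Kf Kg dW; have [dE hs KE sfix _] := g'; have [sE _ _] := dE.
  have [a ha] := shift_first hs sfix Ea K_dIa.
  have [b hb] := shift_first hs sfix Ec K_dIc.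
  apply: (step E s W (W + cstC a * f + cstC b * g) g').
    by rewrite dW; apply: (sfD sE); apply: (sfM sE) => //; apply: KE.
  by rewrite (shift_second_level dE hs KE sfix Ea Ec Kf Kg dW ha hb).
have [E1 [s1 [g1 _ E1a]]] := first _ _ Ia g0 K_dIa.
have [E2 [s2 [g2 sub2 E2c]]] := first _ _ Ic g1 K_dIc.
have [E3 [s3 [g3 sub3 E3Pa]]] := first _ _ Pa g2 KdPa.
have [E4 [s4 [g4 sub4 E4Pc]]] := first _ _ Pc g3 KdPc.
have [E4a E4c] : E4 Ia /\ E4 Ic.
  by split; apply: sub4; apply: sub3 => //; apply: sub2.
have [|E5 [s5 [g5 sub5 E52a]]] := mixed E4 s4 Pa 0 P2a g4 E4a E4c KdPa Kd0.
  by rewrite dP2a dPa raddf0; ring.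
have [|||E6 [s6 [g6 sub6 E6ca]]] := mixed E5 s5 Pc Pa Pca g5 _ _ KdPc KdPa.
- exact: sub5.
- exact: sub5.
- by rewrite dPca dPc dPa derM; ring.
have sub46 a : E4 a -> E6 a by move=> /sub5 /sub6.
have [E6a E6c] := (sub46 _ E4a, sub46 _ E4c).
have [dE6 hs6 KE6 fix6 _] := g6; have [sE6 _ _] := dE6.
have [a ha] := shift_first hs6 fix6 E6a K_dIa.
have [b hb] := shift_first hs6 fix6 E6c K_dIc.
have [||E7 [s7 [g7 sub7 E7c2a]]] := step E6 s6 Pc2a (Pc2a + 2%:R * cstC a * Pca +
  cstC a ^+ 2 * Pc + 2%:R * cstC b * P2a + 2%:R * cstC a * cstC b * Pa) g6.
- rewrite dPc2a; apply: (sfM sE6); first exact: KE6.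
  have dI := KE6 _ K_dIa; have dIc := KE6 _ K_dIc.
  rewrite derM der_sqr; have n2 := sf_nat sE6 2.
  apply: (sfD sE6); apply: (sfM sE6) => //; first exact: (sfX sE6).
  by apply: (sfM sE6) => //; apply: (sfM sE6).
- by rewrite (shift_third_level dE6 hs6 KE6 fix6 E6a E6c ha hb).
have sub47 u : E4 u -> E7 u by move=> /sub46 /sub7.
have [dE7 hs7 KE7 fix7 [_ hh]] := g7; have [sE7 _ _] := dE7.
have FE7 : F `<=` E7.
  apply: adjoin_min => // [u Ku|_ [i [j ->]]]; first by apply: KE7; apply: K0_K.
  apply: (pv_entries_in (U := E7)) => //.
  - exact: (sfB sE7).
  - exact: (sfM sE7).
  - exact: sub47.
  - exact: sub47.
  - by apply: sub47; apply: sub4.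
  - exact: sub47.
  - by apply: sub7; apply: sub6.
  - exact: sub7.
exists s7; split=> //; first exact: diff_embedding_sub FE7 hs7.
rewrite hh => /eqP; rewrite -subr_eq0 addrAC subrr add0r.
by rewrite oner_eq0.
Qed.

(** Every generator of F over K is translated by an element on which s is already
    known to be unipotent. *)
Lemma K_emb_unipotent s : diff_embedding F s -> (forall a, K a -> s a = a) ->
  exists N, forall i j, iter N (fun a => s a - a) (Y i j) = 0.
Proof.
move=> hs sfix; have fix0 a : K0 a -> s a = a by move=> Ka; apply: sfix; apply: K0_K.
have hst := emb_stable dK0 VE2_K0 hY hs fix0.
have FD := F_dsub; pose U := unipotent_at F s.
have Ufix u : K u -> U u.
  by move=> Ku; apply: unipotent_at_fixed; [exact: K_F|exact: sfix].
have UM := unipotent_atM FD hs hst; have UB := unipotent_atB FD hs hst.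
have UD := unipotent_atD FD hs hst.
have UC c : U (cstC c) by exact: Ufix.
have Ushift t u c : F t -> U u -> s t = t + u + cstC c -> U t.
  move=> Ft Uu e; apply: unipotent_at_shift => //.
  have -> : s t - t = u + cstC c by rewrite e; ring.
  exact: (UD _ _ Uu (UC c)).
have U0 : U 0 by apply: Ufix; apply: (sf0 sK).
have Ufirst t : F t -> K (der t) -> U t.
  move=> Ft Kt; have [c hc] := shift_first hs sfix Ft Kt.
  by apply: (Ushift t 0 c) => //; rewrite hc addr0.
have [FIa FIc] := (F_Ia, F_Ic).
have KdPa : K (der Pa) by rewrite dPa; apply: (sfM sK) => //; exact: K_dIa.
have KdPc : K (der Pc) by rewrite dPc; apply: (sfM sK) => //; exact: K_dIc.
have Kd0 : K (der (0 : L)) by rewrite raddf0; apply: (sf0 sK).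
have UPa : U Pa by apply: Ufirst.
have UPc : U Pc by apply: Ufirst => //; exact: F_Pc.
have [a ha] := shift_first hs sfix FIa K_dIa.
have [b hb] := shift_first hs sfix FIc K_dIc.
have Umixed f g W : F W -> U f -> U g -> K (der f) -> K (der g) ->
    der W = der f * Ia + der g * Ic -> U W.
  move=> FW Uf Ug Kf Kg dW.
  have := shift_second_level FD hs K_F sfix FIa FIc Kf Kg dW ha hb.
  move/esym/(shift_primitive hs FW) => [c hc].
  apply: (Ushift W (cstC a * f + cstC b * g) c) => //; last by rewrite hc; ring.
  by apply: UD; apply: UM => //; exact: UC.
have UP2a : U P2a.
  by apply: (Umixed Pa 0) => //; rewrite dP2a dPa raddf0; ring.
have UPca : U Pca.
  by apply: (Umixed Pc Pa) => //; rewrite dPca dPc dPa derM; ring.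
have UPc2a : U Pc2a.
  have := shift_third_level FD hs K_F sfix FIa FIc ha hb.
  move/esym/(shift_primitive hs FPc2a) => [c hc].
  apply: (Ushift Pc2a (2%:R * cstC a * Pca + cstC a ^+ 2 * Pc +
                      2%:R * cstC b * P2a + 2%:R * cstC a * cstC b * Pa) c) => //.
    have U2 : U 2%:R by apply: Ufix; apply: (sf_nat sK).
    have U2a : U (2%:R * cstC a) := UM _ _ U2 (UC a).
    have Uaa : U (cstC a ^+ 2) by rewrite -rmorphXn.
    have U2b : U (2%:R * cstC b) := UM _ _ U2 (UC b).
    have p1 := UD _ _ (UM _ _ U2a UPca) (UM _ _ Uaa UPc).
    exact: (UD _ _ (UD _ _ p1 (UM _ _ U2b UP2a)) (UM _ _ (UM _ _ U2a (UC b)) UPa)).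
  by rewrite hc; ring.
have UY i j : U (Y i j).
  by apply: (pv_entries_in (U := U)) => //; apply: Ufirst => //; [exact: K_dIa|exact: K_dIc].
have hN (ij : 'I_7 * 'I_7) : exists N, iter N (fun a => s a - a) (Y ij.1 ij.2) = 0.
  by case: (UY ij.1 ij.2).
have [N hN'] := choice hN; exists (\max_ij N ij)%N => i j.
exact: (iter_shift_le hs (leq_bigmax (i, j)) (hN' (i, j))).
Qed.


Lemma virtually_abelian_commute s t : virtually_abelian K0 Y ->
  diff_embedding F s -> (forall a, K a -> s a = a) ->
  diff_embedding F t -> (forall a, K a -> t a = a) ->
  forall a, F a -> s (t a) = t (s a).
Proof.
move=> VA hs sfix ht tfix.
have key u : diff_embedding F u -> (forall a, K a -> u a = a) -> exists M,
    map_mx u Y = Y *m map_mx cstC M /\ identity_component (diff_galois K0 Y) M.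
  move=> hu ufix; have fix0 a : K0 a -> u a = a by move=> Ka; apply: ufix; apply: K0_K.
  have [M hM] := emb_fundamental dK0 VE2_K0 hY hu fix0; exists M; split=> //.
  have [N hN] := K_emb_unipotent hu ufix.
  have uM := emb_unipotent dK0 VE2_K0 hY hu hM hN.
  apply: (unipotent_identity_component dK0 VE2_K0 hY _ uM).
  exact: (emb_galois dK0 VE2_K0 hY hu fix0 hM).
have [M1 [e1 G1]] := key s hs sfix; have [M2 [e2 G2]] := key t ht tfix.
apply: (iffLR (emb_commute dK0 VE2_K0 hY hs _ ht _ e1 e2)).
- by move=> a Ka; apply: sfix; apply: K0_K.
- by move=> a Ka; apply: tfix; apply: K0_K.
- exact: VA.
Qed.

Lemma solution_fixed (s : L -> L) M (v : 'cV[L]_7) i :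
  identity_component (diff_galois K0 Y) M -> diff_embedding F s ->
  map_mx s Y = Y *m map_mx cstC M -> map_mx der v = VE2 ra rc omega *m v ->
  algebraic_over K0 (v i 0) -> s (v i 0) = v i 0.
Proof.
move=> GM hs hM /(solution_cst hY) [c ->] halg.
rewrite -[RHS](identity_component_fixes dK0 VE2_K0 hY GM halg) -hM.
have := emb_mx dK0 VE2_K0 hY c hs (@pv_entry _ _ _ K0 Y) => e.
by rewrite -e [RHS]mxE.
Qed.

Lemma algebraic_K0 a : algebraic_over Cz a -> algebraic_over K0 a.
Proof. by move=> [p [p0 pC rp]]; exists p; split=> // i; apply: Cz_K0. Qed.

Lemma identity_component_fixes_K (s : L -> L) M :
  identity_component (diff_galois K0 Y) M -> diff_embedding F s ->
  (forall a, K0 a -> s a = a) -> map_mx s Y = Y *m map_mx cstC M ->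
  forall a, K a -> s a = a.
Proof.
move=> GM hs sfix hM; have hsK := diff_embedding_sub K_F hs.
have hid := diff_embedding_id K.
apply: (emb_adjoin_eq dK hsK hid) => [a|_ [->|->]]; first exact: sfix.
  have := solution_fixed (i := inord 5) GM hs hM (col7_solution y1_solution).
  rewrite mxE inordK //=; apply; apply: algebraic_K0; by case: hy1.
have := solution_fixed (i := inord 0) GM hs hM (col7_solution x1_solution).
rewrite mxE inordK //=; apply; apply: algebraic_K0; by case: hx1.
Qed.

(** A first level integral J in a closed form of an element u of F is itself in F,
    being the difference of u and a polynomial in Ia, Ic. *)
Lemma closed_form_in (U : set L) u :
  (forall a b, U a -> U b -> U (a - b)) ->
  (forall a b, U a -> U b -> U (a * b)) -> (forall a, K a -> U a) ->
  (forall a, F a -> K (der a) -> U a) -> F u ->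
  closed_form K Ia Ic u -> U u.
Proof.
move=> UB UM UK Ufirst Fu [P [J [hP KJ e]]].
have U0 : U 0 by apply: UK; apply: (sf0 sK).
have UD a b : U a -> U b -> U (a + b).
  by move=> Ua Ub; rewrite -[b]opprK -[- b]sub0r; apply: (UB) => //; apply: UB.
have U1 : U 1 by apply: UK; apply: (sf1 sK).
have closure (V : set L) : V 0 -> V 1 -> (forall a b, V a -> V b -> V (a + b)) ->
    (forall a b, V a -> V b -> V (a * b)) -> (forall a, K a -> V a) -> V Ia -> V Ic ->
    V P.[Ia%:P].[Ic].
  move=> V0 V1 VD VM VK VIa VIc.
  have VX a n : V a -> V (a ^+ n).
    by move=> Va; elim: n => // n IH; rewrite exprS; apply: VM.
  rewrite (horner_coef P) horner_sum; apply: big_ind => // i _.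
  rewrite hornerM horner_exp hornerC; apply: (VM); last exact: VX.
  rewrite horner_coef; apply: big_ind => // j _.
  by apply: (VM); [exact: VK|exact: VX].
have [FIa FIc] := (F_Ia, F_Ic).
have FP : F P.[Ia%:P].[Ic].
  apply: closure => //; [exact: (sf0 sF)|exact: (sf1 sF)|exact: (sfD sF)|exact: (sfM sF)|].
  exact: K_F.
have FJ : F J.
  have -> : J = u - P.[Ia%:P].[Ic] by rewrite e; ring.
  exact: (sfB sF).
rewrite e; apply: (UD _ _); last exact: (Ufirst _ FJ KJ).
by apply: closure => //; [exact: (Ufirst _ FIa K_dIa)|exact: (Ufirst _ FIc K_dIc)].
Qed.

(** Both automorphisms fix K and translate first level integrals by constants, hence
    commute on everything that is in closed form. *)
Lemma closed_form_virtually_abelian :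
  closed_form K Ia Ic Pa -> closed_form K Ia Ic Pc -> closed_form K Ia Ic P2a ->
  closed_form K Ia Ic Pca -> closed_form K Ia Ic Pc2a ->
  virtually_abelian K0 Y.
Proof.
move=> cPa cPc cP2a cPca cPc2a M1 M2 G1 G2.
have sub M : identity_component (diff_galois K0 Y) M -> diff_galois K0 Y M.
  by case=> A [AG _ _ AM]; apply: AG.
have [s1 [h1 f1 e1]] := galois_emb dK0 (sub _ G1).
have [s2 [h2 f2 e2]] := galois_emb dK0 (sub _ G2).
apply: (iffRL (emb_commute dK0 VE2_K0 hY h1 f1 h2 f2 e1 e2)).
have k1 := identity_component_fixes_K G1 h1 f1 e1.
have k2 := identity_component_fixes_K G2 h2 f2 e2.
have st1 := emb_stable dK0 VE2_K0 hY h1 f1.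
have st2 := emb_stable dK0 VE2_K0 hY h2 f2.
have FD := F_dsub.
have c12 := diff_embedding_comp FD h1 h2 st2; have c21 := diff_embedding_comp FD h2 h1 st1.
apply: (emb_adjoin_eq FD c12 c21) => [a Ka|_ [i [j ->]]] /=.
  by rewrite (f2 _ Ka) (f1 _ Ka) (f2 _ Ka).
pose U := [set u | F u /\ s1 (s2 u) = s2 (s1 u)].
have UB a b : U a -> U b -> U (a - b).
  move=> [Fa ea] [Fb eb]; split; first exact: (sfB sF).
  have := embB c12 Fa Fb; have := embB c21 Fa Fb => /= -> ->.
  by rewrite ea eb.
have UM a b : U a -> U b -> U (a * b).
  move=> [Fa ea] [Fb eb]; split; first exact: (sfM sF).
  have := embM c12 Fa Fb; have := embM c21 Fa Fb => /= -> ->.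
  by rewrite ea eb.
have UK a : K a -> U a.
  by move=> Ka; split; [exact: K_F|rewrite (k2 _ Ka) (k1 _ Ka) (k2 _ Ka)].
have Ufirst a : F a -> K (der a) -> U a.
  move=> Fa Ka; split=> //.
  have [c hc] := shift_first h1 k1 Fa Ka; have [d hd] := shift_first h2 k2 Fa Ka.
  rewrite hd hc (embD FD h1) // (embD FD h2) // (emb_cst h1) (emb_cst h2) hc hd.
  ring.
have CU u := closed_form_in UB UM UK Ufirst (u := u).
have [FIa FIc] := (F_Ia, F_Ic).
suff [] : U (Y i j) by [].
apply: (pv_entries_in (U := U)) => //; try by [exact: CU
  |apply: Ufirst => //; [exact: K_dIa]|apply: Ufirst => //; exact: K_dIc].
by apply: CU => //; exact: F_Pc.
Qed.

End Integrals.
End Core.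

(** * Closed forms *)
Section ClosedForms.
Variables (R : realType) (L : diffExt R) (K : set L) (Ia Ic : L).
Hypothesis dK : diff_subfield K.
Let sK : subfield K. Proof. by case: dK. Qed.

Definition poly_form (u : L) :=
  exists2 P : {poly {poly L}}, forall i j, K (P`_i)`_j & u = P.[Ia%:P].[Ic].

Lemma poly_formK u : K u -> poly_form u.
Proof.
move=> Ku; exists u%:P%:P; last by rewrite !hornerC.
move=> i j; rewrite coefC; case: eqP => _; last by rewrite coef0; apply: (sf0 sK).
by rewrite coefC; case: eqP => _ //; apply: (sf0 sK).
Qed.

Lemma poly_form_Ia : poly_form Ia.
Proof.
exists 'X; last by rewrite hornerX hornerC.
move=> i j; rewrite coefX; case: (i == 1%N); rewrite ?mulr1n ?mulr0n.
  by rewrite coef1; apply: (sf_nat sK).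
by rewrite coef0; apply: (sf0 sK).
Qed.

Lemma poly_form_Ic : poly_form Ic.
Proof.
exists 'X%:P; last by rewrite hornerC hornerX.
move=> i j; rewrite coefC; case: eqP => _; last by rewrite coef0; apply: (sf0 sK).
by rewrite coefX; apply: (sf_nat sK).
Qed.

Lemma poly_formD u v : poly_form u -> poly_form v -> poly_form (u + v).
Proof.
move=> [P hP ->] [Q hQ ->]; exists (P + Q); last by rewrite !hornerD.
by move=> i j; rewrite !coefD; apply: (sfD sK).
Qed.

Lemma poly_formM u v : poly_form u -> poly_form v -> poly_form (u * v).
Proof.
move=> [P hP ->] [Q hQ ->]; exists (P * Q); last by rewrite !hornerM.
move=> i j; rewrite coefM coef_sum; apply: (sf_sum sK) => l _.
by rewrite coefM; apply: (sf_sum sK) => m _; apply: (sfM sK).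
Qed.

Lemma poly_formN u : poly_form u -> poly_form (- u).
Proof.
rewrite -mulN1r; apply: poly_formM; apply: poly_formK; apply: (sfN sK); exact: (sf1 sK).
Qed.

Lemma poly_formX u n : poly_form u -> poly_form (u ^+ n).
Proof.
move=> hu; elim: n => [|n IH]; last by rewrite exprS; apply: poly_formM.
by apply: poly_formK; apply: (sf1 sK).
Qed.

Lemma closed_form_of_der p u : poly_form p -> K (der u - der p) ->
  closed_form K Ia Ic u.
Proof.
move=> [P hP ->] h; exists P, (u - P.[Ia%:P].[Ic]); split=> //; last by ring.
by rewrite /first_level derB.
Qed.

End ClosedForms.

Ltac poly_form_solve := lazymatch goal with
  | |- poly_form _ _ _ (_ + _) => apply: poly_formD; [assumption|poly_form_solve|poly_form_solve]
  | |- poly_form _ _ _ (- _) => apply: poly_formN; [assumption|poly_form_solve]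
  | |- poly_form _ _ _ (_ * _) => apply: poly_formM; [assumption|poly_form_solve|poly_form_solve]
  | |- poly_form _ ?I _ ?I => apply: poly_form_Ia; assumption
  | |- poly_form _ _ ?I ?I => apply: poly_form_Ic; assumption
  | |- poly_form _ _ _ (_ ^+ _) => apply: poly_formX; [assumption|poly_form_solve]
  | |- _ => first [done | apply: poly_formK; [assumption|]; first [done | idtac]]
  end.

(** * Linear algebra of translations *)
Section CommutingShifts.
Variables (R : realType) (L : diffExt R) (K F : set L) (Ia Ic : L).
Hypotheses (dK : diff_subfield K) (dF : diff_subfield F) (KF : forall a, K a -> F a).
Hypotheses (FIa : F Ia) (FIc : F Ic) (KdIa : K (der Ia)) (KdIc : K (der Ic)).
Let sK : subfield K. Proof. by case: dK. Qed.
Let sF : subfield F. Proof. by case: dF. Qed.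
Let Kcst c : K (cstC c). Proof. by case: dK. Qed.

Definition diff_aut_over s := diff_embedding F s /\ forall a, K a -> s a = a.

Hypothesis moves : forall h, K (der h) -> ~ K h -> exists s, diff_aut_over s /\ s h <> h.
Hypothesis comm : forall s t, diff_aut_over s -> diff_aut_over t ->
  forall a, F a -> s (t a) = t (s a).
Hypothesis KIa : ~ K Ia.

(** Compare the constants in s (t W) and t (s W), where s W = W + a f + b g + const. *)
Lemma commuting_pairing f g W s t : F f -> F g -> F W ->
  K (der f) -> K (der g) -> der W = der f * Ia + der g * Ic ->
  diff_aut_over s -> diff_aut_over t ->
  (t Ia - Ia) * (s f - f) + (t Ic - Ic) * (s g - g) =
  (s Ia - Ia) * (t f - f) + (s Ic - Ic) * (t g - g).
Proof.
move=> Ff Fg FW Kf Kg dW as_ at_; have [hs fs] := as_; have [ht ft] := at_.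
have [a ha] := shift_first hs fs FIa KdIa; have [b hb] := shift_first hs fs FIc KdIc.
have [p hp] := shift_first hs fs Ff Kf; have [q hq] := shift_first hs fs Fg Kg.
have [a' ha'] := shift_first ht ft FIa KdIa; have [b' hb'] := shift_first ht ft FIc KdIc.
have [p' hp'] := shift_first ht ft Ff Kf; have [q' hq'] := shift_first ht ft Fg Kg.
have /esym/(shift_primitive hs FW) [w hw] :=
  shift_second_level dF hs KF fs FIa FIc Kf Kg dW ha hb.
have /esym/(shift_primitive ht FW) [w' hw'] :=
  shift_second_level dF ht KF ft FIa FIc Kf Kg dW ha' hb'.
have Fc c : F (cstC c) by apply: KF.
have expand u c d e : diff_embedding F u -> u (W + cstC c * f + cstC d * g + cstC e) =
    u W + cstC c * u f + cstC d * u g + cstC e.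
  move=> hu; have F1 : F (cstC c * f) by apply: (sfM sF).
  have F2 : F (cstC d * g) by apply: (sfM sF).
  have F3 : F (W + cstC c * f) by apply: (sfD sF).
  have F4 : F (W + cstC c * f + cstC d * g) by apply: (sfD sF).
  by rewrite !(embD dF hu) // !(embM hu) // !(emb_cst hu).
have := comm as_ at_ FW; rewrite hw hw' !expand // hw hw' ha hb hp hq ha' hb' hp' hq'.
move=> /eqP; rewrite -subr_eq0 => /eqP h; apply/eqP; rewrite -subr_eq0; apply/eqP.
by rewrite -[RHS]h; ring.
Qed.

Lemma shift_comb (s : L -> L) f g c d : diff_aut_over s -> F f -> F g ->
  s (f - cstC c * Ia - cstC d * g) = s f - cstC c * s Ia - cstC d * s g.
Proof.
move=> [hs fs] Ff Fg; have Fc e : F (cstC e) by apply: KF.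
have F1 : F (cstC c * Ia) by apply: (sfM sF).
have F2 : F (cstC d * g) by apply: (sfM sF).
have F3 : F (f - cstC c * Ia) by apply: (sfB sF).
by rewrite !(embB hs) // !(embM hs) // !(emb_cst hs).
Qed.

Lemma fixed_in_K h : K (der h) -> (forall s, diff_aut_over s -> s h = h) -> K h.
Proof. by move=> Kh fix_h; apply: contrapT => /(moves Kh) [s [/fix_h]]. Qed.

Lemma der_comb f g c d : K (der f) -> K (der g) ->
  K (der (f - cstC c * Ia - cstC d * g)).
Proof.
move=> Kf Kg; rewrite !derE !mul0r !add0r.
by apply: (sfB sK); [apply: (sfB sK) => //|]; apply: (sfM sK).
Qed.

(** The constant e is the ratio of the translations of f and Ia under one automorphism
    that moves Ia; then f - e Ia is fixed by all automorphisms. *)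
Lemma proportional_shift f : F f -> K (der f) ->
  (forall s t, diff_aut_over s -> diff_aut_over t ->
    (t Ia - Ia) * (s f - f) = (s Ia - Ia) * (t f - f)) ->
  exists e, K (f - cstC e * Ia).
Proof.
move=> Ff Kf prop; have [s [as_ sIa]] := moves KdIa KIa; have [hs fs] := as_.
have [a ha] := shift_first hs fs FIa KdIa; have [p hp] := shift_first hs fs Ff Kf.
have a0 : cstC a != 0 :> L.
  by apply/eqP => a0; apply: sIa; rewrite ha a0 addr0.
exists (p / a).
have -> : f - cstC (p / a) * Ia = f - cstC (p / a) * Ia - cstC 0 * Ia.
  by rewrite rmorph0; ring.
apply: fixed_in_K => [|t at_]; first exact: der_comb.
rewrite shift_comb // rmorph0 fmorph_div.
have := prop s t as_ at_; rewrite hp ha => h.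
have {}h : t f - f = cstC p / cstC a * (t Ia - Ia).
  by apply: (mulfI a0); move: h; rewrite !(addrC _ (cstC _)) !addrK => <-; field.
apply/eqP; rewrite -subr_eq0; apply/eqP.
have -> : t f - cstC p / cstC a * t Ia - 0 * t Ia - (f - cstC p / cstC a * Ia - 0 * Ia)
  = (t f - f) - cstC p / cstC a * (t Ia - Ia) by ring.
by rewrite h subrr.
Qed.

(** Cartan's lemma: if a ^ n + b ^ x = 0 for linear forms a, b, n, x, where ^ is
    the exterior product and a, b are independent, then (n, x) is a symmetric
    matrix times (a, b).  Here the forms are the translations of Ia, Ic, f, g, and
    two automorphisms on which a, b are independent let one solve for n and x by
    Cramer's rule; the relation between these two automorphisms is the symmetry. *)
Lemma cartan_shift f g W : F f -> F g -> F W ->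
  K (der f) -> K (der g) -> der W = der f * Ia + der g * Ic ->
  ~ dependent K Ia Ic ->
  exists a b c : R[i], K (f - cstC a * Ia - cstC b * Ic) /\
                       K (g - cstC b * Ia - cstC c * Ic).
Proof.
move=> Ff Fg FW Kf Kg dW indep.
have pair := commuting_pairing Ff Fg FW Kf Kg dW.
have [s [as_ sIa]] := moves KdIa KIa; have [hs fs] := as_.
have [a1 ha1] := shift_first hs fs FIa KdIa; have [b1 hb1] := shift_first hs fs FIc KdIc.
have [n1 hn1] := shift_first hs fs Ff Kf; have [x1 hx1] := shift_first hs fs Fg Kg.
have a10 : a1 != 0.
  by apply/eqP => a0; apply: sIa; rewrite ha1 a0 rmorph0 addr0.
have [t [at_ tm]] : exists t, diff_aut_over t /\
    t (cstC a1 * Ic - cstC b1 * Ia) <> cstC a1 * Ic - cstC b1 * Ia.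
  apply: moves.
    by rewrite !derE !mul0r !add0r; apply: (sfB sK); apply: (sfM sK).
  move=> h; apply: indep; exists (- b1), a1; split; first by right.
  by rewrite rmorphN mulNr addrC.
have [ht ft] := at_.
have [a2 ha2] := shift_first ht ft FIa KdIa; have [b2 hb2] := shift_first ht ft FIc KdIc.
have [n2 hn2] := shift_first ht ft Ff Kf; have [x2 hx2] := shift_first ht ft Fg Kg.
have D0 : a1 * b2 - b1 * a2 != 0.
  apply/eqP => D0; apply: tm; have Fc e : F (cstC e) by apply: KF.
  rewrite (embB ht) ?(embM ht) //; try exact: (sfM sF).
  rewrite !(emb_cst ht) ha2 hb2; apply/eqP; rewrite -subr_eq0; apply/eqP.
  transitivity (cstC (a1 * b2 - b1 * a2) : L).
    by rewrite rmorphB !rmorphM; ring.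
  by rewrite D0 rmorph0.
set D := a1 * b2 - b1 * a2 in D0.
have sym : a2 * n1 + b2 * x1 = a1 * n2 + b1 * x2.
  apply: (@cst_inj _ L); have := pair s t as_ at_.
  by rewrite ha1 hb1 hn1 hx1 ha2 hb2 hn2 hx2 !(addrC _ (cstC _)) !addrK !rmorphD !rmorphM.
pose al := (b2 * n1 - b1 * n2) / D; pose be := (b2 * x1 - b1 * x2) / D.
pose ga := (a1 * x2 - a2 * x1) / D.
have beE : be = (a1 * n2 - a2 * n1) / D.
  congr (_ / _); apply/eqP; rewrite -subr_eq0; apply/eqP.
  transitivity ((a2 * n1 + b2 * x1) - (a1 * n2 + b1 * x2)); first by ring.
  by rewrite sym subrr.
exists al, be, ga.
have solve u : diff_aut_over u ->
    u f - f = cstC al * (u Ia - Ia) + cstC be * (u Ic - Ic) /\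
    u g - g = cstC be * (u Ia - Ia) + cstC ga * (u Ic - Ic).
  move=> au; have e1 := pair s u as_ au; have e2 := pair t u at_ au.
  rewrite {2}beE /al /be /ga !fmorph_div /D !rmorphB !rmorphM.
  move: e1 e2; rewrite ha1 hb1 hn1 hx1 ha2 hb2 hn2 hx2 !(addrC _ (cstC _)) !addrK.
  set p := u Ia - Ia; set q := u Ic - Ic; set n := u f - f; set x := u g - g.
  have DL : (cstC a1 * cstC b2 - cstC b1 * cstC a2 : L) != 0.
    by rewrite -!rmorphM -rmorphB fmorph_eq0.
  move=> e1 e2; split; apply: (mulfI DL).
    transitivity (cstC b2 * (cstC a1 * n + cstC b1 * x) - cstC b1 * (cstC a2 * n + cstC b2 * x)).
      by ring.
    by rewrite -e1 -e2; field.
  transitivity (cstC a1 * (cstC a2 * n + cstC b2 * x) - cstC a2 * (cstC a1 * n + cstC b1 * x)).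
    by ring.
  by rewrite -e1 -e2; field.
split; (apply: fixed_in_K => [|u au]; first exact: der_comb);
  have [e1 e2] := solve u au; rewrite shift_comb //;
  apply/eqP; rewrite -subr_eq0; apply/eqP.
  by rewrite -[RHS](subrr (u f - f)) {2}e1; ring.
by rewrite -[RHS](subrr (u g - g)) {2}e2; ring.
Qed.

End CommutingShifts.

(** * Criteria for virtual abelianity *)
Section Criterion.
Variables (R : realType) (L : diffExt R) (k : int) (hk : 3 <= `|k|).
Variables (la lc : R[i]) (omega : L) (homega : is_omega k omega).
Local Notation ra := (rfun L k la).
Local Notation rc := (rfun L k lc).
Variable Y : 'M[L]_7.
Hypothesis hY : fundamental_matrix (VE2 ra rc omega) Y.
Variables (x1 y1 : L).
Hypothesis hx1 : algebraic_solution ra x1.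
Hypothesis hy1 : algebraic_solution rc y1.
Variables (Ia Ic : L).
Hypotheses (hIa : der Ia = x1 ^- 2) (hIc : der Ic = y1 ^- 2).
Local Notation K0 := (K0 omega).
Local Notation K := (Kalg omega x1 y1).
Local Notation F := (pv_ext K0 Y).
Local Notation VA := (virtually_abelian K0 Y).
Hypothesis KIa : ~ K Ia.

Let sK : subfield K := K_subfield omega x1 y1.
Let dK : diff_subfield K := K_dsub hk homega hx1 hy1.
Let Kcst c : K (cstC c). Proof. by case: dK. Qed.
Let dF : diff_subfield F := F_dsub hk homega hY.
Let sF : subfield F. Proof. by case: dF. Qed.
Let KF : forall a, K a -> F a := K_F hk homega hY hx1 hy1.
Let FIa : F Ia := F_Ia hk homega hY hx1 hy1 hIa.
Let FIc : F Ic := F_Ic hk homega hY hx1 hy1 hIc.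
Let KdIa : K (der Ia) := K_dIa hIa.
Let KdIc : K (der Ic) := K_dIc hIc.
Let Fcst c : F (cstC c) := KF (Kcst c).

Variables (Phi Pa Pc : L).
Hypotheses (dPhi : der Phi = omega * y1 * x1 ^+ 2) (KPhi : K Phi).
Hypotheses (dPa : der Pa = Phi * der Ia) (dPc : der Pc = Phi * der Ic).

Let KdPa : K (der Pa). Proof. by rewrite dPa; apply: (sfM sK). Qed.
Let KdPc : K (der Pc). Proof. by rewrite dPc; apply: (sfM sK). Qed.
Let FPc : F Pc := F_Pc hk homega hY hx1 hy1 hIc dPhi dPc.
Let second := second_level_integrals hk homega hY hx1 hy1 hIa hIc dPhi KPhi dPa.
Let FPa : F Pa. Proof. by case: second. Qed.

Lemma aut_moves h : K (der h) -> ~ K h -> exists s, diff_aut_over K F s /\ s h <> h.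
Proof.
have [_ [P2a [Pca [Pc2a [[F2 F3 F4] [d2 d3 d4]]]]]] := second => Kdh Kh.
have [s [h1 h2 h3]] := galois_moves hk homega hY hx1 hy1 hIa hIc dPhi KPhi dPa dPc
  d2 d3 d4 Kdh Kh.
by exists s.
Qed.

Lemma aut_commute : VA -> forall s t, diff_aut_over K F s -> diff_aut_over K F t ->
  forall a, F a -> s (t a) = t (s a).
Proof.
have [_ [P2a [Pca [Pc2a [[F2 F3 F4] [d2 d3 d4]]]]]] := second.
move=> va s t [s1 s2] [t1 t2].
exact: (virtually_abelian_commute hk homega hY hx1 hy1 hIa hIc dPhi KPhi dPa dPc
  FPa F2 F3 F4 d2 d3 d4 va s1 s2 t1 t2).
Qed.

(** The coefficient d is common to both relations, and becomes 0 when Phi is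
    replaced by Phi - d. *)
Definition normal_relations d e := K (Pa - cstC d * Ia) /\ K (Pc - cstC d * Ic - cstC e * Ia).

(** Commutation on Psi2a gives the first relation, and on Psica the second. *)
Lemma virtually_abelian_normal : VA -> exists d e, normal_relations d e.
Proof.
move=> va; have comm := aut_commute va.
have [_ [P2a [Pca [Pc2a [[F2 F3 F4] [d2 d3 d4]]]]]] := second.
have K0d : K (der (0 : L)) by rewrite raddf0; apply: (sf0 sK).
have [d hd] : exists d, K (Pa - cstC d * Ia).
  apply: (proportional_shift dK dF KF FIa KdIa aut_moves KIa) => // s t as_ at_.
  have e2 : der P2a = der Pa * Ia + der 0 * Ic by rewrite d2 dPa raddf0; ring.
  have := commuting_pairing dK dF KF FIa FIc KdIa KdIc comm FPa (sf0 sF) F2 KdPa K0d e2 as_ at_.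
  by have [hs _] := as_; have [ht _] := at_; rewrite (emb0 hs) (emb0 ht) subrr !mulr0 !addr0.
have fixd s : diff_aut_over K F s -> s Pa - Pa = cstC d * (s Ia - Ia).
  move=> [hs fs]; have := fs _ hd.
  rewrite (embB hs) ?(embM hs) ?(emb_cst hs) //; last exact: (sfM sF).
  move=> e; apply/eqP; rewrite -subr_eq0; apply/eqP.
  transitivity ((s Pa - cstC d * s Ia) - (Pa - cstC d * Ia)); first by ring.
  by rewrite e subrr.
exists d; suff [e he] : exists e, K (Pc - cstC d * Ic - cstC e * Ia) by exists e.
apply: (proportional_shift dK dF KF FIa KdIa aut_moves KIa).
- by apply: (sfB sF) => //; apply: (sfM sF).
- rewrite !derE mul0r add0r; apply: (sfB sK) => //; exact: (sfM sK).
move=> s t as_ at_.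
have e2 : der Pca = der Pc * Ia + der Pa * Ic by rewrite d3 dPa dPc derM; ring.
have := commuting_pairing dK dF KF FIa FIc KdIa KdIc comm FPc FPa F3 KdPc KdPa e2 as_ at_.
rewrite (fixd s as_) (fixd t at_).
have shE u : diff_aut_over K F u -> u (Pc - cstC d * Ic) = u Pc - cstC d * u Ic.
  move=> [hu _]; rewrite (embB hu) ?(embM hu) ?(emb_cst hu) //; exact: (sfM sF).
rewrite (shE s as_) (shE t at_) => h; apply/eqP; rewrite -subr_eq0; apply/eqP.
move/eqP: h; rewrite -subr_eq0 => /eqP h; rewrite -[RHS]h; ring.
Qed.

Lemma Ic_of_dependent : dependent K Ia Ic -> exists theta, K (Ic - cstC theta * Ia).
Proof.
move=> [a [b [ab0 h]]]; have [b0|b0] := eqVneq b 0.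
  exfalso; apply: KIa; have a0 : a != 0 by case: ab0 => //; rewrite b0 eqxx.
  have -> : Ia = (cstC a)^-1 * (cstC a * Ia + cstC b * Ic).
    by rewrite b0 rmorph0; field; rewrite fmorph_eq0.
  by apply: (sfM sK) => //; apply: (sfV sK).
exists (- a / b).
have -> : Ic - cstC (- a / b) * Ia = (cstC b)^-1 * (cstC a * Ia + cstC b * Ic).
  by rewrite fmorph_div rmorphN; field; rewrite fmorph_eq0.
by apply: (sfM sK) => //; apply: (sfV sK).
Qed.

Lemma dependent_sym : dependent K Ic Ia -> dependent K Ia Ic.
Proof. by move=> [a [b [ab h]]]; exists b, a; split; [case: ab; [right|left]|rewrite addrC]. Qed.

(** When the coefficients of Ia in Psia and of Ic in Psic differ, the relation between
    Ia and Ic allows one to change the second. *)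
Lemma cond_normal : cond1 K Ia Pa -> cond2 K Ia Ic Pc ->
  cond3 K Ia Ic Pa Pc \/ dependent K Ia Ic -> exists d e, normal_relations d e.
Proof.
move=> [d hd] [dc [e he]] h; exists d.
have [ecd|ncd] := eqVneq dc d; first by exists e; split=> //; rewrite -ecd.
have /Ic_of_dependent [theta ht] : dependent K Ia Ic.
  by case: h => // h3; apply: dependent_sym; apply: (h3 d dc e).
exists (e + (dc - d) * theta); split=> //.
have -> : Pc - cstC d * Ic - cstC (e + (dc - d) * theta) * Ia =
   (Pc - cstC dc * Ic - cstC e * Ia) + cstC (dc - d) * (Ic - cstC theta * Ia).
  by rewrite rmorphD rmorphM rmorphB; ring.
by apply: (sfD sK) => //; apply: (sfM sK).
Qed.

Lemma normal_unique_d d e d' : normal_relations d e -> K (Pa - cstC d' * Ia) -> d' = d.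
Proof.
move=> [h _] h'; apply/eqP/negPn/negP => n; apply: KIa.
have n0 : cstC (d' - d) != 0 :> L by rewrite fmorph_eq0 subr_eq0.
have -> : Ia = (cstC (d' - d))^-1 * ((Pa - cstC d * Ia) - (Pa - cstC d' * Ia)).
  by apply: (mulfI n0); rewrite mulVKf // rmorphB; ring.
by apply: (sfM sK); [exact: (sfV sK)|exact: (sfB sK)].
Qed.

Lemma normal_cond d e : normal_relations d e ->
  [/\ cond1 K Ia Pa, cond2 K Ia Ic Pc & cond3 K Ia Ic Pa Pc].
Proof.
move=> n; have [h1 h2] := n; split; [by exists d|by exists d, e|].
move=> da dc d' /(normal_unique_d n) -> h ne.
exists (dc - d), (d' - e); split; first by left; rewrite subr_eq0.
have -> : cstC (dc - d) * Ic + cstC (d' - e) * Ia =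
  (Pc - cstC d * Ic - cstC e * Ia) - (Pc - cstC dc * Ic - cstC d' * Ia).
  by rewrite !rmorphB; ring.
exact: (sfB sK).
Qed.

(** The normal form solved for Psia, Psic; f and g are variables so that they stay
    folded in the computations of derivatives. *)
Section Normal.
Variables (d e : R[i]) (f g : L).
Hypotheses (Kf : K f) (Kg : K g).
Hypotheses (PaE : Pa = f + cstC d * Ia) (PcE : Pc = g + cstC d * Ic + cstC e * Ia).
Let two0 : (2%:R : L) != 0 := natS_neq0 L 1.
Let three0 : (3%:R : L) != 0 := natS_neq0 L 2.
Let K2 : K 2%:R^-1. Proof. by apply: (sfV sK); apply: (sf_nat sK). Qed.
Let K3 : K 3%:R^-1. Proof. by apply: (sfV sK); apply: (sf_nat sK). Qed.
Let Kn n : K n%:R. Proof. exact: (sf_nat sK). Qed.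
Let d2V : der (2%:R^-1 : L) = 0.
Proof. by rewrite derV der_nat oppr0 mul0r. Qed.
Let d3V : der (3%:R^-1 : L) = 0.
Proof. by rewrite derV der_nat oppr0 mul0r. Qed.
Let dphi_a : Phi * der Ia = der f + cstC d * der Ia.
Proof. by rewrite -dPa PaE !derE; ring. Qed.
Let dphi_c : Phi * der Ic = der g + cstC d * der Ic + cstC e * der Ia.
Proof. by rewrite -dPc PcE !derE; ring. Qed.

Lemma closed_form_Pa : closed_form K Ia Ic Pa.
Proof.
apply: (closed_form_of_der (p := 0)); last by rewrite raddf0 subr0.
by apply: (poly_formK _ _ dK); apply: (sf0 sK).
Qed.

Lemma closed_form_Pc : closed_form K Ia Ic Pc.
Proof.
apply: (closed_form_of_der (p := 0)); last by rewrite raddf0 subr0.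
by apply: (poly_formK _ _ dK); apply: (sf0 sK).
Qed.

Lemma closed_form_P2a P2a : der P2a = Phi * der Ia * Ia -> closed_form K Ia Ic P2a.
Proof.
move=> h; apply: (closed_form_of_der (p := f * Ia + cstC d * Ia ^+ 2 / 2%:R)).
  by poly_form_solve.
have -> : der P2a - der (f * Ia + cstC d * Ia ^+ 2 / 2%:R) = - (f * der Ia).
  by rewrite h dphi_a derD !derM ?der_sqr !d2V !der_cst; field.
by apply: (sfN sK); apply: (sfM sK).
Qed.

Lemma closed_form_Pca Pca : der Pca = Phi * der (Ic * Ia) -> closed_form K Ia Ic Pca.
Proof.
move=> h; apply: (closed_form_of_der
  (p := g * Ia + cstC e * Ia ^+ 2 / 2%:R + cstC d * Ia * Ic + f * Ic)); first by poly_form_solve.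
have -> : der Pca - der (g * Ia + cstC e * Ia ^+ 2 / 2%:R + cstC d * Ia * Ic + f * Ic)
    = - (g * der Ia + f * der Ic).
  transitivity (Phi * der Ic * Ia + Phi * der Ia * Ic -
      der (g * Ia + cstC e * Ia ^+ 2 / 2%:R + cstC d * Ia * Ic + f * Ic)).
    by rewrite h derM; ring.
  by rewrite dphi_a dphi_c !derD !derM ?der_sqr !d2V !der_cst; field.
by apply: (sfN sK); apply: (sfD sK); apply: (sfM sK).
Qed.

Lemma closed_form_X X : der X = Pa * der Ia -> closed_form K Ia Ic X.
Proof.
move=> h; apply: (closed_form_of_der (p := cstC d * Ia ^+ 2 / 2%:R)); first by poly_form_solve.
have -> : der X - der (cstC d * Ia ^+ 2 / 2%:R) = f * der Ia.
  by rewrite h PaE !derM ?der_sqr !d2V !der_cst; field.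
exact: (sfM sK).
Qed.

Lemma closed_form_M M : der M = Pc * der Ia + Pa * der Ic -> closed_form K Ia Ic M.
Proof.
move=> h; apply: (closed_form_of_der
  (p := cstC d * Ia * Ic + cstC e * Ia ^+ 2 / 2%:R)); first by poly_form_solve.
have -> : der M - der (cstC d * Ia * Ic + cstC e * Ia ^+ 2 / 2%:R) = g * der Ia + f * der Ic.
  by rewrite h PaE PcE !derD !derM ?der_sqr !d2V !der_cst; field.
by apply: (sfD sK); apply: (sfM sK).
Qed.

Lemma virtually_abelian_of_closed P : der P = Phi * der (Ic * Ia ^+ 2) ->
  closed_form K Ia Ic P -> VA.
Proof.
have [_ [P2a [Pca [Pc2a [[F2 F3 F4] [d2 d3 d4]]]]]] := second.
move=> dP cP; have [c hc] : exists c, P = Pc2a + cstC c by apply: der_inj; rewrite dP d4.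
have FP : F P by rewrite hc; apply: (sfD sF).
exact: (closed_form_virtually_abelian hk homega hY hx1 hy1 hIa hIc dPhi KPhi dPa dPc
   FPa F2 F3 FP d2 d3 dP closed_form_Pa closed_form_Pc (closed_form_P2a d2)
   (closed_form_Pca d3) cP).
Qed.

(** Integration by parts: X and N are, up to polynomials, - Psi2a and - Psica. *)
Lemma reduced_primitives : exists X N, [/\ F X, F N, der X = f * der Ia &
  der N = g * der Ia + f * der Ic].
Proof.
have [_ [P2a [Pca [Pc2a [[F2 F3 F4] [d2 d3 d4]]]]]] := second.
have [Ff Fg F12] := And3 (KF Kf) (KF Kg) (KF K2).
have m a b : F a -> F b -> F (a * b) by exact: (sfM sF).
have p a b : F a -> F b -> F (a + b) by exact: (sfD sF).
have F1 := m _ _ (Fcst d) (sfX sF 2 FIa); have F1' := m _ _ (Fcst e) (sfX sF 2 FIa).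
have F5 := m _ _ (m _ _ (Fcst d) FIa) FIc.
exists (f * Ia + cstC d * Ia ^+ 2 / 2%:R - P2a),
  (g * Ia + cstC e * Ia ^+ 2 / 2%:R + cstC d * Ia * Ic + f * Ic - Pca); split.
- by apply: (sfB sF) => //; apply: (p _ _); apply: (m _ _).
- apply: (sfB sF) => //.
  by apply: (p _ _); [apply: (p _ _); [apply: (p _ _)|]|]; do ?[exact: F5|apply: (m _ _)].
- by rewrite derB d2 dphi_a derD !derM ?der_sqr !d2V !der_cst; field.
- rewrite derB d3.
  transitivity (der (g * Ia + cstC e * Ia ^+ 2 / 2%:R + cstC d * Ia * Ic + f * Ic) -
    (Phi * der Ic * Ia + Phi * der Ia * Ic)); first by rewrite derM; ring.
  by rewrite dphi_a dphi_c !derD !derM ?der_sqr !d2V !der_cst; field.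
Qed.

Section Reduced.
Variables (X N : L).
Hypotheses (dX : der X = f * der Ia) (dN : der N = g * der Ia + f * der Ic).

Let KdX : K (der X). Proof. by rewrite dX; apply: (sfM sK). Qed.
Let KdN : K (der N). Proof. by rewrite dN; apply: (sfD sK); apply: (sfM sK). Qed.

(** Integrating Phi (Ic Ia^2)' = Psic' Ia^2 + 2 Psia' Ia Ic by parts leaves
    - 2 (g Ia' Ia + f Ic' Ia + f Ia' Ic) = - 2 (N' Ia + X' Ic). *)
Lemma third_level_reduction : exists Q, [/\ poly_form K Ia Ic Q, F Q &
  Phi * der (Ic * Ia ^+ 2) = der Q - 2%:R * (der N * Ia + der X * Ic)].
Proof.
exists (cstC d * Ic * Ia ^+ 2 + cstC e * (Ia * Ia ^+ 2) / 3%:R + g * Ia ^+ 2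
   + 2%:R * f * Ia * Ic); split.
- by poly_form_solve; exact: Kn.
- have [Ff Fg F13] := And3 (KF Kf) (KF Kg) (KF K3).
  have m a b : F a -> F b -> F (a * b) by exact: (sfM sF).
  have FII := sfX sF 2 FIa.
  apply: (sfD sF); [apply: (sfD sF); [apply: (sfD sF)|]|]; repeat (apply: (m _ _) => //).
  exact: KF.
- transitivity ((Phi * der Ic) * Ia ^+ 2 + 2%:R * (Phi * der Ia) * Ia * Ic).
    by rewrite derM der_sqr; ring.
  rewrite dphi_a dphi_c dX dN !derD !derM ?der_sqr !d3V !der_cst der_nat; field.
  exact: three0.
Qed.

Lemma pv_primitives : F X /\ F N.
Proof.
have [X0 [N0 [FX FN dX0 dN0]]] := reduced_primitives.
have [c ->] : exists c, X = X0 + cstC c by apply: der_inj; rewrite dX dX0.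
have [c' ->] : exists c, N = N0 + cstC c by apply: der_inj; rewrite dN dN0.
by split; apply: (sfD sF).
Qed.

Lemma third_level_integral : exists2 W, F W & der W = der N * Ia + der X * Ic.
Proof.
have [_ [P2a [Pca [Pc2a [[F2 F3 F4] [d2 d3 d4]]]]]] := second.
have [Q [_ FQ dQ]] := third_level_reduction.
exists ((Q - Pc2a) / 2%:R).
  by apply: (sfM sF); [exact: (sfB sF)|exact: KF].
by rewrite derM derB d4 dQ d2V; field.
Qed.

Lemma virtually_abelian_independent : VA -> ~ dependent K Ia Ic ->
  exists a b c : R[i], K (N - cstC a * Ia - cstC b * Ic) /\
                       K (X - cstC b * Ia - cstC c * Ic).
Proof.
move=> va; have [FX FN] := pv_primitives; have [W FW dW] := third_level_integral.
exact: (cartan_shift dK dF KF FIa FIc KdIa KdIc aut_moves (aut_commute va) KIa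
  FN FX FW KdN KdX dW).
Qed.

(** The translations of Ic are theta times those of Ia, so the symmetric pairing
    involves N and X only through N + theta X. *)
Lemma virtually_abelian_dependent theta : VA -> K (Ic - cstC theta * Ia) ->
  exists a, K (N + cstC theta * X - cstC a * Ia).
Proof.
move=> va hth; have [FX FN] := pv_primitives; have [W FW dW] := third_level_integral.
apply: (proportional_shift dK dF KF FIa KdIa aut_moves KIa).
- by apply: (sfD sF) => //; apply: (sfM sF).
- by rewrite !derE mul0r add0r; apply: (sfD sK) => //; apply: (sfM sK).
move=> s t as_ at_.
have fixt u : diff_aut_over K F u -> u Ic - Ic = cstC theta * (u Ia - Ia).
  move=> [hu fu]; have := fu _ hth.
  rewrite (embB hu) ?(embM hu) ?(emb_cst hu) //; last exact: (sfM sF).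
  move=> h; apply/eqP; rewrite -subr_eq0; apply/eqP.
  transitivity ((u Ic - cstC theta * u Ia) - (Ic - cstC theta * Ia)); first by ring.
  by rewrite h subrr.
have shE u : diff_aut_over K F u -> u (N + cstC theta * X) = u N + cstC theta * u X.
  by move=> [hu _]; rewrite (embD dF hu) ?(embM hu) ?(emb_cst hu) //; apply: (sfM sF).
have := commuting_pairing dK dF KF FIa FIc KdIa KdIc (aut_commute va) FN FX FW KdN KdX dW as_ at_.
rewrite (fixt s as_) (fixt t at_) (shE s as_) (shE t at_) => h.
apply/eqP; rewrite -subr_eq0; apply/eqP.
move/eqP: h; rewrite -subr_eq0 => /eqP h; rewrite -[RHS]h; ring.
Qed.

Lemma closed_independent P a b c : der P = Phi * der (Ic * Ia ^+ 2) ->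
  K (N - cstC a * Ia - cstC b * Ic) -> K (X - cstC b * Ia - cstC c * Ic) ->
  closed_form K Ia Ic P.
Proof.
set n := N - _ - _; set x := X - _ - _ => dP Kn' Kx.
have [Q [pQ _ dQ]] := third_level_reduction.
pose q := cstC a * Ia ^+ 2 / 2%:R + cstC b * Ia * Ic + cstC c * Ic ^+ 2 / 2%:R
  + n * Ia + x * Ic.
apply: (closed_form_of_der (p := Q - 2%:R * q)).
  by rewrite /q; poly_form_solve; exact: Kn.
have -> : der P - der (Q - 2%:R * q) = 2%:R * (n * der Ia + x * der Ic).
  rewrite dP dQ derB [der (_ * q)]derM der_nat /q !derD !derM ?der_sqr !d2V !der_cst.
  have -> : der N = der n + cstC a * der Ia + cstC b * der Ic.
    by rewrite /n !derE; ring.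
  have -> : der X = der x + cstC b * der Ia + cstC c * der Ic.
    by rewrite /x !derE; ring.
  by field.
by apply: (sfM sK) => //; apply: (sfD sK); apply: (sfM sK).
Qed.

Lemma closed_dependent P theta a : der P = Phi * der (Ic * Ia ^+ 2) ->
  K (Ic - cstC theta * Ia) -> K (N + cstC theta * X - cstC a * Ia) ->
  closed_form K Ia Ic P.
Proof.
set ka := Ic - _; set m := _ + _ - _ => dP Kka Km.
have [Q [pQ _ dQ]] := third_level_reduction.
pose q := cstC a * Ia ^+ 2 / 2%:R + m * Ia.
apply: (closed_form_of_der (p := Q - 2%:R * q)).
  by rewrite /q; poly_form_solve; exact: Kn.
have -> : der P - der (Q - 2%:R * q) = 2%:R * (m * der Ia - der X * ka).
  rewrite dP dQ derB [der (_ * q)]derM der_nat /q !derD !derM ?der_sqr !d2V !der_cst.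
  have -> : der N = der m + cstC a * der Ia - cstC theta * der X.
    by rewrite /m !derE; ring.
  have -> : Ic = ka + cstC theta * Ia by rewrite /ka subrK.
  by field.
by apply: (sfM sK) => //; apply: (sfB sK); apply: (sfM sK).
Qed.

Lemma virtually_abelian_iff_independent : ~ dependent K Ia Ic ->
  (VA <-> exists a b c : R[i], K (N - cstC a * Ia - cstC b * Ic) /\
                               K (X - cstC b * Ia - cstC c * Ic)).
Proof.
move=> indep; split=> [va|[a [b [c [h1 h2]]]]].
  exact: virtually_abelian_independent.
have [_ [_ [_ [P [_ [_ _ dP]]]]]] := second.
exact: (virtually_abelian_of_closed dP (closed_independent dP h1 h2)).
Qed.

Lemma virtually_abelian_iff_dependent theta : K (Ic - cstC theta * Ia) ->
  (VA <-> exists a, K (N + cstC theta * X - cstC a * Ia)).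
Proof.
move=> hth; split=> [va|[a ha]]; first exact: virtually_abelian_dependent.
have [_ [_ [_ [P [_ [_ _ dP]]]]]] := second.
exact: (virtually_abelian_of_closed dP (closed_dependent dP hth ha)).
Qed.

End Reduced.

Lemma closed_of_virtually_abelian P : VA -> der P = Phi * der (Ic * Ia ^+ 2) ->
  closed_form K Ia Ic P.
Proof.
move=> va dP; have [X [N [_ _ dX dN]]] := reduced_primitives.
have [/Ic_of_dependent [theta hth]|indep] := pselect (dependent K Ia Ic).
  have [a ha] := virtually_abelian_dependent dX dN va hth.
  exact: (closed_dependent dX dN dP hth ha).
have [a [b [c [h1 h2]]]] := virtually_abelian_independent dX dN va indep.
exact: (closed_independent dX dN dP h1 h2).
Qed.

End Normal.
End Criterion.

Theorem theorem5 (R : realType) (L : diffExt R)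
  (k : int) (hk : 3 <= `|k|)
  (la lc : R[i])
  (* Wa, Wc generate the Picard-Vessiot extensions of w'' = r w over C(z) *)
  (Wa Wc : 'M[L]_2)
  (hWa : fundamental_matrix (companion (rfun L k la)) Wa)
  (hWc : fundamental_matrix (companion (rfun L k lc)) Wc)
  (hGa : galois_component_Ga Cz Wa)
  (hGc : galois_component_Ga Cz Wc)
  (omega : L) (homega : is_omega k omega)
  (* Y generates the Picard-Vessiot extension F / K_0 of VE_2 *)
  (Y : 'M[L]_7)
  (hY : fundamental_matrix (VE2 (rfun L k la) (rfun L k lc) omega) Y)
  (x1 y1 : L)
  (hx1 : algebraic_solution (rfun L k la) x1)
  (hy1 : algebraic_solution (rfun L k lc) y1)
  (Ia Ic : L) (hIa : der Ia = x1 ^- 2) (hIc : der Ic = y1 ^- 2)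
  (Phi : L) (hPhi : der Phi = omega * y1 * x1 ^+ 2)
  (hPhiK : Kalg omega x1 y1 Phi)
  (Psia Psic : L)
  (hPsia : der Psia = Phi * der Ia)
  (hPsic : der Psic = Phi * der Ic) :
  let K := Kalg omega x1 y1 in
  let VA := virtually_abelian (K0 omega) Y in
  (* 1, 2, 3 *)
  (VA -> [/\ cond1 K Ia Psia, cond2 K Ia Ic Psic & cond3 K Ia Ic Psia Psic])
  /\
  (* 4 *)
  (cond1 K Ia Psia -> cond2 K Ia Ic Psic -> cond3 K Ia Ic Psia Psic ->
   [/\ [/\ closed_form K Ia Ic Psia,
           closed_form K Ia Ic Psic,
           forall Psi2a : L, der Psi2a = Phi * der Ia * Ia ->
             closed_form K Ia Ic Psi2a &
           forall Psica : L, der Psica = Phi * der (Ic * Ia) ->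
             closed_form K Ia Ic Psica],
       forall X : L, der X = Psia * der Ia -> closed_form K Ia Ic X,
       forall M : L, der M = Psic * der Ia + Psia * der Ic ->
         closed_form K Ia Ic M &
       forall Psic2a : L, der Psic2a = Phi * der (Ic * Ia ^+ 2) ->
         (VA <-> closed_form K Ia Ic Psic2a)])
  /\
  (* 5 *)
  (cond1 K Ia Psia -> cond2 K Ia Ic Psic -> cond3 K Ia Ic Psia Psic ->
   ~ dependent K Ia Ic ->
   (exists! Phi' : L,
      [/\ der Phi' = omega * y1 * x1 ^+ 2,
          exists psia : L, der psia = Phi' * der Ia /\ K psia &
          exists (psic f : L) (d : R[i]),
            [/\ der psic = Phi' * der Ic, K f & psic = cstC d * Ia + f]])
   /\
   (forall (Phi' psia psic f X M : L) (d : R[i]),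
      der Phi' = omega * y1 * x1 ^+ 2 ->
      der psia = Phi' * der Ia -> der psic = Phi' * der Ic ->
      K psia -> K f -> psic = cstC d * Ia + f ->
      der X = psia * der Ia ->
      der M = psic * der Ia + psia * der Ic ->
      (VA <->
       exists (E : 'M[R[i]]_2) (G : 'cV[L]_2),
         [/\ forall i, K (G i 0),
             \col_(i < 2) [:: M; X]`_i =
               \col_(i < 2) [:: cstC d * Ia ^+ 2 / 2%:R; 0]`_i
               + map_mx cstC E *m \col_(i < 2) [:: Ia; Ic]`_i + G &
             E^T = E])))
  /\
  (* 6 *)
  (cond1 K Ia Psia -> cond2 K Ia Ic Psic -> dependent K Ia Ic ->
   (exists theta : R[i], K (Ic - cstC theta * Ia))
   /\
   (exists (Phi' psia psic : L) (e : R[i]),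
      [/\ der Phi' = omega * y1 * x1 ^+ 2,
          der psia = Phi' * der Ia, der psic = Phi' * der Ic,
          K psia & K (psic - cstC e * Ia)])
   /\
   (forall (theta e : R[i]) (Phi' psia psic X M : L),
      K (Ic - cstC theta * Ia) ->
      der Phi' = omega * y1 * x1 ^+ 2 ->
      der psia = Phi' * der Ia -> der psic = Phi' * der Ic ->
      K psia -> K (psic - cstC e * Ia) ->
      der X = psia * der Ia ->
      der M = psic * der Ia + psia * der Ic ->
      (VA <->
       exists (a : R[i]) (g : L),
         K g /\ M + cstC theta * X = cstC e / 2%:R * Ia ^+ 2 + cstC a * Ia + g))).
Proof.
move=> K VA.
have KIa : ~ K Ia := Ia_notin_K hk homega hx1 hy1 hWa hGa hIa.
have dK : diff_subfield K := K_dsub hk homega hx1 hy1.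
have sK : subfield K by case: dK.
have Kc c : K (cstC c) by case: dK.
have two0 : (2%:R : L) != 0 := natS_neq0 L 1.
have d2V : der (2%:R^-1 : L) = 0 by rewrite derV der_nat oppr0 mul0r.
have KPhi Phi' : der Phi' = omega * y1 * x1 ^+ 2 -> K Phi'.
  move=> h; have [c ->] := der_inj (etrans h (esym hPhi)).
  exact: (sfD sK).
split; [|split; [|split]].
- move=> va; have [d [e n]] :=
    virtually_abelian_normal hk homega hY hx1 hy1 hIa hIc KIa hPhi hPhiK hPsia hPsic va.
  exact: (normal_cond hk homega hx1 hy1 KIa n).
- move=> c1 c2 c3.
  have [d [e [Kf Kg]]] := cond_normal hk homega hx1 hy1 KIa c1 c2 (or_introl c3).
  have [f Ef] : exists f, f = Psia - cstC d * Ia by exists (Psia - cstC d * Ia).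
  have [g Eg] : exists g, g = Psic - cstC d * Ic - cstC e * Ia.
    by exists (Psic - cstC d * Ic - cstC e * Ia).
  rewrite -Ef in Kf; rewrite -Eg in Kg.
  have ea : Psia = f + cstC d * Ia by rewrite Ef; ring.
  have ec : Psic = g + cstC d * Ic + cstC e * Ia by rewrite Eg; ring.
  split; [split| | |].
  + exact: (closed_form_Pa hk homega hx1 hy1 Ic hIa hPhiK hPsia).
  + exact: (closed_form_Pc hk homega hx1 hy1 Ia hIc hPhiK hPsic).
  + by move=> P dP; exact: (closed_form_P2a hk homega hx1 hy1 Ic hIa hPsia Kf ea dP).
  + move=> P dP.
    exact: (closed_form_Pca hk homega hx1 hy1 hIa hIc hPsia hPsic Kf Kg ea ec dP).
  + by move=> X dX; exact: (closed_form_X hk homega hx1 hy1 Ic hIa Kf ea dX).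
  + by move=> M dM; exact: (closed_form_M hk homega hx1 hy1 hIa hIc Kf Kg ea ec dM).
  + move=> P dP; split=> h.
      exact: (closed_of_virtually_abelian hk homega hY hx1 hy1 hIa hIc KIa hPhi hPhiK
        hPsia hPsic Kf Kg ea ec h dP).
    exact: (virtually_abelian_of_closed hk homega hY hx1 hy1 hIa hIc hPhi hPhiK
        hPsia hPsic Kf Kg ea ec dP h).
- move=> c1 c2 c3 indep; split.
    have [d [e n]] := cond_normal hk homega hx1 hy1 KIa c1 c2 (or_introl c3).
    have [Kf Kg] := n; exists (Phi - cstC d); split.
      split; first by rewrite derB der_cst subr0.
        by exists (Psia - cstC d * Ia); split=> //; rewrite !derE hPsia; ring.
      exists (Psic - cstC d * Ic), (Psic - cstC d * Ic - cstC e * Ia), e.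
      by split=> //; [rewrite !derE hPsic|]; ring.
    (* psia fixes Phi': another constant would put a multiple of Ia in K *)
    move=> Phi' [hP [psia [dpsia Kpsia]] _].
    have [c hc] := der_inj (etrans hP (esym hPhi)).
    have [c' hc'] : exists c', psia = Psia + cstC c * Ia + cstC c'.
      by apply: der_inj; rewrite dpsia hc !derE hPsia; ring.
    have : K (Psia - cstC (- c) * Ia).
      have -> : Psia - cstC (- c) * Ia = psia - cstC c' by rewrite hc' rmorphN; ring.
      exact: (sfB sK).
    move/(normal_unique_d hk homega hx1 hy1 KIa n) => <-.
    by rewrite hc rmorphN opprK.
  move=> Phi' psia psic f X M d hP ha hc Ka Kf ec dX dM.
  (* a normal form with d = 0 *)
  have ea' : psia = psia + cstC 0 * Ia by rewrite rmorph0; ring.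
  have ec' : psic = f + cstC 0 * Ic + cstC d * Ia by rewrite ec rmorph0; ring.
  have dN : der (M - cstC d * Ia ^+ 2 / 2%:R) = f * der Ia + psia * der Ic.
    by rewrite derB dM ec !derM d2V der_cst; field.
  have := virtually_abelian_iff_independent hk homega hY hx1 hy1 hIa hIc KIa hP
    (KPhi _ hP) ha hc Ka Kf ea' ec' dX dN indep.
  move=> iff_; apply: (iff_trans iff_); split.
    move=> [a [b [c [h1 h2]]]].
    exists (\matrix_(i, j) nth 0 (nth [::] [:: [:: a; b]; [:: b; c]] i) j).
    exists (\col_i nth 0 [:: M - cstC d * Ia ^+ 2 / 2%:R - cstC a * Ia - cstC b * Ic;
       X - cstC b * Ia - cstC c * Ic] i); split.
    + by case=> [[|[|i]] //= hi]; rewrite mxE.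
    + apply/matrixP => i j; rewrite !mxE !big_ord_recl big_ord0 !mxE /=.
      by case: i => [[|[|i]] //= hi]; ring.
    + by apply/matrixP => [[[|[|i]] //= hi]] [[|[|j]] //= hj]; rewrite !mxE.
  move=> [E [G [KG eq symE]]].
  exists (E 0 0), (E 0 1), (E 1 1).
  have E10 : E 1 0 = E 0 1 by rewrite -{1}symE mxE.
  have o1 : lift ord0 ord0 = 1 :> 'I_2 by apply: val_inj.
  have /matrixP/(_ 0 0) := eq; have /matrixP/(_ 1 0) := eq.
  rewrite !mxE !big_ord_recl !big_ord0 !mxE /= !o1 E10 => e1 e0; split.
    have -> : M - cstC d * Ia ^+ 2 / 2%:R - cstC (E 0 0) * Ia - cstC (E 0 1) * Ic = G 0 0.
      by rewrite e0; ring.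
    exact: KG.
  have -> : X - cstC (E 0 1) * Ia - cstC (E 1 1) * Ic = G 1 0 by rewrite e1; ring.
  exact: KG.
- move=> c1 c2 dep.
  have [theta hth] := Ic_of_dependent hk homega hx1 hy1 KIa dep.
  split; first by exists theta.
  split.
    have [d [e [Kf Kg]]] := cond_normal hk homega hx1 hy1 KIa c1 c2 (or_intror dep).
    exists (Phi - cstC d), (Psia - cstC d * Ia), (Psic - cstC d * Ic), e; split=> //.
    + by rewrite derB der_cst subr0.
    + by rewrite !derE hPsia; ring.
    + by rewrite !derE hPsic; ring.
  move=> {theta hth} theta e Phi' psia psic X M hth hP ha hc Ka Kf dX dM.
  have ea' : psia = psia + cstC 0 * Ia by rewrite rmorph0; ring.
  have ec' : psic = (psic - cstC e * Ia) + cstC 0 * Ic + cstC e * Ia.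
    by rewrite rmorph0; ring.
  have dN : der (M - cstC e * Ia ^+ 2 / 2%:R) = (psic - cstC e * Ia) * der Ia + psia * der Ic.
    by rewrite derB dM !derM d2V der_cst; field.
  have := virtually_abelian_iff_dependent hk homega hY hx1 hy1 hIa hIc KIa hP
    (KPhi _ hP) ha hc Ka Kf ea' ec' dX dN hth.
  move=> iff_; apply: (iff_trans iff_); split=> [[a h]|[a [g [Kg h]]]]; exists a.
    exists (M - cstC e * Ia ^+ 2 / 2%:R + cstC theta * X - cstC a * Ia); split=> //.
    by ring.
  have -> : M - cstC e * Ia ^+ 2 / 2%:R + cstC theta * X - cstC a * Ia = g; last by [].
  transitivity (M + cstC theta * X - cstC e / 2%:R * Ia ^+ 2 - cstC a * Ia); first by ring.
  by rewrite h; ring.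
Qed.
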